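(* Let $X$ be a L\'evy process with $X_0=0$ and let $0\le b<1$. (a) Assume $X$ has bounded variation with drift $\mathrm{d}_X>0$. Then $$\lim_{\varepsilon\to 0}\lim_{r\to 0}\frac{E(\overline{T}_b(r)\wedge\varepsilon)}{C(r)}=1,$$ where $C(r)=(r/\mathrm{d}_X)^{1/(1-b)}$. (b) Fix a function $C(r)>0$. Then $T^*_b(r)/C(r)\to 1$ in probability as $r\to0$ if and only if $(T^*_b(r)\wedge\varepsilon)/C(r)\to 1$ in $L^p$ as $r\to 0$ for some (all) $p>0$ and some (all) $\varepsilon>0$. In particular, if $T^*_b(r)/C(r)\to 1$ in probability as $r\to 0$, then for every $p>0$ and $\varepsilon>0$ $$\lim_{r\to 0}\frac{E\big[(T^*_b(r)\wedge\varepsilon)^p\big]}{C(r)^p}=1.$$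
   Context: $X$ is a real-valued L\'evy process with triplet $(\gamma,\sigma^2,\Pi)$, i.e. $E e^{i\theta X_t}=e^{t\Psi(\theta)}$ with $\Psi(\theta)=i\theta\gamma-\sigma^2\theta^2/2+\int_{\mathbb{R}}(e^{i\theta x}-1-i\theta x\mathbf 1_{\{|x|\le1\}})\Pi(dx)$. If $X$ is of bounded variation (equivalently $\sigma=0$ and $\int_{|x|\le1}|x|\Pi(dx)<\infty$), its drift is $\mathrm{d}_X=\gamma-\int_{|x|\le 1}x\,\Pi(dx)$. For $r\ge 0$, $$\overline{T}_b(r)=\inf\{t\ge 0: X_t>rt^b\},\qquad T^*_b(r)=\inf\{t\ge 0:|X_t|>rt^b\},$$ with $\inf\emptyset=+\infty$ (and $t^0=1$ for all $t\ge0$). $u\wedge v=\min(u,v)$. Convergence $Z_r\to1$ in $L^p$ means $E|Z_r-1|^p\to0$, for any $p>0$. Limits as $r\to0$, $\varepsilon\to0$ are from above.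
   Formalization: In (b), the equivalence with L^p convergence for merely some p and some ε assumes X is not almost surely identically zero; for X ≡ 0 and C(r) ≡ ε it fails, since T* = +∞. *)

(* Defs.v *)
From mathcomp Require Import all_boot all_order all_algebra.
From mathcomp Require Import all_classical all_reals all_analysis.
From mathcomp Require Import complex.

Set Implicit Arguments.
Unset Strict Implicit.
Unset Printing Implicit Defensive.

Import Order.TTheory GRing.Theory Num.Theory.
Import numFieldNormedType.Exports.

Local Open Scope classical_set_scope.
Local Open Scope ring_scope.
Local Open Scope complex_scope.

Definition cexp {R : realType} (z : R[i]) : R[i] :=
  (expR (complex.Re z))%:C * (cos (complex.Im z) +i* sin (complex.Im z)).

(* The library integrates real-valued functions only: a complex-valued function
   is integrated through its real and imaginary parts. *)
Definition Cintegral {d} {T : measurableType d} {R : realType}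
    (mu : {measure set T -> \bar R}) (f : T -> R[i]) : R[i] :=
  (\int[mu]_x complex.Re (f x)) +i* (\int[mu]_x complex.Im (f x)).

Definition charfun {d} {T : measurableType d} {R : realType}
    (P : probability T R) (Y : T -> R) (theta : R) : R[i] :=
  Cintegral P (fun w => cexp ('i%C * (theta * Y w)%:C)).

(* Processes are indexed by the whole of R, but only their values at times
   t >= 0 are ever constrained or used.  All paths are càdlàg, which makes the
   passage times below measurable on an arbitrary probability space. *)
Record is_Levy {d} {T : measurableType d} {R : realType}
    (P : probability T R) (X : R -> {RV P >-> R}) : Prop := {
  Levy_start : {ae P, forall w, X 0 w = 0} ;
  Levy_cadlag_right : forall w t, 0 <= t -> X s w @[s --> t^'+] --> X t w ;
  Levy_cadlag_left : forall w t, 0 < t -> cvg (X s w @[s --> t^'-]) ;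
  Levy_stationary : forall s t (A : set R), 0 <= s -> s <= t -> measurable A ->
    P [set w | A (X t w - X s w)] = P [set w | A (X (t - s) w)] ;
  Levy_independent : forall (n : nat) (t : nat -> R) (A : nat -> set R),
    0 <= t 0%N -> (forall i, t i <= t i.+1) -> (forall i, measurable (A i)) ->
    P (\bigcap_(i < n) [set w | A i (X (t i.+1) w - X (t i) w)]) =
    (\prod_(i < n) fine (P [set w | A i (X (t i.+1) w - X (t i) w)]))%:E }.

Record is_Levy_measure {R : realType}
    (Pi : {measure set R -> \bar R}) : Prop := {
  Levy_measure0 : Pi [set 0] = 0%E ;
  Levy_measure_integrable :
    (\int[Pi]_x (Num.min 1 (x ^+ 2))%:E < +oo)%E }.

Definition Levy_exponent {R : realType} (gamma sigma : R)
    (Pi : {measure set R -> \bar R}) (theta : R) : R[i] :=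
  'i%C * (theta * gamma)%:C - (sigma ^+ 2 * theta ^+ 2 / 2)%:C +
  Cintegral Pi (fun x => cexp ('i%C * (theta * x)%:C) - 1
    - 'i%C * (theta * x * (\1_[set y : R | `|y| <= 1] x))%:C).

Definition has_Levy_triplet {d} {T : measurableType d} {R : realType}
    (P : probability T R) (X : R -> {RV P >-> R})
    (gamma sigma : R) (Pi : {measure set R -> \bar R}) : Prop :=
  is_Levy_measure Pi /\
  forall t theta, 0 <= t ->
    charfun P (X t) theta = cexp (t%:C * Levy_exponent gamma sigma Pi theta).

Definition bounded_variation_process {d} {T : measurableType d} {R : realType}
    (P : probability T R) (X : R -> {RV P >-> R}) : Prop :=
  {ae P, forall w, forall t, 0 <= t -> bounded_variation 0 t (fun s => X s w)}.

Definition Levy_drift {R : realType} (gamma : R)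
    (Pi : {measure set R -> \bar R}) : R :=
  gamma - \int[Pi]_(x in [set x : R | `|x| <= 1]) x.

Definition null_process {d} {T : measurableType d} {R : realType}
    (P : probability T R) (X : R -> {RV P >-> R}) : Prop :=
  {ae P, forall w, forall t, 0 <= t -> X t w = 0}.

(* The conventions inf of the empty set = +oo and 0^0 = 1 are those of ereal_inf
   and powR. *)
Definition passage_time {d} {T : measurableType d} {R : realType}
    {P : probability T R} (X : R -> {RV P >-> R}) (b r : R) (w : T) : \bar R :=
  ereal_inf [set t%:E | t in [set t : R | 0 <= t /\ r * t `^ b < X t w]].

Definition passage_time_abs {d} {T : measurableType d} {R : realType}
    {P : probability T R} (X : R -> {RV P >-> R}) (b r : R) (w : T) : \bar R :=
  ereal_inf [set t%:E | t in [set t : R | 0 <= t /\ r * t `^ b < `|X t w|]].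

Definition cvg0_in_probability {d} {T : measurableType d} {R : realType}
    (P : probability T R) (Z : R -> T -> \bar R) (z : \bar R) : Prop :=
  forall delta : R, 0 < delta ->
    P [set w | (delta%:E < `|Z r w - z|)%E] @[r --> 0^'+] --> 0%E.

Definition cvg0_in_Lp {d} {T : measurableType d} {R : realType}
    (P : probability T R) (p : R) (Z : R -> T -> \bar R) (z : \bar R) : Prop :=
  (\int[P]_w (`|Z r w - z| `^ p))%E @[r --> 0^'+] --> 0%E.

(* Main.v *)
(** On a dyadic grid the increments of X are i.i.d., so grid versions of the passage
    times obey one-step recursions; right-continuity of the paths carries the
    resulting estimates over to continuous time.

    (a) Bounded variation gives E min(|X_t|, 1) = O(t), hence sigma = 0 and
    min(|x|, 1) is Pi-integrable, and then E min(|X_t - d t|, h) <= kappa t for every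
    kappa > 0 once h is small.  The expected passage time over a constant level y,
    capped at eps, is subadditive in y, so by Fekete's lemma it is equivalent to S y
    as y -> 0.  With c = C(r), the curve r t^b is close to the level d c during the
    times close to c that matter: it is unlikely to be crossed before lam c if
    lam < 1, or after (1 + u) c if u > 0.  Hence E(T /\ eps) / C(r) tends to d S,
    and 1 <= d S <= d A where A tends to 1 / d as eps -> 0.

    (b) The probability that X vanishes on [0, t] is squared when t is doubled;
    unless X is null, T*(r) / C(r) -> 1 forces it to be 0, hence T*(r) -> 0 in
    probability and the cap is harmless.  Ottaviani's inequality yields some
    s <= 2 C(r) with P(|X_s| > a) > 1/3, where a is of order r C(r)^b.  A run of k
    such steps of the same sign gives C(2 r) <= K C(r), and n such steps give
    P(T*(r) > 2 n C(2^j r)) <= (2/3)^n when 16 n <= 2^j.  Together these make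
    P(T*(r) /\ eps > A B^m C(r)) <= (2/3)^(Q m), which is uniform integrability of
    all powers of (T* /\ eps) / C. *)

Require Import Defs.
From HB Require Import structures.
From mathcomp Require Import all_boot all_order all_algebra.
From mathcomp Require Import all_classical all_reals all_analysis.
From mathcomp Require Import measurable_realfun complex ring lra zify.

Set Implicit Arguments.
Unset Strict Implicit.
Unset Printing Implicit Defensive.

Import Order.TTheory GRing.Theory Num.Theory.
Import numFieldNormedType.Exports.

Local Open Scope classical_set_scope.
Local Open Scope ring_scope.

(** * Bounded measurable functions *)

(** Truncations shape (a). The process need not have a mean, so |X_t - d t| is cut at [h]. A larger
    deviation occurs at rate at most kappa / h and is charged the whole horizon eps; large jumps
    thus leave a single trace, the factor 1 + eps * kappa / h in A, which disappears as eps tends to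
    0. Hence the order of choices: kappa, then [h], then eps. For fixed eps the limit in r may
    exceed 1 (a downward jump before the crossing has probability of order C(r) but costs time of
    order eps), so its value is not computed and Fekete's lemma is used for existence only. One-step
    recursions for a random walk stand in for the strong Markov property.

    In (b) nothing is assumed about C beyond positivity. All its regularity is read off the paths:
    if two events of high probability bound the same path at two levels, one common path gives an
    inequality between the numbers C(r). The 1/3 comes from Ottaviani's inequality with q = 2/3:
    small increments throughout would confine the path with probability at least 1/2, while
    concentration allows at most 1/4. The null process has to be set apart because its capped
    passage time is the cap itself. *)

Section bounded_measurable.
Context d (T : measurableType d) (R : realType).
Implicit Types f g : T -> R.

(** Expectations are taken of truncated quantities throughout; this predicate discharges all
    integrability conditions at once under a probability. *)
Definition bm f := measurable_fun setT f /\ exists M, forall x, `|f x| <= M.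

Lemma bm_cst (c : R) : bm (fun=> c).
Proof. by split; [exact: measurable_cst | exists `|c|]. Qed.

Lemma bmD f g : bm f -> bm g -> bm (fun x => f x + g x).
Proof.
move=> [mf [M fM]] [mg [N gN]]; split; first exact: measurable_funD.
exists (M + N) => x; apply: (le_trans (ler_normD _ _)); exact: lerD.
Qed.

Lemma bmM f g : bm f -> bm g -> bm (fun x => f x * g x).
Proof.
move=> [mf [M fM]] [mg [N gN]]; split; first exact: measurable_funM.
by exists (M * N) => x; rewrite normrM; apply: ler_pM.
Qed.

Lemma bmZ (c : R) f : bm f -> bm (fun x => c * f x).
Proof. by move=> bf; apply: bmM => //; exact: bm_cst. Qed.

Lemma bmB f g : bm f -> bm g -> bm (fun x => f x - g x).
Proof.
move=> bf bg; apply: bmD => //.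
by under eq_fun do rewrite -mulN1r; exact: bmZ.
Qed.

Lemma bm_sum (I : Type) (s : seq I) (F : I -> T -> R) :
  (forall i, bm (F i)) -> bm (fun x => \sum_(i <- s) F i x).
Proof.
move=> bF; elim: s => [|i s IH].
  by under eq_fun do rewrite big_nil; exact: bm_cst.
by under eq_fun do rewrite big_cons; exact: bmD.
Qed.

Lemma bm_prod (I : Type) (s : seq I) (F : I -> T -> R) :
  (forall i, bm (F i)) -> bm (fun x => \prod_(i <- s) F i x).
Proof.
move=> bF; elim: s => [|i s IH].
  by under eq_fun do rewrite big_nil; exact: bm_cst.
by under eq_fun do rewrite big_cons; exact: bmM.
Qed.

Lemma bm_indic A : measurable A -> bm (\1_A : T -> R).
Proof.
move=> mA; split; first exact: measurable_indic.
by exists 1 => x; rewrite indicE ger0_norm ?ler0n// lern1 leq_b1.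
Qed.

Lemma bm_min (h : R) f : 0 <= h -> measurable_fun setT f ->
  (forall x, 0 <= f x) -> bm (fun x => Num.min (f x) h).
Proof.
move=> h0 mf f0; split; first by apply: measurable_minr.
exists h => x; rewrite ger0_norm; first by rewrite ge_min lexx orbT.
by rewrite le_min f0.
Qed.

Lemma measurable_superlevel f (c : R) : measurable_fun setT f ->
  measurable [set x | c < f x].
Proof.
move=> mf; rewrite -[X in measurable X]setTI.
rewrite (_ : [set x | _] = f @^-1` `]c, +oo[%classic); first exact: mf.
by apply/seteqP; split => x /=; rewrite in_itv/= andbT.
Qed.

Lemma measurable_sublevel f (c : R) : measurable_fun setT f ->
  measurable [set x | f x <= c].
Proof.
move=> mf; rewrite -[X in measurable X]setTI.
rewrite (_ : [set x | _] = f @^-1` `]-oo, c]%classic); first exact: mf.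
by apply/seteqP; split => x /=; rewrite in_itv.
Qed.

End bounded_measurable.

Lemma bm_comp d d' (T : measurableType d) (T' : measurableType d') (R : realType)
    (f : T -> R) (u : T' -> T) :
  measurable_fun setT u -> bm f -> bm (fun x => f (u x)).
Proof.
move=> mu [mf [M fM]]; split; last by exists M.
exact: (measurableT_comp mf mu).
Qed.

Section bounded_integral.
Context d (T : measurableType d) (R : realType) (P : probability T R).
Implicit Types f g : T -> R.

Lemma bm_integrable f : bm f -> P.-integrable setT (EFin \o f).
Proof.
move=> [mf [M fM]]; apply: measurable_bounded_integrable => //.
  by rewrite (le_lt_trans (probability_le1 _ _))// ltry.
exists M; split; first exact: num_real.
by move=> N MN x _; apply: (le_trans (fM x)); exact: ltW.
Qed.

Lemma bm_integral f : bm f -> (\int[P]_x (f x)%:E)%E = (\int[P]_x f x)%:E.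
Proof.
move=> bf; rewrite /Rintegral fineK//.
by apply: integrable_fin_num => //; exact: bm_integrable.
Qed.

Lemma bm_Rintegral_cst (c : R) : \int[P]_x (fun=> c) x = c.
Proof.
rewrite Rintegral_cst// [X in fine X](_ : _ = 1%E) ?mulr1//.
exact: probability_setT.
Qed.

Lemma bm_RintegralD f g : bm f -> bm g ->
  \int[P]_x (f x + g x) = \int[P]_x f x + \int[P]_x g x.
Proof. by move=> bf bg; rewrite RintegralD//; exact: bm_integrable. Qed.

Lemma bm_RintegralZ (c : R) f : bm f -> \int[P]_x (c * f x) = c * \int[P]_x f x.
Proof. by move=> bf; rewrite RintegralZl//; exact: bm_integrable. Qed.

Lemma bm_RintegralB f g : bm f -> bm g ->
  \int[P]_x (f x - g x) = \int[P]_x f x - \int[P]_x g x.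
Proof. by move=> bf bg; rewrite RintegralB//; exact: bm_integrable. Qed.

Lemma bm_Rintegral_affine (a c : R) f : bm f ->
  \int[P]_x (a + c * f x) = a + c * \int[P]_x f x.
Proof.
move=> bf; rewrite (bm_RintegralD (bm_cst _ a) (bmZ c bf)).
by rewrite bm_Rintegral_cst bm_RintegralZ.
Qed.

Lemma bm_Rintegral_sum (I : Type) (s : seq I) (F : I -> T -> R) :
  (forall i, bm (F i)) ->
  \int[P]_x (\sum_(i <- s) F i x) = \sum_(i <- s) \int[P]_x F i x.
Proof.
move=> bF; elim: s => [|i s IH].
  by under eq_Rintegral do rewrite big_nil; rewrite bm_Rintegral_cst big_nil.
under eq_Rintegral do rewrite big_cons.
by rewrite bm_RintegralD ?IH ?big_cons//; exact: bm_sum.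
Qed.

Lemma bm_le_Rintegral f g : bm f -> bm g -> (forall x, f x <= g x) ->
  \int[P]_x f x <= \int[P]_x g x.
Proof. by move=> bf bg fg; apply: le_Rintegral => //; exact: bm_integrable. Qed.

Lemma bm_Rintegral_indic A : measurable A -> \int[P]_x (\1_A x) = fine (P A).
Proof. by move=> mA; rewrite /Rintegral integral_indic// setIT. Qed.

Lemma bm_markov (c : R) f A : bm f -> measurable A -> (forall x, 0 <= f x) ->
  (forall x, A x -> c <= f x) -> c * fine (P A) <= \int[P]_x f x.
Proof.
move=> bf mA f0 cf; rewrite -bm_Rintegral_indic// -bm_RintegralZ; last exact: bm_indic.
apply: bm_le_Rintegral => //; first by apply: bmZ; exact: bm_indic.
move=> x; rewrite indicE; case: (boolP (x \in A)) => [|_]; last by rewrite mulr0.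
by rewrite mulr1 inE => /cf.
Qed.

Lemma fineP_le (A B : set T) : measurable A -> measurable B -> A `<=` B ->
  fine (P A) <= fine (P B).
Proof.
by move=> mA mB AB; rewrite fine_le// ?fin_num_measure// le_measure// inE.
Qed.

Lemma fineP_ge0 (A : set T) : 0 <= fine (P A).
Proof. exact: fine_ge0. Qed.

Lemma fineP_le1 (A : set T) : measurable A -> fine (P A) <= 1.
Proof.
by move=> mA; rewrite -lee_fin fineK ?fin_num_measure//; exact: probability_le1.
Qed.

Lemma fineP_setC (A : set T) : measurable A -> fine (P (~` A)) = 1 - fine (P A).
Proof.
move=> mA; rewrite probability_setC// fineB ?fin_num_measure//.
Qed.

Lemma fineP_setU (A B : set T) : measurable A -> measurable B ->
  fine (P (A `|` B)) <= fine (P A) + fine (P B).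
Proof.
move=> mA mB; rewrite -fineD ?fin_num_measure// fine_le//.
- by rewrite fin_num_measure//; exact: measurableU.
- by rewrite fin_numD !fin_num_measure.
- exact: measureU2.
Qed.

End bounded_integral.

(** * Exit times of a random walk *)

Section random_walk.
Context (R : realType) (mu : probability R R).
Implicit Types (f g : R -> R) (H G : nat -> set R).

(** The transition operator of the random walk with step law [mu]. *)
Definition avg f (x : R) := \int[mu]_y f (x + y).

Lemma bm_shift f (x : R) : bm f -> bm (fun y : R => f (x + y)).
Proof. by move=> bf; apply: bm_comp bf; apply: measurable_funD. Qed.

Lemma avg_cst (c : R) x : avg (fun=> c) x = c.
Proof. exact: bm_Rintegral_cst. Qed.

Lemma avgD f g x : bm f -> bm g -> avg (fun y => f y + g y) x = avg f x + avg g x.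
Proof. by move=> bf bg; rewrite /avg bm_RintegralD//; exact: bm_shift. Qed.

Lemma avgZ (c : R) f x : bm f -> avg (fun y => c * f y) x = c * avg f x.
Proof. by move=> bf; rewrite /avg bm_RintegralZ//; exact: bm_shift. Qed.

Lemma le_avg f g x : bm f -> bm g -> (forall y, f (x + y) <= g (x + y)) ->
  avg f x <= avg g x.
Proof. by move=> bf bg fg; apply: bm_le_Rintegral => //; exact: bm_shift. Qed.

Lemma avg_bounds f (M : R) : bm f -> (forall x, 0 <= f x <= M) ->
  forall x, 0 <= avg f x <= M.
Proof.
move=> bf f01 x; rewrite -[X in X <= _ <= _](avg_cst 0 x) -[X in _ <= _ <= X](avg_cst M x).
by rewrite !le_avg//; try exact: bm_cst; move=> y; have /andP[] := f01 (x + y).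
Qed.

(** Measurability in the starting point comes from Tonelli's theorem, which wants a nonnegative
    integrand; hence the shift by the bound [M]. *)
Lemma bm_avg f : bm f -> bm (avg f).
Proof.
move=> bf; have [mf [M fM]] := bf.
have bfM : bm (fun x => f x + M) by apply: bmD => //; exact: bm_cst.
have -> : avg f = fun x => avg (fun y => f y + M) x - M.
  by apply/funext => x; rewrite avgD//; [rewrite avg_cst addrK|exact: bm_cst].
apply: bmB; last exact: bm_cst.
split; last first.
  exists (M + M) => x; have f0 y : 0 <= f y + M <= M + M.
    by have := fM y; rewrite ler_norml; lra.
  by have /andP[p q] := avg_bounds bfM f0 x; rewrite ger0_norm.
apply/measurable_EFinP.
have -> : EFin \o avg (fun x => f x + M) =
    fun x => (\int[mu]_y ((fun z : R * R => (f (z.1 + z.2) + M)%:E) (x, y)))%E.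
  by apply/funext => x /=; rewrite /avg -bm_integral//; exact: (bm_shift x bfM).
apply: (@measurable_fun_fubini_tonelli_F _ _ _ _ R mu (fun z : R * R => (f (z.1 + z.2) + M)%:E)).
- apply/measurable_EFinP; apply: (measurable_funD _ (measurable_cst _)).
  by apply: measurableT_comp => //; apply: measurable_funD.
- by move=> z; rewrite lee_fin; have := fM (z.1 + z.2); rewrite ler_norml; lra.
Qed.

(* For the random walk with step law mu started at x, the probability that its
   position at time k lies in H k for all k < n, and the expectation of its first
   exit time from H capped at n. *)
Fixpoint surv H n : R -> R := if n is n'.+1 then
  fun x => \1_(H 0%N) x * avg (surv (fun k => H k.+1) n') x else fun=> 1.

Fixpoint est H n : R -> R := if n is n'.+1 then
  fun x => \1_(H 0%N) x * (1 + avg (est (fun k => H k.+1) n') x) else fun=> 0.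

Lemma surv_in H n x : H 0%N x ->
  surv H n.+1 x = avg (surv (fun k => H k.+1) n) x.
Proof. by move=> Hx /=; rewrite indicE mem_set// mul1r. Qed.

Lemma surv_out H n x : ~ H 0%N x -> surv H n.+1 x = 0.
Proof. by move=> Hx /=; rewrite indicE memNset// mul0r. Qed.

Lemma est_in H n x : H 0%N x ->
  est H n.+1 x = 1 + avg (est (fun k => H k.+1) n) x.
Proof. by move=> Hx /=; rewrite indicE mem_set// mul1r. Qed.

Lemma est_out H n x : ~ H 0%N x -> est H n x = 0.
Proof. by case: n => [//|n] Hx /=; rewrite indicE memNset// mul0r. Qed.

Local Notation mset H := (forall k, measurable (H k)).

Lemma bm_surv H n : mset H -> bm (surv H n).
Proof.
elim: n H => [|n IH] H mH /=; first exact: bm_cst.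
apply: bmM; first exact: bm_indic.
by apply: bm_avg; apply: IH => k; exact: mH.
Qed.

Lemma bm_est H n : mset H -> bm (est H n).
Proof.
elim: n H => [|n IH] H mH /=; first exact: bm_cst.
apply: bmM; first exact: bm_indic.
apply: bmD; first exact: bm_cst.
by apply: bm_avg; apply: IH => k; exact: mH.
Qed.

Lemma surv01 H n x : mset H -> 0 <= surv H n x <= 1.
Proof.
elim: n H x => [|n IH] H x mH; first by rewrite ler01 lexx.
have [Hx|Hx] := pselect (H 0%N x); last by rewrite surv_out// lexx ler01.
rewrite surv_in//; apply: avg_bounds; first by apply: bm_surv => k; exact: mH.
by move=> y; apply: IH => k; exact: mH.
Qed.

Lemma est0n H n x : mset H -> 0 <= est H n x <= n%:R.
Proof.
elim: n H x => [|n IH] H x mH; first by rewrite lexx.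
have [Hx|Hx] := pselect (H 0%N x); last by rewrite est_out// lexx ler0n.
have mH' k : measurable (H k.+1) by exact: mH.
have := @avg_bounds _ n%:R (bm_est n mH') (fun y => IH _ y mH') x.
by rewrite est_in// -natr1; lra.
Qed.

Lemma est_ge0 H n x : mset H -> 0 <= est H n x.
Proof. by move=> /(est0n n x)/andP[]. Qed.

(** The tail-sum formula for a capped integer time: [surv H j.+1] is the probability that the exit
    time exceeds j. *)
Lemma est_surv H n x : mset H -> est H n x = \sum_(j < n) surv H j.+1 x.
Proof.
elim: n H x => [|n IH] H x mH; first by rewrite big_ord0.
have mH' k : measurable (H k.+1) by exact: mH.
have [Hx|Hx] := pselect (H 0%N x); last first.
  by rewrite est_out// big1// => j _; rewrite surv_out.
rewrite est_in// big_ord_recl surv_in// avg_cst; congr (1 + _).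
rewrite [LHS]/avg; under eq_Rintegral do rewrite IH//.
rewrite bm_Rintegral_sum; last by move=> j; apply: bm_shift; exact: bm_surv.
by apply: eq_bigr => j _; rewrite (surv_in j.+1 Hx).
Qed.

(** Both walks are driven by the same steps, which is why the hypothesis compares translates by a
    common [y]. *)
Lemma surv_mono H H' n x x' : mset H -> mset H' ->
  (forall k y, H k (x + y) -> H' k (x' + y)) -> surv H n x <= surv H' n x'.
Proof.
elim: n H H' x x' => [//|n IH] H H' x x' mH mH' HH'.
have [Hx|Hx] := pselect (H 0%N x); last first.
  by rewrite surv_out//; have /andP[] := surv01 n.+1 x' mH'.
have Hx' : H' 0%N x' by rewrite -(addr0 x'); apply: HH'; rewrite addr0.
rewrite !surv_in//; apply: bm_le_Rintegral; [apply: bm_shift; exact: bm_surv..|].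
move=> y; apply: IH => // k z.
by rewrite -!addrA; exact: HH'.
Qed.

Lemma est_mono H H' n x x' : mset H -> mset H' ->
  (forall k y, H k (x + y) -> H' k (x' + y)) -> est H n x <= est H' n x'.
Proof.
move=> mH mH' HH'; rewrite !est_surv//; apply: ler_sum => j _.
exact: surv_mono.
Qed.

Lemma surv_decr H n m x : mset H -> (n <= m)%N -> surv H m x <= surv H n x.
Proof.
elim: n m H x => [|n IH] m H x mH nm; first by have /andP[] := surv01 m x mH.
case: m nm => // m nm.
have mH' k : measurable (H k.+1) by exact: mH.
have [Hx|Hx] := pselect (H 0%N x); last by rewrite !surv_out.
rewrite !surv_in//; apply: le_avg; [exact: bm_surv|exact: bm_surv|].
by move=> y; exact: IH.
Qed.

Lemma surv_le_est H M n x : mset H -> (M <= n)%N ->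
  M%:R * surv H M x <= est H n x.
Proof.
move=> mH Mn; rewrite est_surv// mulr_natl.
have -> : surv H M x *+ M = \sum_(j < n | (j < M)%N) surv H M x.
  by rewrite -(big_ord_widen _ (fun=> surv H M x) Mn) sumr_const card_ord.
rewrite [leLHS]big_mkcond; apply: ler_sum => j _; case: ifP => [jM|_].
  exact: surv_decr.
by have /andP[] := surv01 j.+1 x mH.
Qed.

Lemma surv_ext H H' n x : (forall k, (k < n)%N -> H k = H' k) ->
  surv H n x = surv H' n x.
Proof.
elim: n H H' x => [//|n IH] H H' x HH' /=.
rewrite HH'//; congr (_ * _); rewrite /avg; apply: eq_Rintegral => y _.
by apply: IH => k kn; exact: HH'.
Qed.

(** Allows the constraint at time 0 to be dropped, as [early_crossing] does: there the curve may
    leave no margin above the drift line. *)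
Lemma surv_ext0 H H' n x : H 0%N x -> H' 0%N x ->
  (forall k, (0 < k)%N -> (k < n)%N -> H k = H' k) -> surv H n x = surv H' n x.
Proof.
case: n => [//|n] Hx Hx' HH'; rewrite !surv_in//.
by apply: eq_Rintegral => y _; apply: surv_ext => k kn; exact: HH'.
Qed.

(* On leaving H the walk has also left G, unless this happens before time M, which
   has probability at most 1 - surv H M x and costs at most B. *)
Lemma est_le_est_surv H G M n x (B : R) : mset H -> mset G -> 0 <= B ->
  (forall k, (M <= k)%N -> G k `<=` H k) ->
  (forall k m x, (k < M)%N -> (m <= n)%N -> ~ H k x ->
     est (fun j => G (k + j)%N) m x <= B) ->
  est G n x <= est H n x + B * (1 - surv H M x).
Proof.
elim: n H G M x => [|n IH] H G M x mH mG B0 GH GB.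
  by rewrite add0r mulr_ge0// subr_ge0; have /andP[] := surv01 M x mH.
have [Hx|Hx] := pselect (H 0%N x); last first.
  rewrite (est_out n.+1 Hx) add0r; case: M GH GB => [|M] GH GB.
    by rewrite subrr mulr0 est_out// => /(GH 0%N isT).
  by rewrite surv_out// subr0 mulr1; exact: (GB 0%N n.+1 x isT (leqnn _)).
have [Gx|Gx] := pselect (G 0%N x); last first.
  rewrite (est_out n.+1 Gx) addr_ge0 ?est_ge0// mulr_ge0// subr_ge0.
  by have /andP[] := surv01 M x mH.
have mH' k : measurable (H k.+1) by exact: mH.
have mG' k : measurable (G k.+1) by exact: mG.
have IH' y : est (fun k => G k.+1) n y <= est (fun k => H k.+1) n y +
     B * (1 - surv (fun k => H k.+1) M.-1 y).
  apply: IH => // k; first by move=> Mk; apply: GH; lia.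
  by move=> m z kM mn Hz; apply: (GB k.+1) => //; lia.
have -> : surv H M x = avg (surv (fun k => H k.+1) M.-1) x.
  by case: M {GH GB IH'} => [|M]; [rewrite /= avg_cst|rewrite surv_in].
have bs := bm_surv M.-1 mH'.
have b1s : bm (fun y => B * (1 - surv (fun k => H k.+1) M.-1 y)).
  by apply: bmZ; apply: bmB => //; exact: bm_cst.
rewrite !est_in// -addrA lerD2l.
apply: (@le_trans _ _ (avg (fun y => est (fun k => H k.+1) n y +
     B * (1 - surv (fun k => H k.+1) M.-1 y)) x)).
  apply: le_avg => //; first exact: bm_est.
  by apply: bmD => //; exact: bm_est.
rewrite avgD//; last exact: bm_est.
rewrite lerD2l avgZ; last by apply: bmB => //; exact: bm_cst.
rewrite /avg bm_RintegralB; [|exact: bm_cst|exact: bm_shift].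
by rewrite bm_Rintegral_cst.
Qed.

(** Split at the exit from [H], at time j say. If j < M the walk has then left [G] as well;
    otherwise a residual time of at most C + al * j remains. In expectation, al * j becomes al times
    [est H], and [C] is paid only with probability [surv H M x]. The offset [k] is a clock that the
    induction advances. *)
Lemma est_le_residual H G M n x (al C : R) (k : nat) : mset H -> mset G ->
  0 <= al -> 0 <= C ->
  (forall j, (j < M)%N -> G j `<=` H j) ->
  (forall j m x, (M <= j)%N -> (m <= n)%N -> ~ H j x ->
     est (fun i => G (j + i)%N) m x <= C + al * (k + j)%:R) ->
  est G n x <= al * k%:R + (1 + al) * est H n x + C * surv H M x.
Proof.
move=> mH mG al0 C0; elim: n H G M k x mH mG => [|n IH] H G M k x mH mG GH GB.
  rewrite mulr0 addr0 addr_ge0 ?mulr_ge0//.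
  by have /andP[] := surv01 M x mH.
have sge0 : 0 <= C * surv H M x.
  by apply: mulr_ge0 => //; have /andP[] := surv01 M x mH.
have kge0 : 0 <= al * k%:R by apply: mulr_ge0.
have [Hx|Hx] := pselect (H 0%N x); last first.
  rewrite (est_out n.+1 Hx) mulr0 addr0; case: M GH GB sge0 => [|M] GH GB sge0.
    rewrite (_ : surv H 0 x = 1)// mulr1 addrC.
    by have := GB 0%N n.+1 x isT (leqnn _) Hx; rewrite addn0; exact.
  by rewrite est_out ?addr_ge0// => /(GH 0%N isT).
have [Gx|Gx] := pselect (G 0%N x); last first.
  rewrite (est_out n.+1 Gx) !addr_ge0// mulr_ge0 ?est_ge0//; lra.
have mH' j : measurable (H j.+1) by exact: mH.
have mG' j : measurable (G j.+1) by exact: mG.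
have IH' y : est (fun j => G j.+1) n y <= al * k.+1%:R +
     (1 + al) * est (fun j => H j.+1) n y + C * surv (fun j => H j.+1) M.-1 y.
  apply: IH => // j; first by move=> jM; apply: GH; lia.
  by move=> m z Mj mn Hz; rewrite addSnnS; apply: (GB j.+1) => //; lia.
have -> : surv H M x = avg (surv (fun k => H k.+1) M.-1) x.
  by case: M {GH GB IH' sge0} => [|M]; [rewrite /= avg_cst|rewrite surv_in].
have bs := bm_surv M.-1 mH'.
have be := bm_est n mH'.
rewrite !est_in//.
have : avg (est (fun j => G j.+1) n) x <= avg (fun y => al * k.+1%:R +
     (1 + al) * est (fun j => H j.+1) n y + C * surv (fun j => H j.+1) M.-1 y) x.
  apply: le_avg => //; first exact: bm_est.
  by apply: bmD; [apply: bmD; [exact: bm_cst|exact: bmZ]|exact: bmZ].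
rewrite avgD; [|by apply: bmD; [exact: bm_cst|exact: bmZ]|exact: bmZ].
rewrite avgD; [|exact: bm_cst|exact: bmZ].
rewrite avg_cst !avgZ// -natr1; lra.
Qed.

(** Once above y1, the walk has at most y2 left to climb, and the overshoot only helps. *)
Lemma est_subadditive (y1 y2 : R) n x : 0 <= y1 -> 0 <= y2 ->
  est (fun=> [set z | z <= y1 + y2]) n x <=
  est (fun=> [set z | z <= y1]) n x + est (fun=> [set z | z <= y2]) n 0.
Proof.
move=> y10 y20.
have mI y : nat -> measurable ([set z | z <= y] : set R).
  by move=> _; rewrite -[X in measurable X]set_itvNyc.
have main m z : ~ (z <= y1) -> est (fun=> [set z | z <= y1 + y2]) m z <=
    est (fun=> [set z | z <= y2]) m 0.
  by move=> zy; apply: est_mono; [exact: mI|exact: mI|move=> _ y /=; lra].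
elim: n x => [|n IH] x; first by rewrite addr0.
have [Hx|Hx] := pselect (x <= y1); last by rewrite (est_out n.+1 Hx) add0r; exact: main.
rewrite (@est_in (fun=> [set z | z <= y1 + y2])); last by rewrite /=; lra.
rewrite (@est_in (fun=> [set z | z <= y1]))//.
rewrite -addrA lerD2l.
set c := est _ n.+1 0.
have cle : est (fun=> [set z | z <= y2]) n 0 <= c.
  rewrite /c !est_surv; [|exact: mI..].
  rewrite big_ord_recr/= lerDl.
  by have /andP[] := @surv01 (fun=> [set z | z <= y2]) n.+1 0 (mI y2).
apply: (@le_trans _ _ (avg (fun z => est (fun=> [set z | z <= y1]) n z + c) x)).
  apply: le_avg; [exact: bm_est (mI _)|by apply: bmD; [exact: bm_est (mI _)|exact: bm_cst]|].
  by move=> y; apply: (le_trans (IH _)); rewrite lerD2l.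
by rewrite avgD; [rewrite avg_cst|exact: bm_est (mI _)|exact: bm_cst].
Qed.

Lemma bm_dev (a h : R) : 0 < h -> bm (fun y : R => Num.min `|y - a| h).
Proof.
move=> h0; apply: bm_min => //; first exact: ltW.
by apply: measurableT_comp => //; apply: measurable_funB.
Qed.

Lemma avg_le_dev (a e h : R) f x (c1 c2 : R) : 0 < h ->
  \int[mu]_y Num.min `|y - a| h <= e -> bm f -> 0 <= c2 ->
  (forall y, f (x + y) <= c1 + c2 * Num.min `|y - a| h) -> avg f x <= c1 + c2 * e.
Proof.
move=> h0 avg_dev bf c20 fle; apply: (@le_trans _ _ (\int[mu]_y (c1 + c2 * Num.min `|y - a| h))).
  apply: bm_le_Rintegral => //; first exact: bm_shift.
  by apply: bmD; [exact: bm_cst|apply: bmZ; exact: bm_dev].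
by rewrite bm_Rintegral_affine; [rewrite lerD2l ler_wpM2l|exact: bm_dev].
Qed.

(** A Lyapunov argument with the function A * (gap + a). A step within [h] of [a] shrinks the gap by
    at least a - s - |y - a|; a step deviating more has probability at most e / h by Markov's
    inequality and is charged the whole horizon [N]. The condition on [A] says that the mean
    decrease pays for one unit of time plus that charge. The extra [a] keeps the truncation at 0
    from biting while the walk is still inside. *)
Lemma est_drift (a e h : R) (N : nat) (A s : R) (hs : nat -> R) n x :
  0 <= a -> 0 < h -> 0 <= e -> \int[mu]_y Num.min `|y - a| h <= e ->
  0 <= A -> 0 <= s ->
  (forall k, hs k.+1 <= hs k + s) -> 1 + N%:R * e / h <= A * (a - s - e) ->
  (n <= N)%N ->
  est (fun k => [set z | z <= hs k]) n x <= A * Num.max 0 (hs 0%N - x + a).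
Proof.
move=> a0 h0 e0 avg_dev A0 s0 + hA; elim: n hs x => [|n IH] hs x hss nN.
  by rewrite mulr_ge0// le_max lexx.
have mI (u : nat -> R) k : measurable ([set z | z <= u k] : set R).
  by rewrite -[X in measurable X]set_itvNyc.
have [Hx|Hx] := pselect (x <= hs 0%N); last by rewrite est_out// mulr_ge0// le_max lexx.
have hxa : 0 <= hs 0%N - x + a by lra.
rewrite est_in// (max_r hxa).
have le : avg (est (fun k => [set z | z <= hs k.+1]) n) x <=
    A * (hs 0%N - x + s) + (A + N%:R / h) * e.
  have N0 : (0 : R) <= N%:R by [].
  have Nh0 : 0 <= N%:R / h by rewrite divr_ge0// ltW.
  have hs0 : hs 1%N <= hs 0%N + s by exact: hss.
  apply: (avg_le_dev h0 avg_dev); [by apply: bm_est => k; exact: (mI (hs \o S))|lra|] => y.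
  have [yh|hy] := leP `|y - a| h.
    apply: (le_trans (IH (hs \o S) _ (fun k => hss _) (ltnW nN))) => /=.
    have -> : A * (hs 0%N - x + s) + (A + N%:R / h) * `|y - a| =
      A * (hs 0%N - x + s + `|y - a|) + N%:R / h * `|y - a| by ring.
    apply: (@le_trans _ _ (A * (hs 0%N - x + s + `|y - a|))).
      apply: ler_wpM2l => //; rewrite ge_max; apply/andP; split.
        by have := normr_ge0 (y - a); lra.
      by have := ler_norm (- (y - a)); rewrite normrN; lra.
    by rewrite lerDl mulr_ge0.
  have /andP[_] := @est0n (fun k => [set z | z <= hs k.+1]) n (x + y) (mI (hs \o S)).
  have : n%:R <= N%:R :> R by rewrite ler_nat ltnW.
  have : 0 <= A * (hs 0%N - x + s) by apply: mulr_ge0 => //; lra.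
  have : 0 <= A * h by rewrite mulr_ge0// ltW.
  have -> : (A + N%:R / h) * h = A * h + N%:R by field; lra.
  lra.
have : (A + N%:R / h) * e = A * e + N%:R * e / h by ring.
have : A * (a - s - e) = A * (hs 0%N - x + a) - A * (hs 0%N - x + s) - A * e by ring.
lra.
Qed.

(** A maximal inequality of Hajek-Renyi type for first moments. Leaving [H] at time k forces a
    weighted deviation of at least [c] from the line l + k * a, and since the weights do not
    increase, the step taken at time j contributes at most w j * e. A step deviating by more than
    [h] counts as a failure; this is the last term. *)
Lemma surv_deviation (a e h : R) H (w : nat -> R) (l c : R) M x :
  0 <= a -> 0 < h -> 0 <= e -> \int[mu]_y Num.min `|y - a| h <= e ->
  mset H -> 0 <= c ->
  (forall k x, ~ H k x -> c <= w k * (x - (l + k%:R * a))) ->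
  (forall k, 0 <= w k) -> (forall k, w k.+1 <= w k) ->
  c * (1 - surv H M x) <=
  w 0%N * Num.max 0 (x - l) + \sum_(j < M) w j * e + c * M%:R * e / h.
Proof.
move=> a0 h0 e0 avg_dev + c0; elim: M H w l x => [|M IH] H w l x mH Hw w0 wd.
  rewrite !(subrr, mulr0, big_ord0, mulr0n, mul0r, addr0).
  by apply: mulr_ge0; rewrite ?le_max ?lexx.
have h1 : 0 <= h^-1 by rewrite invr_ge0 ltW.
have c1 : 0 <= c * M.+1%:R * e / h by rewrite !mulr_ge0.
have s1 : 0 <= \sum_(j < M.+1) w j * e by apply: sumr_ge0 => j _; exact: mulr_ge0.
have [Hx|Hx] := pselect (H 0%N x); last first.
  rewrite surv_out// subr0 mulr1.
  have := Hw 0%N x Hx; rewrite mul0r addr0 => cle.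
  have : w 0%N * (x - l) <= w 0%N * Num.max 0 (x - l).
    by apply: ler_wpM2l => //; rewrite le_max lexx orbT.
  lra.
have mH' k : measurable (H k.+1) by exact: mH.
rewrite surv_in//.
have bs := bm_surv M mH'.
pose f y := c * (1 - surv (fun k => H k.+1) M y).
have bf : bm f by apply: bmZ; apply: bmB => //; exact: bm_cst.
have -> : c * (1 - avg (surv (fun k => H k.+1) M) x) = avg f x.
  rewrite /f avgZ; last by apply: bmB => //; exact: bm_cst.
  by rewrite /avg bm_RintegralB; [rewrite bm_Rintegral_cst|exact: bm_cst|exact: bm_shift].
set S' := \sum_(j < M) w j.+1 * e.
have S'0 : 0 <= S' by apply: sumr_ge0 => j _; exact: mulr_ge0.
have cM : 0 <= c * M%:R * e / h by rewrite !mulr_ge0.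
have mx0 : 0 <= Num.max 0 (x - l) by rewrite le_max lexx.
have le : avg f x <= (w 1%N * Num.max 0 (x - l) + S' + c * M%:R * e / h) + (w 1%N + c / h) * e.
  apply: (avg_le_dev h0 avg_dev) => //; first by rewrite addr_ge0// mulr_ge0.
  move=> y.
  have [yh|hy] := leP `|y - a| h.
    have fle : f (x + y) <= w 1%N * Num.max 0 (x + y - (l + a)) + S' + c * M%:R * e / h.
      apply: (IH (fun k => H k.+1) (fun k => w k.+1)) => // k z Hz.
      apply: (le_trans (Hw _ _ Hz)).
      by rewrite -natr1 mulrDl mul1r; apply: ler_wpM2l => //; lra.
    apply: (le_trans fle).
    have : w 1%N * Num.max 0 (x + y - (l + a)) <= w 1%N * (Num.max 0 (x - l) + `|y - a|).
      apply: ler_wpM2l => //; rewrite ge_max; apply/andP; split; first exact: addr_ge0.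
      have := ler_norm (y - a).
      have : x - l <= Num.max 0 (x - l) by rewrite le_max lexx orbT.
      lra.
    have : 0 <= c / h * `|y - a| by rewrite !mulr_ge0.
    have -> : (w 1%N + c / h) * `|y - a| = w 1%N * `|y - a| + c / h * `|y - a| by ring.
    lra.
  have -> : (w 1%N + c / h) * h = w 1%N * h + c by field; lra.
  have : 0 <= w 1%N * h by rewrite mulr_ge0// ltW.
  have : 0 <= w 1%N * Num.max 0 (x - l) by rewrite mulr_ge0.
  have /andP[sv0 _] := surv01 M (x + y) mH'.
  have : 0 <= c * surv (fun k => H k.+1) M (x + y) by rewrite mulr_ge0.
  by rewrite /f mulrBr mulr1; lra.
apply: (le_trans le).
have -> : \sum_(j < M.+1) w j * e = w 0%N * e + S' by rewrite big_ord_recl.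
have : w 1%N * e <= w 0%N * e by apply: ler_wpM2r.
have : w 1%N * Num.max 0 (x - l) <= w 0%N * Num.max 0 (x - l) by apply: ler_wpM2r.
rewrite -[M.+1%:R]natr1.
have -> : c * (M%:R + 1) * e / h = c * M%:R * e / h + c / h * e by ring.
have -> : (w 1%N + c / h) * e = w 1%N * e + c / h * e by ring.
lra.
Qed.

(* The probability that the walk started at x lies in A at time n. *)
Definition endp (A : set R) n := iter n avg (\1_A : R -> R).

Lemma bm_endp A n : measurable A -> bm (endp A n).
Proof.
by move=> mA; elim: n => [|n IH]; [exact: bm_indic|exact: bm_avg].
Qed.

Lemma endp01 A n x : measurable A -> 0 <= endp A n x <= 1.
Proof.
move=> mA; elim: n x => [|n IH] x /=.
  by rewrite indicE ler0n lern1 leq_b1.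
by apply: avg_bounds => //; exact: bm_endp.
Qed.

(** The same steps are used from both starting points, so the two end events exclude each other. *)
Lemma endp_disjoint (A B : set R) n (x z : R) : measurable A -> measurable B ->
  (forall y, A (x + y) -> ~ B (z + y)) -> endp A n x + endp B n z <= 1.
Proof.
move=> mA mB; elim: n x z => [|n IH] x z AB.
  have := AB 0; rewrite !addr0 /endp /= !indicE => AB0.
  case: (boolP (x \in A)) => [/set_mem/AB0 zB|_]; first by rewrite memNset// addr0.
  by rewrite add0r lern1 leq_b1.
rewrite /= /avg -bm_RintegralD; [|by apply: bm_shift; exact: bm_endp..].
rewrite -[X in _ <= X](avg_cst 1 0); apply: bm_le_Rintegral; last first.
- by move=> y; apply: IH => t; rewrite -!addrA; exact: AB.
- exact: bm_cst.
- by apply: bmD; apply: bm_shift; exact: bm_endp.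
Qed.

Lemma endp_surv (A : set R) n (x : R) : measurable A ->
  surv (fun k => if k == n then A else setT) n.+1 x = endp A n x.
Proof.
move=> mA; elim: n x => [|n IH] x.
  by rewrite /= avg_cst mulr1.
rewrite surv_in//= /avg; apply: eq_Rintegral => y _; exact: IH.
Qed.

(** When the walk leaves the window of radius 2 a, the remaining displacement is at most [a] with
    probability at least [q], and then the endpoint lies outside the window of radius [a]. *)
Lemma ottaviani (a q : R) n x : 0 <= q <= 1 ->
  (forall j, (j <= n)%N -> q <= endp [set z | `|z| <= a] j 0) ->
  q * (1 - surv (fun=> [set z | `|z| <= 2 * a]) n.+1 x) <=
  1 - endp [set z | `|z| <= a] n x.
Proof.
move=> q01.
have mB c : measurable ([set z | `|z| <= c] : set R).
  have -> : [set z | `|z| <= c] = `[- c, c]%classic.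
    by apply/seteqP; split => z /=; rewrite in_itv /= ler_norml.
  exact: measurable_itv.
have mBk c : forall k : nat, measurable ((fun=> [set z | `|z| <= c]) k : set R).
  by move=> _; exact: mB.
have e01 j z := endp01 j z (mB a).
elim: n x => [|n IH] x qn; (have [Hx|Hx] := pselect (`|x| <= 2 * a); last first);
  rewrite ?(surv_out _ Hx) ?surv_in//=.
- have : (endp [set z | `|z| <= a] 0 x) = 0.
    rewrite /endp /= indicE memNset//= => xa; apply: Hx.
    by have := normr_ge0 x; lra.
  by rewrite /endp /= => ->; lra.
- by rewrite avg_cst subrr mulr0; have := e01 0%N x; rewrite /endp /=; lra.
- have q0 := qn n.+1 (leqnn _).
  have dj : endp [set z | `|z| <= a] n.+1 x + endp [set z | `|z| <= a] n.+1 0 <= 1.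
    apply: endp_disjoint => // y /=; rewrite add0r => xy ya; apply: Hx.
    by have := ler_normB (x + y) y; rewrite addrK; lra.
  by move: q0 dj => /=; lra.
- have IHn := IH _ (fun j jn => qn j (leqW jn)).
  set F := surv _ n.+1 in IHn *.
  have bF : bm F by exact: bm_surv.
  have bE := bm_endp n (mB a).
  have -> : q * (1 - avg F x) = avg (fun y => q * (1 - F y)) x.
    rewrite avgZ; last by apply: bmB => //; exact: bm_cst.
    by rewrite /avg bm_RintegralB; [rewrite bm_Rintegral_cst|exact: bm_cst|exact: bm_shift].
  have -> : 1 - avg (endp [set z | `|z| <= a] n) x = avg (fun y => 1 - endp [set z | `|z| <= a] n y) x.
    by rewrite /avg bm_RintegralB; [rewrite bm_Rintegral_cst|exact: bm_cst|exact: bm_shift].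
  apply: le_avg => //; first by apply: bmZ; apply: bmB => //; exact: bm_cst.
  by apply: bmB => //; exact: bm_cst.
Qed.

End random_walk.

(** * The Markov property on a grid *)

Section independence.
Context d (T : measurableType d) (R : realType) (P : probability T R).

(** The joint law is the product law, then Tonelli applies. [Z] takes values in an arbitrary
    measurable space, so that it can be the identity map onto a coarser sigma-algebra on [T]. *)
Lemma indep_integral d2 (T2 : measurableType d2) (Y : {mfun T >-> R})
    (Z : {mfun T >-> T2}) (F : R * T2 -> \bar R) :
  (forall A B, measurable A -> measurable B ->
    P (Y @^-1` A `&` Z @^-1` B) = (P (Y @^-1` A) * P (Z @^-1` B))%E) ->
  measurable_fun setT F -> (forall z, 0 <= F z)%E ->
  (\int[P]_w F (Y w, Z w) = \int[distribution P Y]_y \int[P]_w F (y, Z w))%E.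
Proof.
move=> indep mF F0.
have mYZ : measurable_fun setT (fun w => (Y w, Z w)) by exact: measurable_fun_pair.
pose YZ : {mfun T >-> (R * T2)%type} :=
  HB.pack (fun w => (Y w, Z w)) (isMeasurableFun.Build _ _ _ _ _ mYZ).
rewrite -[LHS](@ge0_integral_distribution _ _ _ _ _ P YZ)//.
rewrite (@eq_measure_integral _ _ _ _ (distribution P Y \x distribution P Z)%E); last first.
  move=> A mA _; apply/esym; apply: product_measure_unique => // B C mB mC.
rewrite fubini_tonelli1//; apply: eq_integral => y _.
rewrite /fubini_F (@ge0_integral_distribution _ _ _ _ _ P Z)//.
by apply: measurableT_comp => //; exact: measurable_fun_pair.
Qed.

(** For fixed [A], both sides are finite measures in [B], namely a restriction and a multiple of
    [P], and they agree on a generating pi-system. *)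
Lemma indep_pi_system (Y : {mfun T >-> R}) (G : set (set T)) :
  G `<=` measurable -> setI_closed G -> G setT ->
  (forall A B, measurable A -> G B ->
    P (Y @^-1` A `&` B) = (P (Y @^-1` A) * P B)%E) ->
  forall A B, measurable A -> <<s G >> B ->
    P (Y @^-1` A `&` B) = (P (Y @^-1` A) * P B)%E.
Proof.
move=> Gm GI GT indep A B mA GB.
have mYA : measurable (Y @^-1` A) by rewrite -[X in measurable X]setTI; exact: measurable_funP.
have r0 : 0 <= fine (P (Y @^-1` A)) by exact: fine_ge0.
have cov : \bigcup_(k : nat) (fun=> [set: T]) k = [set: T].
  by apply/seteqP; split => x _ //; exists 0%N.
have mrE C : mrestr P mYA C = P (Y @^-1` A `&` C) by rewrite /mrestr setIC.
have msE C : mscale (NngNum r0) P C = (P (Y @^-1` A) * P C)%E.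
  by rewrite /mscale /= fineK ?fin_num_measure.
rewrite -mrE -msE.
apply: (@g_sigma_algebra_measure_unique _ _ _ G Gm (fun=> setT) (fun=> GT) cov
  (mrestr P mYA) (mscale (NngNum r0) P) GI _ _ _ GB) => //.
- by move=> C GC; rewrite [LHS]mrE [RHS]msE indep.
- move=> _; rewrite [X in (X < _)%E]mrE.
  rewrite (le_lt_trans (probability_le1 _ _)) ?ltry//.
  by apply: measurableI.
Qed.

End independence.

Section levy_markov.
Context d (T : measurableType d) (R : realType) (P : probability T R).
Context (X : R -> {RV P >-> R}) (hX : is_Levy X).

Local Notation law t := (distribution P (X t)).
Local Notation incr s t := (fun w => X t w - X s w).

Lemma measurable_incr s t : measurable_fun setT (incr s t).
Proof. exact: measurable_funB. Qed.

Lemma measurable_incr_set s t (A : set R) : measurable A ->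
  measurable [set w | A (X t w - X s w)].
Proof.
move=> mA; rewrite -[X in measurable X]setTI.
exact: (measurable_incr s t measurableT mA).
Qed.

Lemma incr_law s t (A : set R) : 0 <= s -> s <= t -> measurable A ->
  P [set w | A (X t w - X s w)] = law (t - s) A.
Proof. by move=> s0 st mA; rewrite (Levy_stationary hX). Qed.

Section grid.
Variables (s dl : R).
Hypotheses (s0 : 0 <= s) (dl0 : 0 <= dl).

Local Notation tm i := (s + i%:R * dl).
Local Notation xi i := (fun w => X (tm i.+1) w - X (tm i) w).

Lemma grid_ge0 i : 0 <= tm i.
Proof. by rewrite addr_ge0// mulr_ge0. Qed.

Lemma grid_le i : tm i <= tm i.+1.
Proof. by rewrite lerD2l ler_wpM2r// ler_nat. Qed.

Lemma xi_law i (A : set R) : measurable A ->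
  P [set w | A (xi i w)] = law dl A.
Proof.
move=> mA; rewrite incr_law//; [|exact: grid_ge0|exact: grid_le].
by rewrite -natr1; congr (distribution P (X _) A); ring.
Qed.

Lemma xi_rectangle n (A : nat -> set R) : (forall i, measurable (A i)) ->
  P (\bigcap_(i < n) [set w | A i (xi i w)]) =
  (\prod_(i < n) fine (law dl (A i)))%:E.
Proof.
move=> mA; rewrite (Levy_independent hX n (t := fun i => tm i))//.
- by congr EFin; apply: eq_bigr => i _; rewrite xi_law.
- exact: grid_ge0.
- exact: grid_le.
Qed.

Definition future n : set (set T) := [set B | exists2 A : nat -> set R,
  forall i, measurable (A i) & B = \bigcap_(i < n) [set w | A i (xi i.+1 w)]].

Lemma futureP n : [/\ future n `<=` measurable, setI_closed (future n) &
  future n setT].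
Proof.
split.
- move=> _ [A mA ->]; apply: bigcap_measurableType => // i _.
  exact: measurable_incr_set.
- move=> _ _ [A mA ->] [B mB ->]; exists (fun i => A i `&` B i).
    by move=> i; exact: measurableI.
  by rewrite -bigcapI.
- by exists (fun=> setT) => //; apply/esym/seteqP; split.
Qed.

Lemma xi_future n (A : set R) (B : set T) : measurable A -> <<s future n >> B ->
  P ([set w | A (xi 0%N w)] `&` B) = (law dl A * P B)%E.
Proof.
have [fm fI fT] := futureP n.
pose Y : {mfun T >-> R} := HB.pack (xi 0%N)
  (isMeasurableFun.Build _ _ _ _ _ (measurable_incr (tm 0) (tm 1))).
have YE C : measurable C -> P (Y @^-1` C) = law dl C by move=> mC; rewrite -(xi_law 0).
move=> mA sB; rewrite -YE//.
apply: (indep_pi_system (Y := Y) fm fI fT) => // {mA sB B}C _ mC [B mB ->].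
pose C' i := if i is i'.+1 then B i' else C.
have mC' i : measurable (C' i) by case: i => //= i.
have -> : Y @^-1` C `&` \bigcap_(i < n) [set w | B i (xi i.+1 w)] =
    \bigcap_(i < n.+1) [set w | C' i (xi i w)].
  apply/seteqP; split => [w [Cw Bw] [|i] //= iln|w CBw]; first exact: Bw.
  by split=> [|i /= iln]; [exact: (CBw 0%N)|exact: (CBw i.+1)].
rewrite xi_rectangle// big_ord_recl/= YE// EFinM fineK ?fin_num_measure//.
congr (_ * _)%E.
rewrite (Levy_independent hX n (t := fun i => tm i.+1))//.
- by congr EFin; apply: eq_bigr => i _; rewrite xi_law.
- exact: grid_ge0.
- by move=> i; exact: grid_le.
Qed.

(** Integrates out the first increment. The rest of the path is represented by the identity of [T],
    seen as a random element for the sigma-algebra of the later increments; its independence of the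
    first increment is [xi_future]. *)
Lemma xi_future_integral n (F : R * g_sigma_algebraType (future n) -> \bar R) :
  measurable_fun setT F -> (forall z, 0 <= F z)%E ->
  (\int[P]_w F (xi 0%N w, w) = \int[law dl]_y \int[P]_w F (y, w))%E.
Proof.
move=> mF F0; have [fm fI fT] := futureP n.
pose Y : {mfun T >-> R} := HB.pack (xi 0%N)
  (isMeasurableFun.Build _ _ _ _ _ (measurable_incr (tm 0) (tm 1))).
have fs : <<s future n >> `<=` @measurable _ T.
  by apply: smallest_sub => //; exact: sigma_algebra_measurable.
have mid : measurable_fun setT (id : T -> g_sigma_algebraType (future n)).
  by move=> _ B mB; rewrite setTI; exact: fs.
pose Z : {mfun T >-> g_sigma_algebraType (future n)} :=
  HB.pack (id : T -> g_sigma_algebraType (future n)) (isMeasurableFun.Build _ _ _ _ _ mid).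
rewrite -[LHS]/(\int[P]_w F (Y w, Z w))%E (@indep_integral _ _ _ _ _ _ Y Z)//; last first.
  by move=> A B mA mB; apply: (etrans (xi_future mA mB)); congr (_ * _)%E; exact/esym/(xi_law 0%N).
by apply: eq_measure_integral => A mA _; exact: (xi_law 0%N mA).
Qed.

Lemma measurable_future n i : (i < n)%N ->
  measurable_fun setT (xi i.+1 : g_sigma_algebraType (future n) -> R).
Proof.
move=> iln _ A mA; rewrite setTI; apply: sub_sigma_algebra.
exists (fun j => if j == i then A else setT); first by move=> j; case: ifP.
apply/seteqP; split => [w Aw j _ /=|w /(_ i iln)/=]; last by rewrite eqxx.
by case: eqP => // ->.
Qed.

Lemma measurable_future_sum n k : (k <= n)%N ->
  measurable_fun setT (incr (tm 1) (tm k.+1) : g_sigma_algebraType (future n) -> R).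
Proof.
elim: k => [|k IH] kn.
  by under eq_fun do rewrite subrr; exact: measurable_cst.
have -> : incr (tm 1) (tm k.+2) = (fun w => incr (tm 1) (tm k.+1) w + xi k.+1 w).
  by apply/funext => w; ring.
by apply: measurable_funD; [exact: IH (ltnW kn)|exact: measurable_future].
Qed.

End grid.

(** The bridge from the process to the walk recursions. The start time [s] and the shift [x] are
    free because the induction restarts at s + dl from x plus the first increment. *)
Lemma levy_surv (dl : R) H n s x : 0 <= dl -> 0 <= s ->
  (forall k, measurable (H k)) ->
  P (\bigcap_(k < n) [set w | H k (x + (X (s + k%:R * dl) w - X s w))]) =
  (surv (law dl) H n x)%:E.
Proof.
move=> dl0; elim: n H s x => [|n IH] H s x s0 mH.
  by rewrite bigcap_mkord big_ord0 probability_setT.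
set E := \bigcap_(k < _) _.
have E0 w : E w -> H 0%N x.
  by move=> /(_ 0%N isT) /=; rewrite mul0r addr0 subrr addr0.
have [Hx|Hx] := pselect (H 0%N x); last first.
  by rewrite surv_out// (_ : E = set0) ?measure0//; apply/seteqP; split => // w /E0.
have mH' k : measurable (H k.+1) by exact: mH.
(* The path enters only through increments after the first grid step; these alone are measurable for
   the sigma-algebra of the future. *)
pose F (z : R * g_sigma_algebraType (future s dl n)) : \bar R :=
  (\1_(\bigcap_(k < n) [set z : R * g_sigma_algebraType (future s dl n) |
     H k.+1 (x + z.1 + (X (s + k.+1%:R * dl) z.2 - X (s + 1%:R * dl) z.2))]) z)%:E.
have mF : measurable_fun setT F.
  apply/measurable_EFinP; apply: measurable_indic.
  apply: bigcap_measurableType => // k kn; rewrite -[X in measurable X]setTI.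
  apply: (_ : measurable_fun setT (fun z : R * g_sigma_algebraType (future s dl n) =>
    x + z.1 + (X (s + k.+1%:R * dl) z.2 - X (s + 1%:R * dl) z.2))) => //.
  apply: measurable_funD; first exact: measurable_funD.
  have m2 : measurable_fun setT (snd : R * g_sigma_algebraType (future s dl n) ->
    g_sigma_algebraType (future s dl n)) by exact: measurable_snd.
  exact: (measurableT_comp (measurable_future_sum (s := s) (dl := dl) (ltnW kn)) m2).
have mE : measurable E.
  apply: bigcap_measurableType => // k _; rewrite -[X in measurable X]setTI.
  apply: (_ : measurable_fun setT (fun w => x + (X (s + k%:R * dl) w - X s w))) => //.
  by apply: measurable_funD => //; exact: measurable_incr.
have EF w : F (X (s + 1%:R * dl) w - X (s + 0%:R * dl) w, w) = (\1_E w)%:E.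
  rewrite /F !indicE; congr ((_ : bool)%:R%:E); apply/idP/idP; rewrite !inE => Ew.
    case=> [|k] kn /=; first by rewrite mul0r addr0 subrr addr0.
    have := Ew k kn; rewrite /= mul0r addr0; congr (H _ _); ring.
  move=> k kn /=; have := Ew k.+1 kn; rewrite /= mul0r addr0; congr (H _ _); ring.
transitivity (\int[P]_w (\1_E w)%:E)%E; first by rewrite integral_indic// setIT.
under eq_integral do rewrite -EF.
rewrite (xi_future_integral s0 dl0 mF); last by move=> z; rewrite lee_fin.
rewrite surv_in// /avg -bm_integral; last exact: bm_shift (bm_surv _ n mH').
apply: eq_integral => y _.
rewrite -(IH (fun k => H k.+1) (s + dl))//; last exact: addr_ge0.
set B := \bigcap_(k < n) _.
have mB : measurable B.
  apply: bigcap_measurableType => // k _; rewrite -[X in measurable X]setTI.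
  apply: (_ : measurable_fun setT (fun w => x + y + (X (s + dl + k%:R * dl) w - X (s + dl) w))) => //.
  by apply: measurable_funD => //; exact: measurable_incr.
transitivity (\int[P]_w (\1_B w)%:E)%E; last by rewrite integral_indic// setIT.
apply: eq_integral => w _; rewrite /F !indicE; congr ((_ : bool)%:R%:E).
have e k : s + k.+1%:R * dl = s + dl + k%:R * dl by rewrite -natr1; ring.
apply/idP/idP; rewrite !inE => Ew k kn; have := Ew k kn;
  by rewrite /= !e mul0r addr0.
Qed.

Lemma levy_prod (f : R -> R) dl n s : 0 <= dl -> 0 <= s -> bm f ->
  (forall y, 0 <= f y) ->
  \int[P]_w (\prod_(i < n) f (X (s + i.+1%:R * dl) w - X (s + i%:R * dl) w)) =
  (\int[law dl]_y f y) ^+ n.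
Proof.
move=> dl0 + bf f0; elim: n s => [|n IH] s s0.
  by under eq_Rintegral do rewrite big_ord0; rewrite bm_Rintegral_cst expr0.
have bfx i s' : bm (fun w => f (X (s' + i.+1%:R * dl) w - X (s' + i%:R * dl) w)).
  exact: bm_comp (measurable_incr _ _) bf.
apply: EFin_inj; rewrite -bm_integral; last by apply: bm_prod => i; exact: bfx.
pose F (z : R * g_sigma_algebraType (future s dl n)) : \bar R :=
  (f z.1 * \prod_(i < n) f (X (s + i.+2%:R * dl) z.2 - X (s + i.+1%:R * dl) z.2))%:E.
have mF : measurable_fun setT F.
  apply/measurable_EFinP; apply: measurable_funM.
    by apply: measurableT_comp => //; case: bf.
  apply: measurable_prod => i _; apply: measurableT_comp; first by case: bf.
  have m2 : measurable_fun setT (snd : R * g_sigma_algebraType (future s dl n) ->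
    g_sigma_algebraType (future s dl n)) by exact: measurable_snd.
  exact: (measurableT_comp (measurable_future (s := s) (dl := dl) (ltn_ord i)) m2).
under eq_integral do rewrite big_ord_recl.
rewrite (xi_future_integral s0 dl0 mF); last first.
  by move=> z; rewrite lee_fin mulr_ge0// prodr_ge0.
have e k : s + k.+1%:R * dl = s + dl + k%:R * dl by rewrite -natr1; ring.
transitivity (\int[law dl]_y (f y * (\int[law dl]_y f y) ^+ n)%:E)%E.
  apply: eq_integral => y _; rewrite -(IH (s + dl))//; last exact: addr_ge0.
  rewrite -bm_RintegralZ -?bm_integral; last first.
  - by apply: bm_prod => i; exact: bfx.
  - by apply: bmZ; apply: bm_prod => i; exact: bfx.
  apply: eq_integral => w _; rewrite /F; congr EFin; congr (_ * _).
  by apply: eq_bigr => i _; rewrite !e.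
rewrite bm_integral; last by apply: bmM => //; exact: bm_cst.
congr EFin; under eq_Rintegral do rewrite mulrC.
by rewrite bm_RintegralZ// exprS mulrC.
Qed.

End levy_markov.

(** * First entrance times *)

Section first_time.
Context (R : realType).
Implicit Types (D : R -> Prop) (t u eta : R).

Lemma dyadic_small (a eta : R) : 0 < a -> 0 < eta ->
  exists m0, forall m, (m0 <= m)%N -> a / (2 ^ m)%N%:R < eta.
Proof.
move=> a0 e0; exists (Num.truncn (a / eta)).+1 => m mm.
have p2 : (0 : R) < (2 ^ m)%N%:R by rewrite ltr0n expn_gt0.
rewrite ltr_pdivrMr// mulrC -ltr_pdivrMr//.
apply: (lt_trans (truncnS_gt _)); rewrite ltr_nat.
by apply: (leq_ltn_trans mm); exact: ltn_expl.
Qed.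

(** What right-continuity gives for strict inequalities, and all that a grid needs in order to
    detect an entrance. *)
Definition right_open D := forall t, 0 <= t -> D t ->
  exists2 eta, 0 < eta & forall s, t <= s < t + eta -> D s.

Definition first_time D : \bar R :=
  ereal_inf [set t%:E | t in [set t | 0 <= t /\ D t]].

Lemma first_time_ge0 D : (0 <= first_time D)%E.
Proof. by apply: le_ereal_inf_tmp => _ [t [t0 _] <-]; rewrite lee_fin. Qed.

Lemma first_time_ltP D (t : \bar R) :
  (first_time D < t)%E <-> exists s, [/\ 0 <= s, D s & (s%:E < t)%E].
Proof.
split=> [/ereal_inf_lt[_ [s [s0 Ds] <-] st]|[s [s0 Ds st]]]; first by exists s.
by apply: le_lt_trans st; apply: ereal_inf_lbound; exists s.
Qed.

(** An entrance lasts for a time [eta], so any mesh finer than that has a point in it; the first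
    grid point strictly after [t] serves. [t1] is the horizon of the grid and [u] the tolerated
    delay. *)
Lemma grid_crossing D t1 t u : right_open D -> 0 <= t -> D t -> t < t1 -> t < u ->
  exists m0, forall m, (m0 <= m)%N -> exists k, [/\ (k < 2 ^ m)%N,
    t < k%:R * (t1 / (2 ^ m)%N%:R) < u & D (k%:R * (t1 / (2 ^ m)%N%:R))].
Proof.
move=> rD t0 Dt tt1 tu; have [eta eta0 De] := rD t t0 Dt.
have t10 : 0 < t1 by exact: le_lt_trans tt1.
have e0 : 0 < Num.min eta (Num.min (t1 - t) (u - t)) by rewrite !lt_min eta0 !subr_gt0 tt1.
have [m0 m0P] := dyadic_small t10 e0; exists m0 => m /m0P.
rewrite !lt_min => /and3P[d1 d2 d3].
have p2 : (0 : R) < (2 ^ m)%N%:R by rewrite ltr0n expn_gt0.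
set dl := t1 / _ in d1 d2 d3 *.
have dl0 : 0 < dl by rewrite divr_gt0.
have tE : t1 = (2 ^ m)%N%:R * dl by rewrite /dl mulrC divfK// gt_eqF.
have /andP[k1 k2] := truncn_itv (divr_ge0 t0 (ltW dl0)).
set k := Num.truncn _ in k1 k2.
rewrite ler_pdivlMr// in k1; rewrite ltr_pdivrMr// in k2.
have k3 : k.+1%:R * dl = k%:R * dl + dl by rewrite -natr1 mulrDl mul1r.
exists k.+1; split.
- by rewrite -(ltr_nat R) -(ltr_pM2r dl0) -tE; lra.
- by apply/andP; split; lra.
- by apply: De; apply/andP; split; lra.
Qed.

End first_time.

Lemma bm_cvg_Rintegral d (T : measurableType d) (R : realType)
    (P : probability T R) (f_ : nat -> T -> R) (f : T -> R) (M : R) :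
  (forall n, measurable_fun setT (f_ n)) -> measurable_fun setT f ->
  (forall n w, `|f_ n w| <= M) -> (forall w, f_ n w @[n --> \oo] --> f w) ->
  \int[P]_w f_ n w @[n --> \oo] --> \int[P]_w f w.
Proof.
move=> mf_ mf fM fcvg.
have M0 : 0 <= M by exact: le_trans (fM 0%N point).
have fle w : `|f w| <= M.
  apply: (@closed_cvg _ _ _ eventually_filter (fun n => `|f_ n w|) [set x | x <= M]).
  - exact: closed_le.
  - by near=> n; exact: fM.
  - by apply: cvg_norm; exact: fcvg.
have bf n : bm (f_ n) by split; [|exists M].
have b : bm f by split; [|exists M].
apply: fine_cvg; rewrite -/(Rintegral _ _ _) -bm_integral//.
apply: (@dominated_cvg _ T R P setT measurableT (fun n => EFin \o f_ n) (EFin \o f)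
  (cst M%:E)) => //.
- by move=> n; apply/measurable_EFinP; exact: mf_.
- by move=> w _; apply: cvg_EFin; [near=> n|exact: fcvg].
- exact: (bm_integrable P (bm_cst _ M)).
- by move=> n w _; rewrite lee_fin; exact: fM.
Unshelve. all: by end_near. Qed.

Section measurable_first_time.
Context d (T : measurableType d) (R : realType).
Variable D : R -> T -> Prop.
Hypothesis mD : forall t, 0 <= t -> measurable [set w | D t w].
Hypothesis rD : forall w, right_open (D ^~ w).

(** By [grid_crossing], an entrance before t is an entrance at some dyadic point of [0, t), a
    countable union; completeness of the probability space is not called for. *)
Lemma measurable_first_time : measurable_fun setT (fun w => first_time (D ^~ w)).
Proof.
apply: (measurability _ (ErealGenCInfty.measurableE R)).
move=> _ [_ [t ->] <-]; rewrite setTI.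
have -> : (fun w => first_time (D ^~ w)) @^-1` `[t%:E, +oo[ =
    ~` [set w | (first_time (D ^~ w) < t%:E)%E].
  by apply/seteqP; split => w /=; rewrite in_itv/= andbT; [move/le_gtF => ->|move/negP; rewrite -leNgt].
apply: measurableC.
have [t0|t0] := leP t 0.
  rewrite (_ : [set _ | _] = set0) ?measurable0//; apply/seteqP; split => // w /=.
  by move/(le_lt_trans (first_time_ge0 _)); rewrite lte_fin ltNge t0.
have -> : [set w | (first_time (D ^~ w) < t%:E)%E] =
    \bigcup_m \bigcup_(k < 2 ^ m) [set w | D (k%:R * (t / (2 ^ m)%N%:R)) w].
  apply/seteqP; split => [w /= /first_time_ltP[s [s0 Ds]]|w].
    rewrite lte_fin => st; have [m0 /(_ m0 (leqnn _))[k [km _ Dk]]] := grid_crossing (@rD w) s0 Ds st st.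
    by exists m0 => //; exists k.
  move=> [m _ [k /= km Dk]]; apply/first_time_ltP; exists (k%:R * (t / (2 ^ m)%N%:R)).
  have p2 : (0 : R) < (2 ^ m)%N%:R by rewrite ltr0n expn_gt0.
  split => //; first by rewrite mulr_ge0// divr_ge0// ltW.
  rewrite lte_fin mulrCA gtr_pMr// ltr_pdivrMr// mul1r ltr_nat//.
apply: bigcup_measurable => m _; apply: bigcup_measurable => k _; apply: mD.
by rewrite mulr_ge0// divr_ge0// ltW.
Qed.

Variable eps : R.
Hypothesis eps0 : 0 < eps.

Definition capped_time w : R := fine (mine (first_time (D ^~ w)) eps%:E).

Lemma capped_timeE w : (capped_time w)%:E = mine (first_time (D ^~ w)) eps%:E.
Proof.
rewrite /capped_time fineK// fin_numElt; apply/andP; split.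
  apply: (@lt_le_trans _ _ 0%E) => //.
  by rewrite le_min first_time_ge0/= lee_fin ltW.
by rewrite gt_min ltry orbT.
Qed.

Lemma capped_time_bounds w : 0 <= capped_time w <= eps.
Proof.
rewrite -!lee_fin capped_timeE ge_min lexx orbT andbT.
by rewrite le_min first_time_ge0/= lee_fin ltW.
Qed.

Lemma bm_capped_time : bm capped_time.
Proof.
split; last first.
  by exists eps => w; have /andP[? ?] := capped_time_bounds w; rewrite ger0_norm.
apply/measurable_EFinP; rewrite (_ : EFin \o _ = fun w => mine (first_time (D ^~ w)) eps%:E).
  by apply: measurable_mine => //; exact: measurable_first_time.
by apply/funext => w /=; rewrite capped_timeE.
Qed.

Definition grid_alive m k := \bigcap_(j < k) [set w | ~ D (j%:R * (eps / (2 ^ m)%N%:R)) w].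

Lemma measurable_grid_alive m k : measurable (grid_alive m k).
Proof.
apply: bigcap_measurableType => j _; apply: measurableC; apply: mD.
by rewrite mulr_ge0// divr_ge0// ltW.
Qed.

(** The first grid point in [D], capped at [eps], written as a sum of survival indicators so that
    its expectation has the shape of [est_surv]. *)
Definition grid_time m w :=
  eps / (2 ^ m)%N%:R * \sum_(k < 2 ^ m) \1_(grid_alive m k.+1) w : R.

Lemma bm_grid_time m : bm (grid_time m).
Proof.
by apply: bmZ; apply: bm_sum => k; apply: bm_indic; exact: measurable_grid_alive.
Qed.

Lemma sum_ord_lt (n : nat) (a : R) : 0 <= a -> a <= n%:R ->
  a <= \sum_(k < n) (k%:R < a)%R%:R.
Proof.
elim: n a => [|n IH] a a0 an; first by rewrite big_ord0.
rewrite big_ord_recr /=; have [na|na] := ltP n%:R a.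
  rewrite (eq_bigr (fun=> 1)).
    by rewrite sumr_const card_ord natr1.
  by move=> i _; rewrite (lt_trans _ na)// ltr_nat.
by rewrite addr0; exact: IH.
Qed.

Lemma grid_time_bounds m w : capped_time w <= grid_time m w <= eps.
Proof.
have p2 : (0 : R) < (2 ^ m)%N%:R by rewrite ltr0n expn_gt0.
have dl0 : 0 < eps / (2 ^ m)%N%:R by rewrite divr_gt0.
have epsE : eps / (2 ^ m)%N%:R * (2 ^ m)%N%:R = eps by rewrite divfK// gt_eqF.
have /andP[t0 te] := capped_time_bounds w.
apply/andP; split; last first.
  rewrite /grid_time -[leRHS]epsE ler_wpM2l//; first exact: ltW.
  rewrite -[X in _ <= X%:R]card_ord -sumr_const ler_sum// => k _.
rewrite /grid_time mulrC -ler_pdivrMr//.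
apply: (le_trans (sum_ord_lt (n := 2 ^ m) _ _)).
- by rewrite divr_ge0// ltW.
- by rewrite ler_pdivrMr// mulrC epsE.
apply: ler_sum => k _; rewrite ltr_pdivlMr//.
have [kt|_] := boolP (_ < capped_time w); last by rewrite indicE.
rewrite indicE mem_set// => j /= jk Dj.
move: kt; apply/negP; rewrite -leNgt -lee_fin capped_timeE ge_min; apply/orP; left.
apply: (@le_trans _ _ (j%:R * (eps / (2 ^ m)%N%:R))%:E).
  by apply: ereal_inf_lbound; exists (j%:R * (eps / (2 ^ m)%N%:R)) => //; split => //; rewrite mulr_ge0// ltW.
by rewrite lee_fin ler_wpM2r ?(ltW dl0)// ler_nat.
Qed.

Lemma grid_time_cvg w : grid_time m w @[m --> \oo] --> capped_time w.
Proof.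
have /andP[t0 te] := capped_time_bounds w.
apply/cvgrPdist_le => e e0.
suff [m0 m0P] : exists m0, forall m, (m0 <= m)%N -> grid_time m w <= capped_time w + e.
  exists m0 => // m /= mm; have /andP[g1 _] := grid_time_bounds m w.
  by rewrite distrC ger0_norm ?subr_ge0// lerBlDl m0P.
have [tE|tE] := leP eps (capped_time w).
  exists 0%N => m _; have /andP[_ g1] := grid_time_bounds m w.
  by rewrite (le_trans g1)// (le_trans tE)// lerDl ltW.
have : (first_time (D ^~ w) < (Num.min eps (capped_time w + e))%:E)%E.
  rewrite EFin_min lt_min; apply/andP; split.
    move: (tE); rewrite -lte_fin capped_timeE /mine; case: ifP => //; by rewrite ltxx.
  apply: (@le_lt_trans _ _ (capped_time w)%:E); last by rewrite lte_fin ltrDl.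
  move: (tE); rewrite -lte_fin capped_timeE /mine; case: ifP => //; by rewrite ltxx.
move=> /first_time_ltP[s [s0 Ds]]; rewrite lte_fin lt_min => /andP[se st].
have [m0 m0P] := grid_crossing (@rD w) s0 Ds se st.
exists m0 => m /m0P[k [km /andP[_ kt] Dk]].
have p2 : (0 : R) < (2 ^ m)%N%:R by rewrite ltr0n expn_gt0.
have dl0 : 0 < eps / (2 ^ m)%N%:R by rewrite divr_gt0.
apply: (le_trans _ (ltW kt)); rewrite /grid_time mulrC ler_wpM2r ?(ltW dl0)//.
have -> : \sum_(i < 2 ^ m) \1_(grid_alive m i.+1) w =
    \sum_(i < 2 ^ m | (i < k)%N) \1_(grid_alive m i.+1) w :> R.
  rewrite [RHS]big_mkcond; apply: eq_bigr => i _; case: ltnP => // ki.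
  by rewrite indicE memNset// => /(_ k ki).
apply: (@le_trans _ _ (\sum_(i < 2 ^ m | (i < k)%N) 1)).
  by apply: ler_sum => i _; rewrite indicE lern1 leq_b1.
by rewrite -(big_ord_widen _ (fun=> 1) (ltnW km)) sumr_const card_ord.
Qed.

Lemma grid_integral (P : probability T R) :
  eps / (2 ^ m)%N%:R * \sum_(k < 2 ^ m) fine (P (grid_alive m k.+1))
  @[m --> \oo] --> \int[P]_w capped_time w.
Proof.
have -> : (fun m => eps / (2 ^ m)%N%:R * \sum_(k < 2 ^ m) fine (P (grid_alive m k.+1))) =
    (fun m => \int[P]_w grid_time m w).
  apply/funext => m; rewrite bm_RintegralZ; last first.
    by apply: bm_sum => k; apply: bm_indic; exact: measurable_grid_alive.
  rewrite bm_Rintegral_sum; last by move=> k; apply: bm_indic; exact: measurable_grid_alive.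
  by congr (_ * _); apply: eq_bigr => k _; rewrite bm_Rintegral_indic//; exact: measurable_grid_alive.
apply: (@bm_cvg_Rintegral _ _ _ _ _ _ eps).
- by move=> m; case: (bm_grid_time m).
- by case: bm_capped_time.
- move=> m w; have /andP[g1 g2] := grid_time_bounds m w.
  have /andP[t0 _] := capped_time_bounds w.
  by rewrite ger0_norm// (le_trans t0).
- exact: grid_time_cvg.
Qed.

End measurable_first_time.

(** * Small jumps and drift of a process of bounded variation *)

Section dyadic_cosine_sums.
Context (R : realType).
Implicit Types x y : R.

Lemma abs_sin_le x : `|sin x| <= `|x|.
Proof.
wlog x0 : x / 0 <= x => [H|].
  have [|x0] := leP 0 x; first exact: H.
  by rewrite -normrN -sinN -(normrN x); apply: H; rewrite oppr_ge0 ltW.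
move: x0; rewrite le_eqVlt => /predU1P[<-|x0]; first by rewrite sin0 normr0.
have [c _] := @MVT R sin cos 0 x x0 (fun y _ => is_derive_sin y)
  (continuous_subspaceT (@continuous_sin R)).
rewrite sin0 !subr0 => ->; rewrite normrM ler_piMl//; exact: cos_max.
Qed.

Lemma one_sub_cos_half x : 1 - cos x = 2 * sin (x / 2) ^+ 2.
Proof.
have -> : cos x = cos (x / 2 + x / 2) by congr cos; field.
by rewrite cosD; have := cos2Dsin2 (x / 2); nra.
Qed.

Lemma one_sub_cos_le x : 1 - cos x <= x ^+ 2 / 2.
Proof.
rewrite one_sub_cos_half -real_normK ?num_real// -[x ^+ 2]real_normK ?num_real//.
have := abs_sin_le (x / 2); rewrite normrM (ger0_norm (x := 2^-1)) ?invr_ge0//.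
by have := normr_ge0 (sin (x / 2)); nra.
Qed.

Lemma one_sub_cos_ge0 x : 0 <= 1 - cos x.
Proof. by rewrite subr_ge0 cos_le1. Qed.

Lemma one_sub_cos_le2 x : 1 - cos x <= 2.
Proof. by have := cos_geN1 x; lra. Qed.

Definition cos_const : R := 1 - cos (2^-1).

Lemma cos_const_gt0 : 0 < cos_const.
Proof.
have p2 := pi_ge2 R.
suff : cos 2^-1 < cos 0 :> R by rewrite cos0 /cos_const; lra.
by rewrite ltr_cos ?in_itv/=; lra.
Qed.

Lemma one_sub_cos_ge x : 2^-1 <= `|x| <= 1 -> cos_const <= 1 - cos x.
Proof.
move=> /andP[x1 x2]; rewrite lerD2l lerN2.
have -> : cos x = cos `|x| by case: (ger0P x) => // _; rewrite cosN.
have p2 := pi_ge2 R.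
by rewrite leNgt ltr_cos ?in_itv/= -?leNgt//; lra.
Qed.

(* A substitute for min(|x|, 2^-J), of the same order when |x| >= 2^-N, whose
   expectation is read off the characteristic function. *)
Definition cos_sum J N x := \sum_(J <= j < N) 2 ^- j * (1 - cos (2 ^+ j * x)).

Lemma cos_sum_rec N x : cos_sum 0 N.+1 x = 1 - cos x + cos_sum 0 N (2 * x) / 2.
Proof.
rewrite /cos_sum big_nat_recl// expr0 invr1 !mul1r; congr (_ + _).
rewrite mulr_suml; apply: eq_bigr => j _.
by rewrite exprSr mulrA invfM mulrAC -!mulrA.
Qed.

Lemma cos_sum0_le4 N x : cos_sum 0 N x <= 4.
Proof.
elim: N x => [|N IH] x; first by rewrite /cos_sum big_geq.
by rewrite cos_sum_rec; have := IH (2 * x); have := one_sub_cos_le2 x; lra.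
Qed.

Lemma cos_sum0_le N x : cos_sum 0 N x <= 9 * Num.min `|x| 1.
Proof.
have [x1|x1] := leP `|x| 1; last by have := cos_sum0_le4 N x; lra.
(* The correction makes the bound reproduce itself: half the bound at 2 x is 9 |x| - x^2, and 1 -
   cos x adds at most x^2 / 2. The constant 9 covers 1/2 < |x| <= 1, where the sum is at most 4. *)
suff : cos_sum 0 N x <= 9 * `|x| - `|x| ^+ 2 / 2 by have := sqr_ge0 `|x|; lra.
elim: N x x1 => [|N IH] x x1.
  by rewrite /cos_sum big_geq//; have := normr_ge0 x; nra.
have := one_sub_cos_le x; rewrite -[x ^+ 2]real_normK ?num_real// => cx.
have [xh|xh] := leP `|x| 2^-1; last first.
  by have := cos_sum0_le4 N.+1 x; have := normr_ge0 x; nra.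
rewrite cos_sum_rec.
have n2 : `|2 * x| = 2 * `|x| by rewrite normrM ger0_norm.
have := IH (2 * x); rewrite n2 => /(_ _); lra.
Qed.

Lemma cos_sum_shift J N x :
  cos_sum J N x = 2 ^- J * cos_sum 0 (N - J) (2 ^+ J * x).
Proof.
rewrite /cos_sum -{1}[J]add0n big_addn mulr_sumr; apply: eq_bigr => j _.
by rewrite exprD invfM mulrA [in LHS](mulrC _^-1) -!mulrA.
Qed.

Lemma cos_sum_le J N x : cos_sum J N x <= 9 * Num.min `|x| (2 ^- J).
Proof.
rewrite cos_sum_shift; have p : (0 : R) < 2 ^- J by rewrite invr_gt0 exprn_gt0.
apply: (le_trans (ler_wpM2l (ltW p) (cos_sum0_le _ _))).
rewrite mulrCA ler_wpM2l// le_min; apply/andP; split.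
  rewrite -ler_pdivlMl// invrK ge_min; apply/orP; left.
  by rewrite normrM ger0_norm// exprn_ge0.
by rewrite -ler_pdivlMl// mulVf ?gt_eqF// ge_min lexx orbT.
Qed.

Lemma cos_sum_ge0 J N x : 0 <= cos_sum J N x.
Proof.
by apply: sumr_ge0 => j _; rewrite mulr_ge0 ?one_sub_cos_ge0// invr_ge0 exprn_ge0.
Qed.

Lemma cos_sum_ge J N x : 2 ^- N <= `|x| -> `|x| <= 2 ^- J ->
  cos_const * `|x| <= cos_sum J N.+1 x.
Proof.
move=> xN xJ.
have p j : (0 : R) < 2 ^- j by rewrite invr_gt0 exprn_gt0.
(* One scale suffices: 2^m |x| lies in [1/2, 1], so the term of index m alone is at least
   [cos_const] times 2^-m, hence times |x|; the other terms are nonnegative. *)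
have [m [Jm mN xm xm']] : exists m, [/\ (J <= m)%N, (m <= N)%N, 2 ^- m.+1 <= `|x| & `|x| <= 2 ^- m].
  elim: N xN => [|N IH] xN.
    exists 0%N; split => //.
    - rewrite leqNgt; apply/negP => J0.
      suff : 2 ^- J < 2 ^- 0 :> R by move: xN; lra.
      by rewrite ltf_pV2 ?posrE ?exprn_gt0// ltr_eXn2l ?ltr1n.
    - by apply: le_trans xN; rewrite exprS invfM expr0; lra.
    - apply: (le_trans xJ); rewrite lef_pV2 ?posrE ?exprn_gt0//.
      by rewrite ler_eXn2l ?ltr1n.
  have [xN'|xN'] := leP (2 ^- N) `|x|.
    by have [m [? ? ? ?]] := IH xN'; exists m; split => //; exact: leqW.
  have [JN|NJ] := leqP J N.
    by exists N; split => //; exact: ltW.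
  exists N.+1; split => //.
  - rewrite leqNgt; apply/negP => NJ'.
    suff : 2 ^- J < 2 ^- N.+1 :> R by move: xN xJ; lra.
    by rewrite ltf_pV2 ?posrE ?exprn_gt0// ltr_eXn2l ?ltr1n.
  - by apply: le_trans xN; rewrite lef_pV2 ?posrE ?exprn_gt0// ler_eXn2l ?ltr1n.
  - apply: (le_trans xJ); rewrite lef_pV2 ?posrE ?exprn_gt0//.
    by rewrite ler_eXn2l ?ltr1n.
apply: (@le_trans _ _ (2 ^- m * (1 - cos (2 ^+ m * x)))).
  apply: (@le_trans _ _ (2 ^- m * cos_const)).
    by rewrite mulrC ler_wpM2r// ltW// cos_const_gt0.
  rewrite ler_wpM2l ?(ltW (p m))// one_sub_cos_ge// normrM ger0_norm ?exprn_ge0//.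
  have q : (0 : R) < 2 ^+ m by rewrite exprn_gt0.
  have := ler_wpM2l (ltW q) xm; have := ler_wpM2l (ltW q) xm'.
  rewrite exprS invfM mulrCA mulfV ?gt_eqF// mulr1; lra.
rewrite /cos_sum (@big_cat_nat _ _ _ m)//= ?(leqW mN)//.
rewrite (@big_cat_nat _ _ _ m.+1 m)//= big_nat1.
have s0 a b : 0 <= \sum_(a <= j < b) 2 ^- j * (1 - cos (2 ^+ j * x)) by exact: cos_sum_ge0.
by have := s0 J m; have := s0 m.+1 N.+1; lra.
Qed.

End dyadic_cosine_sums.

(** * Bounded variation gives a truncated first moment of order t *)

Section bounded_variation_moment.
Context d (T : measurableType d) (R : realType) (P : probability T R).
Context (X : R -> {RV P >-> R}) (hX : is_Levy X).

Lemma law_Rintegral (Y : {RV P >-> R}) (f : R -> R) : bm f ->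
  \int[distribution P Y]_y f y = \int[P]_w f (Y w).
Proof.
move=> bf; rewrite /Rintegral integral_distribution//.
- by apply/measurable_EFinP; case: bf.
- by apply: (bm_integrable P (f := f \o Y)); exact: bm_comp bf.
Qed.

Lemma mesh_variation (f : R -> R) n : (0 < n)%N ->
  variations 0 1 f (\sum_(i < n)
    `|f (0 + i.+1%:R * n%:R^-1) - f (0 + i%:R * n%:R^-1)|).
Proof.
move=> n0; pose g i : R := 0 + i%:R * n%:R^-1.
have n0' : (0 : R) < n%:R by rewrite ltr0n.
have g0 : g 0%N = 0 by rewrite /g mul0r addr0.
have gn : g n = 1 by rewrite /g add0r mulfV// gt_eqF.
exists (map g (iota 1 n)).
  split.
    have : sorted <%O (map g (iota 0 n.+1)).
      apply: (homo_sorted (e := ltn) (e' := <%O)); last exact: iota_ltn_sorted.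
      by move=> i j ij; rewrite /g ltrD2l ltr_pM2r ?invr_gt0// ltr_nat.
    by rewrite /= g0.
  rewrite -{1}g0 last_map -gn; apply/eqP; congr g.
  by rewrite (last_nth 0%N) size_iota -[0%N :: _]/(iota 0 n.+1) nth_iota.
rewrite /variation size_map size_iota big_mkord; apply: eq_bigr => i _.
have gE j : (j <= n)%N -> nth 1 (0 :: map g (iota 1 n)) j = g j.
  by move=> jn; rewrite -{1}g0 -[_ :: _]/(map g (iota 0 n.+1)) (nth_map 0%N) ?size_iota// nth_iota.
have -> : `|f (g i.+1) - f (g i)| = `|f (nth 1 (0 :: map g (iota 1 n)) i.+1) -
    f (nth 1 (0 :: map g (iota 1 n)) i)| by rewrite !gE// ltnW.
by [].
Qed.

(** Independence turns a bound on the total variation into one on a single increment. The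
    expectation of exp(- sum of min(|xi|, 1)) is the N-th power of that of one factor. It is at
    least [c0], because the variation stays below some [M] with probability at least 1/2, and it is
    at most exp(- N x / 2), where x is the moment sought; so N x / 2 <= 1 / c0. *)
Lemma BV_moment : bounded_variation_process X ->
  exists K : R, forall m,
    \int[P]_w Num.min `|X ((2 ^ m)%N%:R^-1) w| 1 <= K / (2 ^ m)%N%:R.
Proof.
move=> bvX.
pose xi (m i : nat) w := X (0 + i.+1%:R * (2 ^ m)%N%:R^-1) w - X (0 + i%:R * (2 ^ m)%N%:R^-1) w.
have mxi m i : measurable_fun setT (xi m i) by exact: measurable_incr.
pose V m w : R := \sum_(i < 2 ^ m) `|xi m i w|.
have mV m : measurable_fun setT (V m).
  by apply: measurable_sum => i; apply: measurableT_comp.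
(* Only dyadic meshes enter, which makes [A M] measurable; bounded variation puts almost every path
   in some [A M]. *)
pose A (M : nat) := \bigcap_m [set w | V m w <= M%:R].
have mA M : measurable (A M).
  apply: bigcap_measurableType => m _; rewrite -[X in measurable X]setTI.
  by have := mV m measurableT _ (measurable_itv `]-oo, (M%:R)]); rewrite set_itvNyc.
have mUA : measurable (\bigcup_M A M) by exact: bigcup_measurable.
have PUA : P (\bigcup_M A M) = 1%E.
  case: bvX => N [mN PN NX].
  apply/eqP; rewrite eq_le probability_le1//=.
  rewrite -[X in (X <= _)%E](@probability_setT _ _ _ P) -(setUv N) measureU//; last exact: setICr.
    rewrite [X in (X + _ <= _)%E](_ : _ = 0%E) ?add0e; last exact: PN.
    apply: le_measure; rewrite ?inE//; first exact: measurableC.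
    move=> w Nw.
    have /contrapT bvw : ~ ~ (forall t, 0 <= t -> bounded_variation 0 t (fun s => X s w)).
      by move=> H; apply: Nw; exact: NX.
    have [M ubM] := bvw 1 ler01.
    exists (Num.truncn M).+1 => // m _ /=.
    apply: (le_trans (ubM _ _) (ltW (truncnS_gt _))).
    by apply: mesh_variation; rewrite expn_gt0.
  exact: measurableC.
have [M PM] : exists M, 2^-1 <= fine (P (A M)).
  have cvgA : P (A M) @[M --> \oo] --> (1%:E : \bar R).
    rewrite -PUA; apply: nondecreasing_cvg_mu => // M M' MM'.
    apply/subsetPset => w AM m _ /=; apply: (le_trans (AM m I)); by rewrite ler_nat.
  have cA : fine (P (A M)) @[M --> \oo] --> (1 : R) by exact: fine_cvg cvgA.
  move/cvgrPdist_lt : cA => cA.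
  have h0 : (0 : R) < 2^-1 by rewrite invr_gt0.
  have [M _ /(_ M (leqnn _))/=] := cA _ h0.
  by rewrite ltr_norml => HM; exists M; lra.
pose c0 : R := expR (- M%:R) / 2.
have c00 : 0 < c0 by rewrite divr_gt0// expR_gt0.
exists (2 / c0) => m.
set N := (2 ^ m)%N; have N0 : (0 : R) < N%:R by rewrite ltr0n expn_gt0.
pose f (y : R) := expR (- Num.min `|y| 1).
have fb y : 0 <= f y <= 1.
  by rewrite expR_ge0/= -expR0 ler_expR oppr_le0 le_min normr_ge0/=.
have bmin : bm (fun y : R => Num.min `|y| 1) by apply: bm_min.
have bf : bm f.
  split; last by exists 1 => y; have /andP[? ?] := fb y; rewrite ger0_norm.
  by apply: measurableT_comp => //; apply: measurableT_comp => //; case: bmin.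
have := levy_prod (dl := N%:R^-1) (s := 0) hX N _ _ bf.
rewrite invr_ge0 ler0n => /(_ isT (lexx _) (fun y => (andP (fb y)).1)) prodE.
have lower : c0 <= (\int[distribution P (X N%:R^-1)]_y f y) ^+ N.
  rewrite -prodE /c0; apply: (@le_trans _ _ (expR (- M%:R) * fine (P (A M)))).
    by rewrite ler_wpM2l ?expR_ge0.
  apply: bm_markov => //.
  - by apply: bm_prod => i; apply: (bm_comp (mxi m i) bf).
  - by move=> w; apply: prodr_ge0 => i _; exact: (andP (fb _)).1.
  - move=> w /(_ m I) /= VM; rewrite /f -expR_sum ler_expR sumrN lerN2.
    apply: (le_trans _ VM); apply: ler_sum => i _; by rewrite ge_min lexx.
have i01 : 0 <= \int[P]_w Num.min `|X N%:R^-1 w| 1.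
  by apply: Rintegral_ge0 => w _; rewrite le_min normr_ge0/=.
set x := \int[P]_w Num.min _ _ in i01 *.
have bminX : bm (fun w => Num.min `|X N%:R^-1 w| 1).
  exact: (bm_comp (f := fun y : R => Num.min `|y| 1)).
have fx : \int[distribution P (X N%:R^-1)]_y f y <= expR (- (x / 2)).
  (* On [0, 1] one has exp(-u) <= 1 - u / 2, and then 1 - x / 2 <= exp(- x / 2). *)
  rewrite law_Rintegral//; apply: (@le_trans _ _ (1 + (- (2^-1)) * x)).
    rewrite -(bm_Rintegral_affine P 1 (- 2^-1) bminX); apply: bm_le_Rintegral.
    - exact: bm_comp bf.
    - by apply: bmD; [exact: bm_cst|exact: bmZ].
    - move=> w; rewrite /f; set u := Num.min _ _.
      have u01 : 0 <= u <= 1 by rewrite le_min normr_ge0 ler01 ge_min lexx orbT.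
      rewrite expRN invf_ple ?posrE ?expR_gt0//; last by lra.
      apply: (le_trans _ (expR_ge1Dx u)).
      rewrite -div1r ler_pdivrMr; last lra.
      have /andP[u0 u1] := u01; nra.
  by apply: (le_trans _ (expR_ge1Dx _)); lra.
have : c0 <= expR (- (N%:R * (x / 2))).
  apply: (le_trans lower); rewrite -mulrN expRM_natl.
  by rewrite lerXn2r// ?nnegrE ?expR_ge0//; apply: Rintegral_ge0 => y _; exact: (andP (fb y)).1.
rewrite expRN invf_pge ?posrE ?expR_gt0// => /(le_trans (expR_ge1Dx _)) h.
rewrite ler_pdivlMr//; lra.
Qed.

End bounded_variation_moment.

Lemma integrable_dom d (T : measurableType d) (R : realType)
    (mu : {measure set T -> \bar R}) (f g : T -> R) (c : R) :
  measurable_fun setT f -> mu.-integrable setT (EFin \o g) ->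
  (forall x, `|f x| <= c * g x) -> mu.-integrable setT (EFin \o f).
Proof.
move=> mf ig fg; apply: (@le_integrable _ _ _ mu setT measurableT _
  (fun x => (c%:E * (g x)%:E)%E)).
- exact/measurable_EFinP.
- by move=> x _ /=; rewrite lee_fin (le_trans (fg x))// ler_norm.
- exact: integrableZl.
Qed.

Lemma measurable_cosM (R : realType) (a : R) : measurable_fun setT (fun x : R => cos (a * x)).
Proof.
apply: (measurableT_comp (continuous_measurable_fun (@continuous_cos R))).
exact: measurable_funM.
Qed.

Lemma measurable_sinM (R : realType) (a : R) : measurable_fun setT (fun x : R => sin (a * x)).
Proof.
apply: (measurableT_comp (continuous_measurable_fun (@continuous_sin R))).
exact: measurable_funM.
Qed.

Lemma measurable_min_abs (R : realType) (h : R) :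
  measurable_fun setT (fun x : R => Num.min `|x| h).
Proof. by apply: measurable_minr => //; exact: measurableT_comp. Qed.

(** * The characteristic exponent at dyadic frequencies *)

Section exponent.
Context d (T : measurableType d) (R : realType) (P : probability T R).
Context (X : R -> {RV P >-> R}) (gamma sigma : R) (Pi : {measure set R -> \bar R}).
Hypothesis hXt : has_Levy_triplet X gamma sigma Pi.

Local Notation psiR th := (complex.Re (Levy_exponent gamma sigma Pi th)).
Local Notation psiI th := (complex.Im (Levy_exponent gamma sigma Pi th)).

Lemma integrable_min1sq : Pi.-integrable setT (EFin \o fun x : R => Num.min 1 (x ^+ 2)).
Proof.
have [[_ i1] _] := hXt; apply/integrableP; split.
  apply/measurable_EFinP.
  have -> : (fun x : R => Num.min 1 (x ^+ 2)) = cst 1 \min (fun x => x * x).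
    by apply/funext => x; rewrite /= expr2.
  by apply: measurable_minr => //; exact: measurable_funM.
under eq_integral do rewrite /= ger0_norm ?le_min ?ler01 ?sqr_ge0//.
exact: i1.
Qed.

Lemma integrable_one_sub_cos th : Pi.-integrable setT (EFin \o fun x : R => 1 - cos (th * x)).
Proof.
apply: (integrable_dom (c := 2 + th ^+ 2) _ integrable_min1sq).
  by apply: measurable_funB => //; exact: measurable_cosM.
move=> x; rewrite ger0_norm ?one_sub_cos_ge0//.
have t0 := sqr_ge0 th; have [x1|x1] := leP 1 (x ^+ 2).
  by have := one_sub_cos_le2 (th * x); lra.
have := one_sub_cos_le (th * x); rewrite exprMn.
have := sqr_ge0 x; nra.
Qed.

Lemma psiRE th : psiR th = - (sigma ^+ 2 * th ^+ 2 / 2) - \int[Pi]_x (1 - cos (th * x)).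
Proof.
rewrite /Levy_exponent /= !(mul0r, mul1r, sub0r, add0r, oppr0, addr0, mulr0).
congr (_ + _); rewrite -[RHS]mulN1r -RintegralZl//; last exact: integrable_one_sub_cos.
apply: eq_Rintegral => x _.
by rewrite !(mul0r, mul1r, sub0r, add0r, oppr0, addr0, mulr0) expR0; lra.
Qed.

Lemma psiIE th : psiI th = th * gamma +
  \int[Pi]_x (sin (th * x) - th * x * (\1_[set y : R | `|y| <= 1] x)).
Proof.
rewrite /Levy_exponent /= !(mul0r, mul1r, sub0r, add0r, oppr0, addr0, mulr0).
congr (_ + _); apply: eq_Rintegral => x _.
by rewrite !(mul0r, mul1r, sub0r, add0r, oppr0, addr0, mulr0) expR0; lra.
Qed.

Lemma psiR_le0 th : psiR th <= 0.
Proof.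
rewrite psiRE; have : 0 <= \int[Pi]_x (1 - cos (th * x)).
  by apply: Rintegral_ge0 => x _; exact: one_sub_cos_ge0.
have := mulr_ge0 (sqr_ge0 sigma) (sqr_ge0 th); lra.
Qed.

Lemma charfun_cos t th : 0 <= t ->
  \int[P]_w cos (th * X t w) = expR (t * psiR th) * cos (t * psiI th).
Proof.
move=> t0; have /(congr1 (@complex.Re R)) := hXt.2 t th t0.
rewrite /charfun /Cintegral /= !(mul0r, mul1r, sub0r, add0r, oppr0, addr0, mulr0, subr0) => <-.
apply: eq_Rintegral => w _.
by rewrite !(mul0r, mul1r, sub0r, add0r, oppr0, addr0, mulr0) expR0; lra.
Qed.

Lemma charfun_sin t th : 0 <= t ->
  \int[P]_w sin (th * X t w) = expR (t * psiR th) * sin (t * psiI th).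
Proof.
move=> t0; have /(congr1 (@complex.Im R)) := hXt.2 t th t0.
rewrite /charfun /Cintegral /= !(mul0r, mul1r, sub0r, add0r, oppr0, addr0, mulr0, subr0) => <-.
apply: eq_Rintegral => w _.
by rewrite !(mul0r, mul1r, sub0r, add0r, oppr0, addr0, mulr0) expR0; lra.
Qed.

Lemma bm_cos (a : R) t : bm (fun w => cos (a * X t w)).
Proof.
apply: (bm_comp (f := fun x : R => cos (a * x))) => //.
split; first exact: measurable_cosM.
by exists 1 => x; exact: cos_max.
Qed.

Lemma bm_sin (a : R) t : bm (fun w => sin (a * X t w)).
Proof.
apply: (bm_comp (f := fun x : R => sin (a * x))) => //.
split; first exact: measurable_sinM.
by exists 1 => x; exact: sin_max.
Qed.

(** The left side equals 1 - exp(a) cos(b) with a = t Re psi <= 0 and b = t (Im psi - th * e), which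
    is at most - a + b^2 / 2. *)
Lemma shifted_one_sub_cos_le t th e : 0 <= t ->
  \int[P]_w (1 - cos (th * (X t w - e * t))) <=
  t * (- psiR th) + t ^+ 2 * (psiI th - th * e) ^+ 2 / 2.
Proof.
move=> t0.
have -> : \int[P]_w (1 - cos (th * (X t w - e * t))) =
    1 - expR (t * psiR th) * cos (t * (psiI th - th * e)).
  have -> : t * (psiI th - th * e) = t * psiI th + - (th * (e * t)) by ring.
  rewrite cosD cosN sinN mulrN opprK.
  set u := th * (e * t).
  transitivity (\int[P]_w (1 - (cos u * cos (th * X t w) + sin u * sin (th * X t w)))).
    apply: eq_Rintegral => w _; congr (1 - _).
    by rewrite mulrBr cosB -/u; ring.
  have bc := bmZ (cos u) (bm_cos th t); have bs := bmZ (sin u) (bm_sin th t).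
  rewrite (bm_RintegralB P (bm_cst _ 1) (bmD bc bs)) bm_Rintegral_cst.
  rewrite (bm_RintegralD P bc bs) !bm_RintegralZ; [|exact: bm_sin|exact: bm_cos].
  by rewrite charfun_cos// charfun_sin//; ring.
set a := t * psiR th; set b := t * (psiI th - th * e).
have -> : t ^+ 2 * (psiI th - th * e) ^+ 2 / 2 = b ^+ 2 / 2 by rewrite exprMn.
rewrite mulrN -/a.
have a0 : a <= 0 by rewrite mulr_ge0_le0// psiR_le0.
have e1 := expR_ge1Dx a.
have e2 : expR a <= 1 by rewrite -expR0 ler_expR.
have e0 := expR_ge0 a.
have c1 := one_sub_cos_le b; have c0 := one_sub_cos_ge0 b.
have : expR a * (1 - cos b) <= 1 - cos b by rewrite ler_piMl.
rewrite mulrBr mulr1; lra.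
Qed.

Section small_jumps.
Variable K : R.
Hypothesis hK : forall m,
  \int[P]_w Num.min `|X ((2 ^ m)%N%:R^-1) w| 1 <= K / (2 ^ m)%N%:R.

(** The expectation of [cos_sum] at X_dl is at most 9 K dl, while each E(1 - cos(th X_dl)) is at
    least 1 - exp(dl * Re psi(th)), hence almost - dl * Re psi(th). The error factor 1 + Q * dl
    tends to 1 with the mesh because [Q] is a finite sum for fixed [N], and the bound obtained is
    free of [N]. *)
Lemma cos_sum_exponent_le N : \sum_(0 <= j < N) 2 ^- j * (- psiR (2 ^+ j)) <= 9 * K.
Proof.
pose q j := - psiR (2 ^+ j); have q0 j : 0 <= q j by rewrite oppr_ge0 psiR_le0.
pose Q := \sum_(0 <= j < N) q j.
have Q0 : 0 <= Q by apply: sumr_ge0.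
rewrite -/(\sum_(0 <= j < N) 2 ^- j * q j).
have p2 m : (0 : R) < (2 ^ m)%N%:R by rewrite ltr0n expn_gt0.
have main m : \sum_(0 <= j < N) 2 ^- j * q j <= 9 * K * (1 + Q / (2 ^ m)%N%:R).
  set dl := (2 ^ m)%N%:R^-1; have dl0 : 0 < dl by rewrite invr_gt0.
  have h1 : \int[P]_w cos_sum 0 N (X dl w) <= 9 * (K * dl).
    apply: (@le_trans _ _ (\int[P]_w (9 * Num.min `|X dl w| 1))).
      have bmin : bm (fun w => Num.min `|X dl w| 1) by apply: bm_min => //; exact: measurableT_comp.
      apply: bm_le_Rintegral; [|exact: bmZ|by move=> w; exact: cos_sum0_le].
      apply: bm_sum => j; apply: bmZ; apply: bmB; first exact: bm_cst.
      exact: bm_cos.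
    rewrite bm_RintegralZ; last by apply: bm_min => //; exact: measurableT_comp.
    by rewrite ler_wpM2l//; exact: hK.
  have h2 : \int[P]_w cos_sum 0 N (X dl w) =
      \sum_(0 <= j < N) 2 ^- j * (1 - expR (dl * psiR (2 ^+ j)) * cos (dl * psiI (2 ^+ j))).
    rewrite bm_Rintegral_sum; last first.
      by move=> j; apply: bmZ; apply: bmB; [exact: bm_cst|exact: bm_cos].
    apply: eq_bigr => j _; rewrite bm_RintegralZ; last first.
      by apply: bmB; [exact: bm_cst|exact: bm_cos].
    rewrite bm_RintegralB; [|exact: bm_cst|exact: bm_cos].
    by rewrite bm_Rintegral_cst charfun_cos// ltW.
  have h3 : \sum_(0 <= j < N) 2 ^- j * q j * (dl / (1 + dl * Q)) <= 9 * (K * dl).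
    apply: le_trans h1; rewrite h2 !big_mkord; apply: ler_sum => j _.
    rewrite -mulrA ler_wpM2l ?invr_ge0 ?exprn_ge0//.
    have qQ : q j <= Q.
      by rewrite /Q big_mkord (bigD1 j)//= lerDl; apply: sumr_ge0.
    have -> : dl * psiR (2 ^+ j) = - (dl * q j) by rewrite /q; ring.
    have u0 : 0 <= dl * q j by rewrite mulr_ge0// ltW.
    apply: (@le_trans _ _ (1 - expR (- (dl * q j)))).
      rewrite expRN.
      have : (expR (dl * q j))^-1 <= (1 + dl * q j)^-1.
        by rewrite lef_pV2 ?posrE ?expR_gt0 ?expR_ge1Dx//; lra.
      have : 1 - (1 + dl * q j)^-1 = dl * q j / (1 + dl * q j) by field; lra.
      have : q j * (dl / (1 + dl * Q)) <= dl * q j / (1 + dl * q j).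
        have -> : q j * (dl / (1 + dl * Q)) = dl * q j / (1 + dl * Q) by ring.
        rewrite ler_wpM2l// lef_pV2 ?posrE; [|nra|lra].
        by rewrite lerD2l ler_wpM2l// ltW.
      lra.
    have := cos_le1 (dl * psiI (2 ^+ j)); have := expR_ge0 (- (dl * q j)); nra.
  move: h3; rewrite -mulr_suml => h3.
  have dQ : 0 <= dl * Q by rewrite mulr_ge0// ltW.
  have den : 0 < 1 + dl * Q by lra.
  move: h3; rewrite mulrA ler_pdivrMr// => h3.
  have : (\sum_(0 <= j < N) 2 ^- j * q j) * dl <= (9 * K * (1 + Q * dl)) * dl by lra.
  by rewrite ler_pM2r.
rewrite leNgt; apply/negP => lt9.
have S0 : 0 <= \sum_(0 <= j < N) 2 ^- j * q j.
  by apply: sumr_ge0 => j _; rewrite mulr_ge0// invr_ge0 exprn_ge0.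
have K0 : 0 <= K.
  have := hK 0; rewrite expn0 invr1 mulr1; apply: le_trans.
  by apply: Rintegral_ge0 => w _; rewrite le_min normr_ge0/=.
have [KQ|KQ] := leP (9 * K * Q) 0.
  by have := main 0%N; rewrite expn0 divr1; lra.
set S := \sum_(_ <= _ < _) _ in S0 lt9 main *.
have e0 : 0 < S - 9 * K by lra.
have [m0 /(_ m0 (leqnn _))] := dyadic_small KQ e0.
by have := main m0; rewrite mulrDr mulr1 -mulrA; lra.
Qed.

(** A Gaussian part contributes sigma^2 4^j / 2 to - Re psi(2^j), so each term of the bounded sum
    would be at least sigma^2 / 2. *)
Lemma sigma_eq0 : sigma ^+ 2 = 0.
Proof.
apply/eqP; rewrite eq_le sqr_ge0 andbT leNgt; apply/negP => s0.
have K0 : 0 <= K by have := cos_sum_exponent_le 0; rewrite big_geq//; lra.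
have [N NK] : exists N : nat, 18 * K / sigma ^+ 2 < N%:R.
  by exists (Num.truncn (18 * K / sigma ^+ 2)).+1; exact: truncnS_gt.
have := cos_sum_exponent_le N; apply/negP; rewrite -ltNge.
rewrite ltr_pdivrMr// in NK.
apply: (@lt_le_trans _ _ (\sum_(0 <= j < N) sigma ^+ 2 / 2)).
  by rewrite sumr_const_nat subn0 -mulr_natl; lra.
apply: ler_sum => j _; rewrite psiRE opprB.
have i0 : 0 <= \int[Pi]_x (1 - cos (2 ^+ j * x)).
  by apply: Rintegral_ge0 => x _; exact: one_sub_cos_ge0.
have p1 : (1 : R) <= 2 ^+ j by rewrite exprn_ege1// ler1n.
have pj : (0 : R) < 2 ^- j by rewrite invr_gt0 exprn_gt0.
have p0 : 2 ^- j * 2 ^+ j = 1 :> R by rewrite mulVf// gt_eqF// exprn_gt0.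
have e1 : 2 ^- j * (sigma ^+ 2 * (2 ^+ j) ^+ 2 / 2) = 2 ^+ j * (sigma ^+ 2 / 2).
  transitivity ((2 ^- j * 2 ^+ j) * 2 ^+ j * (sigma ^+ 2 / 2)); first by ring.
  by rewrite p0 mul1r.
have e2 : sigma ^+ 2 / 2 <= 2 ^+ j * (sigma ^+ 2 / 2) by rewrite ler_peMl//; lra.
have := mulr_ge0 (ltW pj) i0; rewrite opprK mulrDr e1; lra.
Qed.

End small_jumps.
End exponent.

(** * Integrability of small jumps, and the drift as a limit of the exponent *)

Section drift_moment.
Context d (T : measurableType d) (R : realType) (P : probability T R).
Context (X : R -> {RV P >-> R}) (gamma sigma : R) (Pi : {measure set R -> \bar R}).
Hypotheses (hX : is_Levy X) (hXt : has_Levy_triplet X gamma sigma Pi).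
Variable K : R.
Hypothesis hK : forall m,
  \int[P]_w Num.min `|X ((2 ^ m)%N%:R^-1) w| 1 <= K / (2 ^ m)%N%:R.

Local Notation psiR th := (complex.Re (Levy_exponent gamma sigma Pi th)).
Local Notation psiI th := (complex.Im (Levy_exponent gamma sigma Pi th)).
Local Notation drift := (Levy_drift gamma Pi).

Lemma psiR_cos th : - psiR th = \int[Pi]_x (1 - cos (th * x)).
Proof. by rewrite (psiRE hXt) (sigma_eq0 hXt hK) !mul0r oppr0 sub0r opprK. Qed.

Lemma integrable_cos_sum J N : Pi.-integrable setT (EFin \o cos_sum J N).
Proof.
rewrite (_ : _ \o _ = fun x : R =>
    (\sum_(J <= j < N) (2 ^- j)%:E * (1 - cos (2 ^+ j * x))%:E)%E).
  apply: integrable_sum => // j _; apply: integrableZl => //.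
  exact: (integrable_one_sub_cos hXt).
by apply/funext => x; rewrite /= -sumEFin.
Qed.

Lemma integral_cos_sum J N :
  \int[Pi]_x cos_sum J N x = \sum_(J <= j < N) 2 ^- j * (- psiR (2 ^+ j)).
Proof.
have [JN|NJ] := leqP J N; last first.
  rewrite /cos_sum [RHS]big_geq ?(ltnW NJ)//.
  by under eq_Rintegral do rewrite big_geq ?(ltnW NJ)//; rewrite Rintegral_cst// mul0r.
rewrite -(subnKC JN); elim: (N - J)%N => [|n IH].
  rewrite addn0 /cos_sum [RHS]big_geq//.
  by under eq_Rintegral do rewrite big_geq//; rewrite Rintegral_cst// mul0r.
rewrite addnS big_nat_recr ?leq_addr//= -IH.
have i1 : Pi.-integrable setT (EFin \o fun x : R => 2 ^- (J + n) * (1 - cos (2 ^+ (J + n) * x))).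
  rewrite (_ : _ \o _ = fun x => ((2 ^- (J + n))%:E * (1 - cos (2 ^+ (J + n) * x))%:E)%E)//.
  by apply: integrableZl => //; exact: (integrable_one_sub_cos hXt).
rewrite psiR_cos -RintegralZl//; last exact: (integrable_one_sub_cos hXt).
rewrite -RintegralD//; last exact: integrable_cos_sum.
by apply: eq_Rintegral => x _; rewrite /cos_sum big_nat_recr ?leq_addr.
Qed.

Lemma measurable_abs_ge_le (a b : R) : measurable [set x : R | a <= `|x| <= b].
Proof.
rewrite -[X in measurable X]setTI.
rewrite (_ : [set x : R | _] = (fun x : R => `|x|) @^-1` `[a, b]%classic); last first.
  by apply/seteqP; split => x /=; rewrite in_itv.
have mn : measurable_fun setT (fun x : R => `|x|) by apply: measurableT_comp.
exact: (mn measurableT _ (measurable_itv `[a, b])).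
Qed.

(** On 2^-N <= |x| <= 1, |x| is dominated by a multiple of [cos_sum], whose integral is an exponent
    sum bounded uniformly in [N]; monotone convergence follows. Beyond |x| = 1 the defining
    condition of a Levy measure suffices. *)
Lemma integrable_min_abs1 : Pi.-integrable setT (EFin \o fun x : R => Num.min `|x| 1).
Proof.
pose B N := [set x : R | 2 ^- N <= `|x| <= 1].
have mB N : measurable (B N) by exact: measurable_abs_ge_le.
have mabs : measurable_fun setT (fun x : R => `|x|%:E).
  by apply/measurable_EFinP; exact: normr_measurable.
have c0 := cos_const_gt0 R.
have bound N : (\int[Pi]_(x in B N) `|x|%:E <= (9 * K / cos_const R)%:E)%E.
  apply: (@le_trans _ _ (\int[Pi]_x ((cos_const R)^-1%:E * (cos_sum 0 N.+1 x)%:E))%E).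
    rewrite integral_mkcond; apply: ge0_le_integral => //.
    - by move=> x xT; rewrite /patch; case: ifP => // xB; rewrite lee_fin.
    - by apply/(measurable_restrictT _ _).1 => //; exact: measurable_funTS.
    - apply: measurable_funeM; exact: (measurable_int _ (integrable_cos_sum 0 N.+1)).
    - move=> x _; rewrite /patch; case: ifPn => [|_]; last first.
        by rewrite lee_fin mulr_ge0 ?cos_sum_ge0// invr_ge0 ltW.
      rewrite inE => /andP[x1 x2]; rewrite lee_fin mulrC ler_pdivlMr// mulrC.
      by apply: cos_sum_ge => //; rewrite expr0 invr1.
  rewrite integralZl//; last exact: integrable_cos_sum.
  rewrite -(@fineK _ (\int[Pi]_x _)%E); last first.
    exact: (integrable_fin_num _ (integrable_cos_sum 0 N.+1)).
  rewrite -EFinM lee_fin mulrC ler_wpM2r ?invr_ge0 ?(ltW c0)//.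
  rewrite -/(Rintegral _ _ _) integral_cos_sum.
  exact: (cos_sum_exponent_le hXt hK).
have ndB : nondecreasing_seq B.
  move=> m n mn; apply/subsetPset => x /andP[x1 x2]; apply/andP; split => //.
  by apply: le_trans x1; rewrite lef_pV2 ?posrE ?exprn_gt0// ler_eXn2l ?ltr1n.
have mUB : measurable (\bigcup_N B N) by exact: bigcup_measurable.
have boundU : (\int[Pi]_(x in \bigcup_N B N) `|x|%:E <= (9 * K / cos_const R)%:E)%E.
  have cv : (\int[Pi]_(x in B N) `|x|%:E)%E @[N --> \oo] -->
      (\int[Pi]_(x in \bigcup_N B N) `|x|%:E)%E.
    by apply: ge0_nondecreasing_set_cvg_integral => // N; exact: measurable_funTS.
  by apply: (cvge_le _ cv); near=> N; exact: bound.
have iU : Pi.-integrable setT ((fun x : R => `|x|%:E) \_ (\bigcup_N B N)).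
  apply/integrableP; split.
    by apply/(measurable_restrictT _ _).1 => //; exact: measurable_funTS.
  rewrite (eq_integral ((fun x : R => `|x|%:E) \_ (\bigcup_N B N))).
    rewrite -integral_mkcond; exact: (le_lt_trans boundU (ltry _)).
  by move=> x _; rewrite gee0_abs// /patch; case: ifP => // _; rewrite lee_fin.
apply: (@le_integrable _ _ _ Pi setT measurableT _ (fun x =>
  ((fun x : R => `|x|%:E) \_ (\bigcup_N B N)) x + (Num.min 1 (x ^+ 2))%:E)%E).
- by apply/measurable_EFinP; exact: measurable_min_abs.
- move=> x _ /=; rewrite ger0_norm ?le_min ?normr_ge0 ?ler01//.
  have q0 : 0 <= Num.min 1 (x ^+ 2) by rewrite le_min ler01 sqr_ge0.
  rewrite /patch; case: ifPn => [_|].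
    rewrite -EFinD /= lee_fin [leRHS]ger0_norm ?addr_ge0//.
    by apply: (@le_trans _ _ `|x|); [rewrite ge_min lexx|rewrite lerDl].
  rewrite notin_setE => xB; rewrite add0e /= lee_fin [leRHS]ger0_norm//.
  have [x1|x1] := leP 1 `|x|.
    by rewrite le_min lexx/= -real_normK ?num_real//; nra.
  have [->|x0] := eqVneq x 0; first by rewrite normr0 le_min ler01 sqr_ge0.
  exfalso; apply: xB.
  have x0' : 0 < `|x| by rewrite normr_gt0.
  have [N /(_ N (leqnn _))] := dyadic_small ltr01 x0'.
  rewrite div1r natrX => /ltW Nx; exists N => //; apply/andP; split => //; exact: ltW.
- exact: (integrableD measurableT iU (integrable_min1sq hXt)).
Unshelve. all: by end_near. Qed.

Lemma integrable_min_abs (h : R) : 0 <= h <= 1 ->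
  Pi.-integrable setT (EFin \o fun x : R => Num.min `|x| h).
Proof.
move=> /andP[h0 h1]; apply: (integrable_dom (c := 1) _ integrable_min_abs1).
  exact: measurable_min_abs.
move=> x; rewrite mul1r ger0_norm ?le_min ?normr_ge0//.
by rewrite !ge_min lexx/= h1 !orbT.
Qed.

(** The small-jump modulus: it controls both the tail of the exponent sum and the distance of Im psi
    from the drift. *)
Definition omega J : R := \int[Pi]_x Num.min `|x| (2 ^- J).

Lemma dyadic01 J : 0 <= (2 ^- J : R) <= 1.
Proof.
have p1 : (1 : R) <= 2 ^+ J by rewrite exprn_ege1// ler1n.
by rewrite invr_ge0 exprn_ge0//= invf_le1 ?exprn_gt0.
Qed.

Lemma omega_ge0 J : 0 <= omega J.
Proof.
apply: Rintegral_ge0 => x _; rewrite le_min normr_ge0/=.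
by have /andP[] := dyadic01 J.
Qed.

Lemma omega_cvg : omega J @[J --> \oo] --> 0.
Proof.
have cv : (\int[Pi]_x (Num.min `|x| (2 ^- J))%:E)%E @[J --> \oo] -->
    (\int[Pi]_x cst 0%E x)%E; last first.
  by rewrite integral0 in cv; exact: fine_cvg cv.
apply: (@dominated_cvg _ R R Pi setT measurableT
  (fun J x => (Num.min `|x| (2 ^- J))%:E) (cst 0%E) (EFin \o fun x : R => Num.min `|x| 1)) => //.
- by move=> J; apply/measurable_EFinP; exact: measurable_min_abs.
- move=> x _; apply: cvg_EFin; first by near=> J.
  apply/cvgr0Pnorm_le => e e0.
  have [m0 m0P] := dyadic_small ltr01 e0.
  exists m0 => // J /= /m0P; rewrite div1r natrX => /ltW Je.
  rewrite ger0_norm; first by rewrite ge_min Je orbT.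
  by rewrite le_min normr_ge0/=; have /andP[] := dyadic01 J.
- exact: integrable_min_abs1.
- move=> J x _; rewrite lee_fin ger0_norm.
    by rewrite le_min !ge_min lexx/=; have /andP[_ ->] := dyadic01 J; rewrite orbT.
  by rewrite le_min normr_ge0/=; have /andP[] := dyadic01 J.
Unshelve. all: by end_near. Qed.

Lemma exponent_sum_omega J N :
  \sum_(J <= j < N) 2 ^- j * (- psiR (2 ^+ j)) <= 9 * omega J.
Proof.
rewrite -integral_cos_sum /omega -RintegralZl//; last exact: integrable_min_abs (dyadic01 J).
apply: le_Rintegral => //.
- exact: integrable_cos_sum.
- rewrite (_ : _ \o _ = fun x : R => (9%:E * (Num.min `|x| (2 ^- J))%:E)%E)//.
  by apply: integrableZl => //; exact: integrable_min_abs (dyadic01 J).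
- by move=> x _; exact: cos_sum_le.
Qed.

Lemma integrable_sin j : Pi.-integrable setT (EFin \o fun x : R => sin (2 ^+ j * x)).
Proof.
apply: (integrable_dom (c := 2 ^+ j) _ integrable_min_abs1).
  exact: measurable_sinM.
move=> x; have p1 : (1 : R) <= 2 ^+ j by rewrite exprn_ege1// ler1n.
have [x1|x1] := leP `|x| 1.
  by apply: (le_trans (abs_sin_le _)); rewrite normrM ger0_norm//; lra.
by apply: (le_trans (sin_max _)); lra.
Qed.

Lemma integrable_small_jump : Pi.-integrable setT
  (EFin \o fun x : R => x * \1_[set y : R | `|y| <= 1] x).
Proof.
apply: (integrable_dom (c := 1) _ integrable_min_abs1).
  apply: measurable_funM => //; apply: measurable_indic.
  rewrite (_ : [set y : R | _] = [set y : R | 0 <= `|y| <= 1]).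
    exact: measurable_abs_ge_le.
  by apply/seteqP; split => y /=; rewrite normr_ge0.
move=> x; rewrite mul1r indicE; case: (boolP (_ \in _)) => [|_].
  by rewrite inE/= mulr1 => x1; rewrite min_l.
by rewrite mulr0 normr0 le_min normr_ge0/=.
Qed.

(** The compensator cancels against the drift and leaves the integral of sin(2^j x), where |sin(2^j
    x)| <= 2^j min(|x|, 2^-j). *)
Lemma psiI_drift j : `|psiI (2 ^+ j) - 2 ^+ j * drift| <= 2 ^+ j * omega j.
Proof.
have p0 : (0 : R) < 2 ^+ j by rewrite exprn_gt0.
have -> : psiI (2 ^+ j) - 2 ^+ j * drift = \int[Pi]_x sin (2 ^+ j * x).
  rewrite psiIE /Levy_drift.
  have -> : \int[Pi]_(x in [set x : R | `|x| <= 1]) x =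
      \int[Pi]_x (x * \1_[set y : R | `|y| <= 1] x).
    rewrite Rintegral_mkcond; apply: eq_Rintegral => x _; rewrite /patch indicE.
    by case: ifP; rewrite ?mulr1 ?mulr0.
  have iZ : Pi.-integrable setT
      (EFin \o fun x : R => 2 ^+ j * (x * \1_[set y : R | `|y| <= 1] x)).
    rewrite (_ : _ \o _ = fun x => ((2 ^+ j)%:E * (x * \1_[set y : R | `|y| <= 1] x)%:E)%E)//.
    by apply: integrableZl => //; exact: integrable_small_jump.
  under eq_Rintegral do rewrite -mulrA.
  rewrite RintegralB//; last exact: integrable_sin.
  rewrite RintegralZl//; last exact: integrable_small_jump.
  by ring.
have i1 := integrable_min_abs (dyadic01 j).
apply: (le_trans (le_normr_Rintegral measurableT (integrable_sin j))).
have bd x : `|sin (2 ^+ j * x)| <= 2 ^+ j * Num.min `|x| (2 ^- j).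
  have [x1|x1] := leP `|x| (2 ^- j).
    by apply: (le_trans (abs_sin_le _)); rewrite normrM ger0_norm// ltW.
  by rewrite mulfV ?gt_eqF//; exact: sin_max.
rewrite /omega -RintegralZl//; apply: le_Rintegral => //.
- apply: (integrable_dom (c := 2 ^+ j) _ i1) => [|x]; last by rewrite normr_id.
  by apply: (measurableT_comp (@normr_measurable R setT)); exact: measurable_sinM.
- rewrite (_ : _ \o _ = fun x : R => ((2 ^+ j)%:E * (Num.min `|x| (2 ^- j))%:E)%E)//.
  exact: integrableZl.
- by move=> x _; exact: bd.
Qed.

End drift_moment.

Lemma incr_Rintegral d (T : measurableType d) (R : realType) (P : probability T R)
    (X : R -> {RV P >-> R}) (f : R -> R) (s t : R) : is_Levy X -> bm f ->
  0 <= s -> s <= t ->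
  \int[P]_w f (X t w - X s w) = \int[P]_w f (X (t - s) w).
Proof.
move=> hX bf s0 st.
pose Y : {mfun T >-> R} := HB.pack (fun w => X t w - X s w)
  (isMeasurableFun.Build _ _ _ _ _ (measurable_incr X s t)).
rewrite -[LHS]/(\int[P]_w f (Y w)) -(law_Rintegral Y bf) -(law_Rintegral (X (t - s)) bf).
rewrite /Rintegral; congr fine; apply: eq_measure_integral => A mA _.
exact: (incr_law hX).
Qed.

(** * The mean truncated deviation from the drift is o(t) *)

Section dyadic_drift_moment.
Context d (T : measurableType d) (R : realType) (P : probability T R).
Context (X : R -> {RV P >-> R}) (gamma sigma : R) (Pi : {measure set R -> \bar R}).
Hypotheses (hX : is_Levy X) (hXt : has_Levy_triplet X gamma sigma Pi).

Local Notation drift := (Levy_drift gamma Pi).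

Lemma bm_min_dev (t e h : R) : 0 <= h -> bm (fun w => Num.min `|X t w - e| h).
Proof.
move=> h0; apply: bm_min => //; apply: (measurableT_comp (@normr_measurable R setT)).
by apply: measurable_funB => //; exact: measurable_cst.
Qed.

(** With Y = X_t - drift * t, three errors of at most kap * t / 4 each: deviations below 2^-N,
    deviations between 2^-N and 2^-J seen by [cos_sum], and deviations above 2^-J, which are made
    cheap by a small [h]. *)
Lemma drift_moment_dyadic (K : R) : (forall m,
    \int[P]_w Num.min `|X ((2 ^ m)%N%:R^-1) w| 1 <= K / (2 ^ m)%N%:R) ->
  forall kappa : R, 0 < kappa -> exists2 h : R, 0 < h & forall m,
  \int[P]_w Num.min `|X ((2 ^ m)%N%:R^-1) w - drift * (2 ^ m)%N%:R^-1| h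
    <= kappa * (2 ^ m)%N%:R^-1.
Proof.
move=> hK kap kap0; have c0 := cos_const_gt0 R; set c := cos_const R in c0 *.
have K0 : 0 <= K.
  have := hK 0%N; rewrite expn0 invr1 mulr1; apply: le_trans.
  by apply: Rintegral_ge0 => w _; rewrite le_min normr_ge0/=.
have [k kP] : exists k, 2 ^- k <= kap / 4.
  have k4 : 0 < kap / 4 by lra.
  have [k /(_ k (leqnn _))] := dyadic_small ltr01 k4.
  by rewrite div1r natrX => /ltW; exists k.
(* The bound om <= 1 replaces om^2 by om, so that 9 om + 2^k om^2 <= (9 + 2^k) om <= c * kap / 4. *)
pose eta := Num.min 1 (c * kap / (4 * (9 + 2 ^+ k))).
have p2 : (0 : R) < 2 ^+ k by rewrite exprn_gt0.
have eta0 : 0 < eta.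
  rewrite lt_min ltr01/= divr_gt0//; exact: mulr_gt0.
have [J JP] : exists J, omega Pi J <= eta.
  have /cvgr0Pnorm_le/(_ _ eta0)[J _ /(_ J (leqnn _))] := omega_cvg hXt hK.
  by move=> /(le_trans (ler_norm _)); exists J.
have om0 := omega_ge0 Pi J; set om := omega Pi J in JP om0.
have omP : c^-1 * (9 * om + 2 ^+ k * om ^+ 2) <= kap / 4.
  rewrite mulrC ler_pdivrMr//.
  move: JP; rewrite le_min => /andP[om1]; rewrite ler_pdivlMr; last by nra.
  have : 2 ^+ k * om ^+ 2 <= 2 ^+ k * om by rewrite ler_wpM2l ?(ltW p2)//; nra.
  lra.
have pJ : (0 : R) < 2 ^+ J by rewrite exprn_gt0.
pose D := 2 ^+ J * (K + `|drift|) + 1.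
have D0 : 0 < D.
  by rewrite ltr_wpDl// mulr_ge0 ?(ltW pJ)// addr_ge0.
(* [J] is fixed before [h]: a deviation above 2^-J costs [h], and by Markov's inequality has
   probability at most 2^J (K + |drift|) t. *)
pose h := kap / 4 / D; have h0 : 0 < h by rewrite !divr_gt0.
exists h => // m; set t := (2 ^ m)%N%:R^-1.
have t0 : 0 < t by rewrite invr_gt0 ltr0n expn_gt0.
(* With this [N], 2^-N is 2^-k t, while the squared errors t^2 om^2 2^j sum up to a multiple of t^2
   2^N om^2 = t 2^k om^2, again of order t. *)
pose N := (m + k)%N; pose Y w := X t w - drift * t.
have tN : t * 2 ^+ N = 2 ^+ k.
  by rewrite /t /N exprD natrX mulrA mulVf ?mul1r// gt_eqF// exprn_gt0.
have pN : (0 : R) < 2 ^+ N by rewrite exprn_gt0.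
have pw w : Num.min `|Y w| h <=
    2 ^- N + (c^-1 * cos_sum J N.+1 (Y w) + h * 2 ^+ J * Num.min `|Y w| 1).
  have m0 : 0 <= Num.min `|Y w| 1 by rewrite le_min normr_ge0/=.
  have s0 : 0 <= c^-1 * cos_sum J N.+1 (Y w).
    by rewrite mulr_ge0 ?cos_sum_ge0// invr_ge0 ltW.
  have r0 : 0 <= h * 2 ^+ J * Num.min `|Y w| 1 by rewrite mulr_ge0// mulr_ge0 ?(ltW h0) ?(ltW pJ).
  have iN : (0 : R) < 2 ^- N by rewrite invr_gt0.
  have a1 : Num.min `|Y w| h <= `|Y w| by rewrite ge_min lexx.
  have a2 : Num.min `|Y w| h <= h by rewrite ge_min lexx orbT.
  have [yN|yN] := leP (2 ^- N) `|Y w|; last by lra.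
  have [yJ|yJ] := leP `|Y w| (2 ^- J).
    have : `|Y w| <= c^-1 * cos_sum J N.+1 (Y w).
      by rewrite mulrC ler_pdivlMr// mulrC; exact: cos_sum_ge.
    by lra.
  have : h <= h * 2 ^+ J * Num.min `|Y w| 1.
    rewrite -mulrA ler_peMr ?(ltW h0)// mulrC -ler_pdivrMr// div1r.
    by rewrite le_min (ltW yJ)/=; have /andP[] := dyadic01 R J.
  by lra.
have mY : measurable_fun setT Y by apply: measurable_funB => //; exact: measurable_cst.
have bY1 : bm (fun w => Num.min `|Y w| 1) by exact: bm_min_dev.
have bcosj j : bm (fun w => 1 - cos (2 ^+ j * Y w)).
  apply: (bm_comp (f := fun x : R => 1 - cos (2 ^+ j * x))) => //.
  split; first by apply: measurable_funB => //; exact: measurable_cosM.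
  by exists 2 => x; rewrite ger0_norm ?one_sub_cos_ge0// one_sub_cos_le2.
have bcs : bm (fun w => cos_sum J N.+1 (Y w)).
  by apply: bm_sum => j; apply: bmZ; exact: bcosj.
have EY1 : \int[P]_w Num.min `|Y w| 1 <= (K + `|drift|) * t.
  have bX : bm (fun w => Num.min `|X t w| 1).
    by apply: bm_min => //; apply: (measurableT_comp (@normr_measurable R setT)).
  apply: (@le_trans _ _ (\int[P]_w (`|drift| * t + 1 * Num.min `|X t w| 1))).
    apply: bm_le_Rintegral => //; first by apply: bmD; [exact: bm_cst|exact: bmZ].
    move=> w; rewrite mul1r; have := ler_normB (X t w) (drift * t).
    rewrite normrM (ger0_norm (ltW t0)) -/(Y w).
    have : 0 <= `|drift| * t by rewrite mulr_ge0// ltW.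
    rewrite ge_min; case: (leP `|X t w| 1) => x1 d0 y1; apply/orP; [left|right]; lra.
  by rewrite bm_Rintegral_affine// mul1r mulrDl addrC lerD2r; exact: hK.
have Ecs : \int[P]_w cos_sum J N.+1 (Y w) <= t * (9 * om + 2 ^+ k * om ^+ 2).
  rewrite bm_Rintegral_sum; last by move=> j; apply: bmZ; exact: bcosj.
  apply: (@le_trans _ _ (\sum_(J <= j < N.+1)
    (t * (2 ^- j * (- complex.Re (Levy_exponent gamma sigma Pi (2 ^+ j)))) +
     t ^+ 2 * om ^+ 2 / 2 * 2 ^+ j))).
    rewrite !big_nat; apply: ler_sum => j /andP[Jj _].
    have pj : (0 : R) < 2 ^+ j by rewrite exprn_gt0.
    have ipj : (0 : R) < 2 ^- j by rewrite invr_gt0.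
    rewrite bm_RintegralZ//.
    have := shifted_one_sub_cos_le hXt (2 ^+ j) drift (ltW t0).
    rewrite -/(Y _) => /(ler_wpM2l (ltW ipj)) => /le_trans; apply.
    have := psiI_drift hXt hK j; set u := _ - 2 ^+ j * drift => uj.
    have ojJ : omega Pi j <= om.
      apply: le_Rintegral => //.
      - exact: (integrable_min_abs hXt hK (dyadic01 R j)).
      - exact: (integrable_min_abs hXt hK (dyadic01 R J)).
      - move=> x _; rewrite le_min !ge_min lexx/=; apply/orP; right.
        by rewrite lef_pV2 ?posrE// ler_eXn2l// ltr1n.
    have u2 : u ^+ 2 <= (2 ^+ j * om) ^+ 2.
      rewrite -[u ^+ 2]real_normK ?num_real// lerXn2r ?nnegrE ?mulr_ge0 ?(ltW pj)//.
      by apply: (le_trans uj); rewrite ler_wpM2l// ltW.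
    rewrite mulrDr; apply: lerD; first by rewrite mulrCA.
    have -> : t ^+ 2 * om ^+ 2 / 2 * 2 ^+ j = 2 ^- j * (t ^+ 2 * (2 ^+ j * om) ^+ 2 / 2).
      have p1 : 2 ^- j * 2 ^+ j = 1 :> R by rewrite mulVf// gt_eqF.
      transitivity ((2 ^- j * 2 ^+ j) * (t ^+ 2 * om ^+ 2 / 2 * 2 ^+ j)); last by ring.
      by rewrite p1 mul1r.
    rewrite ler_wpM2l ?(ltW ipj)// ler_wpM2r// ler_wpM2l// sqr_ge0//.
  rewrite big_split/= -!mulr_sumr mulrDr; apply: lerD.
    by rewrite ler_wpM2l ?(ltW t0)//; exact: (exponent_sum_omega hXt hK).
  have geo : \sum_(J <= j < N.+1) 2 ^+ j <= 2 * 2 ^+ N :> R.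
    apply: (@le_trans _ _ (\sum_(0 <= j < N.+1) 2 ^+ j)).
      have [JN|NJ] := leqP J N.+1; last first.
        by rewrite big_geq ?(ltnW NJ)//; apply: sumr_ge0 => j _; rewrite exprn_ge0.
      rewrite [leRHS](@big_cat_nat _ _ _ J)//= lerDr.
      by apply: sumr_ge0 => j _; rewrite exprn_ge0.
    elim: (N) => [|n IH]; first by rewrite big_nat1 expr0; lra.
    have := exprn_gt0 n.+1 (ltr0n R 2); rewrite big_nat_recr//= exprS; lra.
  apply: (@le_trans _ _ (t ^+ 2 * om ^+ 2 / 2 * (2 * 2 ^+ N))).
    by rewrite ler_wpM2l// !mulr_ge0// ?sqr_ge0// invr_ge0.
  have -> : t ^+ 2 * om ^+ 2 / 2 * (2 * 2 ^+ N) = t * ((t * 2 ^+ N) * om ^+ 2) by field.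
  by rewrite tN.
apply: (@le_trans _ _ (\int[P]_w (2 ^- N + (c^-1 * cos_sum J N.+1 (Y w) + h * 2 ^+ J * Num.min `|Y w| 1)))).
  apply: bm_le_Rintegral => //; first exact: bm_min_dev (ltW h0).
  by apply: bmD; [exact: bm_cst|apply: bmD; exact: bmZ].
rewrite bm_RintegralD; [|exact: bm_cst|by apply: bmD; exact: bmZ].
rewrite bm_Rintegral_cst bm_RintegralD; [|exact: bmZ|exact: bmZ].
rewrite !bm_RintegralZ//.
have e1 : 2 ^- N <= kap / 4 * t.
  have -> : 2 ^- N = 2 ^- k * t by rewrite -tN invfM mulrAC mulVf ?mul1r// gt_eqF.
  by rewrite ler_wpM2r// ltW.
have e2 : c^-1 * \int[P]_w cos_sum J N.+1 (Y w) <= kap / 4 * t.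
  apply: (@le_trans _ _ (c^-1 * (t * (9 * om + 2 ^+ k * om ^+ 2)))).
    by rewrite ler_wpM2l// invr_ge0 ltW.
  by rewrite mulrCA mulrC ler_wpM2r// ltW.
have e3 : h * 2 ^+ J * \int[P]_w Num.min `|Y w| 1 <= kap / 4 * t.
  apply: (@le_trans _ _ (h * 2 ^+ J * ((K + `|drift|) * t))).
    by rewrite ler_wpM2l// mulr_ge0// ltW.
  have -> : h * 2 ^+ J * ((K + `|drift|) * t) = h * (2 ^+ J * (K + `|drift|)) * t by ring.
  rewrite ler_wpM2r ?(ltW t0)// /h mulrAC ler_pdivrMr// ler_wpM2l ?ltW//; first lra.
  by rewrite /D; lra.
have : 0 < kap * t by rewrite mulr_gt0.
lra.
Qed.

(** The truncated absolute value is subadditive, so the bound passes from 2^-m to its multiples with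
    the same [h]; right-continuity then reaches every t. *)
Lemma drift_moment : bounded_variation_process X -> forall kappa : R, 0 < kappa ->
  exists2 h : R, 0 < h & forall t, 0 <= t ->
  \int[P]_w Num.min `|X t w - drift * t| h <= kappa * t.
Proof.
move=> bvX kap kap0; have [K hK] := BV_moment hX bvX.
have [h h0 hP] := drift_moment_dyadic hK kap0; exists h => // t t0.
have h0' := ltW h0.
have dy m k : \int[P]_w Num.min `|X (k%:R * (2 ^ m)%N%:R^-1) w - drift * (k%:R * (2 ^ m)%N%:R^-1)| h
    <= kap * (k%:R * (2 ^ m)%N%:R^-1).
  set dl := _^-1; have dl0 : 0 <= dl by rewrite invr_ge0.
  have bf e : bm (fun y : R => Num.min `|y - e| h).
    apply: bm_min => //; apply: (measurableT_comp (@normr_measurable R setT)).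
    by apply: measurable_funB => //; exact: measurable_cst.
  elim: k => [|k IH].
    rewrite !mul0r mulr0.
    have := incr_Rintegral hX (bf 0) (lexx 0) (lexx 0); rewrite subrr => <-.
    under eq_Rintegral do rewrite subrr subr0 normr0 min_l//.
    by rewrite bm_Rintegral_cst mulr0.
  have kd : k%:R * dl <= k.+1%:R * dl by rewrite ler_wpM2r// ler_nat.
  have bI : bm (fun w => Num.min `|X (k.+1%:R * dl) w - X (k%:R * dl) w - drift * dl| h).
    exact: (bm_comp (measurable_incr X _ _) (bf (drift * dl))).
  apply: (@le_trans _ _ (\int[P]_w (Num.min `|X (k%:R * dl) w - drift * (k%:R * dl)| h +
    Num.min `|X (k.+1%:R * dl) w - X (k%:R * dl) w - drift * dl| h))).
    apply: bm_le_Rintegral; [exact: bm_min_dev|by apply: bmD => //; exact: bm_min_dev|].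
    move=> w; rewrite -natr1; set a := X _ w - _ * (k%:R * dl); set b := _ - drift * dl.
    have -> : X ((k%:R + 1) * dl) w - drift * ((k%:R + 1) * dl) = a + b by rewrite /a /b; ring.
    have := ler_normD a b; have := normr_ge0 a; have := normr_ge0 b.
    rewrite ge_min; case: (leP `|a| h); case: (leP `|b| h) => *; apply/orP; first [left; lra|right; lra].
  rewrite bm_RintegralD//; last exact: bm_min_dev.
  rewrite (incr_Rintegral hX (bf _)) ?mulr_ge0// -mulrBl -natrB// subSnn mul1r.
  have := hP m; rewrite -/dl -[k.+1%:R]natr1; lra.
(* The successor makes u n > t strictly, as convergence along right limits requires. *)
pose u n : R := (Num.truncn (t * (2 ^ n)%N%:R)).+1%:R * (2 ^ n)%N%:R^-1.
have p2 n : (0 : R) < (2 ^ n)%N%:R by rewrite ltr0n expn_gt0.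
have tu n : t < u n by rewrite /u ltr_pdivlMr// truncnS_gt.
have ut n : u n <= t + 1 / (2 ^ n)%N%:R.
  rewrite /u ler_pdivrMr// mulrDl divfK ?gt_eqF// -natr1 lerD2r.
  by rewrite truncn_le// mulr_ge0.
have ucvg : u n @[n --> \oo] --> t.
  apply/cvgrPdist_le => e e0; have [m0 m0P] := dyadic_small ltr01 e0.
  exists m0 => // n /= /m0P ne; rewrite distrC ger0_norm ?subr_ge0 ?(ltW (tu n))//.
  by have := ut n; lra.
have Xcvg w : X (u n) w @[n --> \oo] --> X t w.
  have Xr : X s w @[s --> t^'+] --> X t w by exact: (Levy_cadlag_right hX).
  by move/cvg_at_rightP : Xr; apply.
have cv : \int[P]_w Num.min `|X (u n) w - drift * u n| h @[n --> \oo] -->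
    \int[P]_w Num.min `|X t w - drift * t| h.
  apply: (@bm_cvg_Rintegral _ _ _ _ _ _ h).
  - by move=> n; case: (bm_min_dev (u n) (drift * u n) h0').
  - by case: (bm_min_dev t (drift * t) h0').
  - by move=> n w; rewrite ger0_norm ?le_min ?normr_ge0// ge_min lexx orbT.
  - move=> w; under eq_fun do rewrite minr_absE; rewrite minr_absE.
    have cw : `|X (u n) w - drift * u n| @[n --> \oo] --> `|X t w - drift * t|.
      by apply: cvg_norm; apply: cvgB => //; apply: cvgMr.
    apply: cvgMl; apply: cvgB; first by apply: cvgD => //; exact: cvg_cst.
    by apply: cvg_norm; apply: cvgB => //; exact: cvg_cst.
have cv2 : kap * u n @[n --> \oo] --> kap * t by exact: cvgMr.
rewrite -(cvg_lim _ cv)// -(cvg_lim _ cv2)//.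
apply: ler_lim; [by apply/cvg_ex; eexists; exact: cv|by apply/cvg_ex; eexists; exact: cv2|].
by near=> n; exact: dy.
Unshelve. all: by end_near. Qed.

End dyadic_drift_moment.

(** * One-sided passage times *)

Section power_inequalities.
Context (R : realType).
Implicit Types b x y t : R.

Lemma powR_amgm b x y : 0 <= b -> b < 1 -> 0 <= x -> 0 <= y ->
  x `^ b * y `^ (1 - b) <= b * x + (1 - b) * y.
Proof.
move=> b0 b1 x0 y0; have [->|bn0] := eqVneq b 0.
  by rewrite subr0 powRr0 powRr1// !mul1r mul0r add0r.
have b0' : 0 < b by rewrite lt_neqAle eq_sym bn0.
have b1' : 0 < 1 - b by lra.
have := @conjugate_powR R (x `^ b) (y `^ (1 - b)) b^-1 (1 - b)^-1.
rewrite !invrK !invr_gt0 !powR_ge0 => /(_ isT isT b0' b1').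
rewrite -!powRrM !mulfV ?gt_eqF// !powRr1// => h.
by rewrite (mulrC b) (mulrC (1 - b)); apply: h; ring.
Qed.

Lemma powR_split b x : 0 < x -> x `^ b * x `^ (1 - b) = x.
Proof.
move=> x0; rewrite -powRD; last by rewrite (gt_eqF x0) implybT.
by rewrite addrC subrK powRr1// ltW.
Qed.

Lemma powRM_bernoulli b u : 0 <= b -> b < 1 -> 0 <= u -> (1 + u) `^ b <= 1 + b * u.
Proof.
move=> b0 b1 u0; have u1 : 0 <= 1 + u by lra.
have := powR_amgm b0 b1 u1 ler01.
by rewrite powR1 mulr1; lra.
Qed.

(** Weighted AM-GM applied to n + 1 and n bounds each new term by the increment of n^(1 - b) / (1 -
    b), in place of a comparison with an integral. *)
Lemma sum_powRN b n : 0 <= b -> b < 1 ->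
  \sum_(1 <= j < n.+1) (j%:R : R) `^ (- b) <= n%:R `^ (1 - b) / (1 - b).
Proof.
move=> b0 b1; have b1' : 0 < 1 - b by lra.
elim: n => [|n IH]; first by rewrite big_geq// divr_ge0 ?powR_ge0// ltW.
rewrite big_nat_recr//=; apply: (le_trans (lerD IH (lexx _))).
have n1 : (0 : R) < n.+1%:R by rewrite ltr0n.
have pn : 0 < (n.+1%:R : R) `^ (- b) by rewrite powR_gt0.
have := powR_amgm b0 b1 (ltW n1) (ler0n R n).
move=> /(ler_wpM2l (ltW pn)); rewrite mulrA -powRD; last by rewrite (gt_eqF n1) implybT.
rewrite addNr powRr0 mul1r => h.
have e : (n.+1%:R : R) `^ (- b) * n.+1%:R = n.+1%:R `^ (1 - b).
  rewrite -[X in _ * X](powRr1 (ltW n1)) -powRD; last by rewrite (gt_eqF n1) implybT.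
  by rewrite addrC.
rewrite ler_pdivlMr// mulrDl divfK ?gt_eqF//.
have nn : n%:R = n.+1%:R - 1 :> R by rewrite -natr1 addrK.
have : (n.+1%:R : R) `^ (- b) * (b * n.+1%:R + (1 - b) * n%:R) =
    n.+1%:R `^ (- b) * n.+1%:R - (1 - b) * n.+1%:R `^ (- b) by rewrite nn; ring.
by rewrite e; lra.
Qed.

Lemma powR_right_cvg b t : 0 <= b -> 0 <= t -> s `^ b @[s --> t^'+] --> t `^ b.
Proof.
move=> b0 t0; have [->|bn0] := eqVneq b 0.
  by under eq_fun do rewrite powRr0; rewrite powRr0; exact: cvg_cst.
have b0' : 0 < b by rewrite lt_neqAle eq_sym bn0.
move: t0; rewrite le_eqVlt => /predU1P[<-|t0].
  by rewrite powR0//; exact: powR_cvg0.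
apply: cvg_at_right_filter.
have : derivable (fun s : R => s `^ b) t 1.
  by apply: derivable_powR; rewrite in_itv/= t0.
by move=> /derivable1_diffP/differentiable_continuous.
Qed.

Lemma right_open_lt (f g : R -> R) :
  (forall t, 0 <= t -> f s @[s --> t^'+] --> f t) ->
  (forall t, 0 <= t -> g s @[s --> t^'+] --> g t) ->
  right_open (fun t => f t < g t).
Proof.
move=> cf cg t t0 fg.
have cgf : g s - f s @[s --> t^'+] --> g t - f t by apply: cvgB; [exact: cg|exact: cf].
have gf0 : 0 < g t - f t by rewrite subr_gt0.
have [e /= e0 He] := cvgr_gt _ cgf _ gf0.
exists e => // s /andP[ts st].
move: ts; rewrite le_eqVlt => /predU1P[<-//|ts].
rewrite -subr_gt0; apply: He => //=.
by rewrite distrC ger0_norm ?subr_ge0 ?(ltW ts)//; lra.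
Qed.

End power_inequalities.

(** * Expected passage times as limits of walk exit times *)

Section passage_as_limit.
Context d (T : measurableType d) (R : realType) (P : probability T R).
Context (X : R -> {RV P >-> R}) (hX : is_Levy X).

Local Notation law t := (distribution P (X t)).

Variable c : R -> R.
Hypothesis cr : forall t, 0 <= t -> c s @[s --> t^'+] --> c t.

Definition crosses t w := c t < X t w.

Lemma measurable_crosses t : measurable [set w | crosses t w].
Proof. by apply: (measurable_superlevel (f := X t)). Qed.

Lemma right_open_crosses w : right_open (crosses ^~ w).
Proof.
by apply: (right_open_lt (g := fun t => X t w)) => // t; exact: (Levy_cadlag_right hX).
Qed.

Lemma fineP_ae (A B N : set T) : measurable A -> measurable B -> measurable N ->
  P N = 0%E -> (forall w, ~ N w -> A w <-> B w) -> P A = P B.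
Proof.
move=> mA mB mN PN AB.
have H (C : set T) : measurable C -> P C = P (C `\` N).
  move=> mC; rewrite -{1}(setDUK (A := C `&` N) (B := C))//.
  rewrite measureU//; last 3 first.
  - exact: measurableI.
  - by apply: measurableD => //; exact: measurableI.
  - by apply/seteqP; split => // w [? []].
  rewrite [X in (X + _)%E](_ : _ = 0%E).
    by rewrite add0e setDIr setDv set0U.
  apply/eqP; rewrite eq_le measure_ge0 andbT -PN le_measure ?inE//.
  exact: measurableI.
rewrite (H A)// (H B)//; congr (P _); apply/seteqP.
by split => w [/AB h nN]; split => //; apply h.
Qed.

(** The walk starts exactly at 0 whereas X_0 = 0 only almost surely; the two survival events agree
    off a null set. *)
Lemma passage_est eps : 0 < eps ->
  eps / (2 ^ m)%N%:R *
    est (law (eps / (2 ^ m)%N%:R))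
      (fun k => [set x | x <= c (k%:R * (eps / (2 ^ m)%N%:R))]) (2 ^ m) 0
  @[m --> \oo] --> \int[P]_w capped_time crosses eps w.
Proof.
move=> eps0.
have G := grid_integral (P := P) (fun t _ => measurable_crosses t) right_open_crosses eps0.
apply: cvg_trans G.
apply: near_eq_cvg; near=> m.
set dl := eps / _; have dl0 : 0 <= dl by rewrite divr_ge0// ltW.
have mH k : measurable ([set x | x <= c (k%:R * dl)] : set R).
  exact: (measurable_sublevel (f := id)).
congr (_ * _); rewrite est_surv//; apply: eq_bigr => k _.
apply: EFin_inj; rewrite fineK; last first.
  by rewrite fin_num_measure//; exact: measurable_grid_alive (fun t _ => measurable_crosses t) _ eps0 _ _.
rewrite -(levy_surv hX k.+1 0 dl0 (lexx 0) mH).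
have [N [mN PN NX]] := Levy_start hX.
apply: (fineP_ae _ _ mN PN).
- exact: measurable_grid_alive (fun t _ => measurable_crosses t) _ eps0 _ _.
- apply: bigcap_measurableType => j _.
  rewrite (_ : [set w | _] = [set w | [set x | x <= c (j%:R * dl)] (X (0 + j%:R * dl) w - X 0 w)]).
    exact: measurable_incr_set.
  by apply/seteqP; split => w /=; rewrite (add0r (X _ w - X 0 w)).
- move=> w Nw.
  have X0 : X 0 w = 0 by apply: contrapT => X0; apply: Nw; exact: NX.
  split=> A j jk; have := A j jk; rewrite /crosses /= !add0r X0 subr0.
    by move/negP; rewrite -leNgt.
  by move=> h; apply/negP; rewrite -leNgt.
Unshelve. all: by end_near. Qed.

End passage_as_limit.

Lemma le_of_cvg (R : realType) (u v : nat -> R) (a c : R) :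
  u n @[n --> \oo] --> a -> v n @[n --> \oo] --> c ->
  (exists n0, forall n, (n0 <= n)%N -> u n <= v n) -> a <= c.
Proof.
move=> ua vc [n0 uv]; rewrite -(cvg_lim _ ua)// -(cvg_lim _ vc)//.
apply: ler_lim; [by apply/cvg_ex; exists a|by apply/cvg_ex; exists c|].
by exists n0 => // n /= /uv.
Qed.

Lemma cvg_mesh (R : realType) (eps : R) : 0 < eps ->
  eps / (2 ^ m)%N%:R @[m --> \oo] --> 0.
Proof.
move=> eps0; apply/cvgr0Pnorm_le => e e0.
have [m0 m0P] := dyadic_small eps0 e0; exists m0 => // m /= /m0P /ltW.
by rewrite ger0_norm// divr_ge0// ltW.
Qed.

(* Fekete's lemma at 0: a subadditive function is almost linear near 0. *)
Lemma subadditive_slope (R : realType) (g : R -> R) (K : R) :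
  (forall y, 0 <= y -> 0 <= g y <= K * y) ->
  (forall y z, 0 <= y -> y <= z -> g y <= g z) ->
  (forall y z, 0 <= y -> 0 <= z -> g (y + z) <= g y + g z) ->
  exists S : R, [/\ 0 <= S, forall y, 0 <= y -> g y <= S * y &
    forall eta, 0 < eta -> exists2 y0, 0 < y0 & forall y, 0 < y < y0 ->
      (S - eta) * y <= g y].
Proof.
move=> gK gmono gsub; pose E := [set g y / y | y in [set y | 0 < y]].
have E1 : E (g 1 / 1) by exists 1 => //=; exact: ltr01.
have ubE : ubound E K.
  by move=> _ [y /= y0 <-]; rewrite ler_pdivrMr//; have /andP[] := gK y (ltW y0).
have hE : has_sup E by split; [exists (g 1 / 1)|exists K].
exists (sup E); split.
- apply: (@le_trans _ _ (g 1 / 1)); last exact: ub_le_sup E1.2 _ || exact: (ub_le_sup hE.2).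
  by rewrite divr1; have /andP[] := gK 1 ler01.
- move=> y; rewrite le_eqVlt => /predU1P[<-|y0].
    by have /andP[_] := gK 0 (lexx 0); rewrite !mulr0.
  by rewrite -ler_pdivrMr//; apply: (ub_le_sup hE.2); exists y.
move=> eta eta0.
have eta2 : 0 < eta / 2 by lra.
have [_ [Y /= Y0 <-] YS] := sup_adherent eta2 hE.
have gY : (sup E - eta / 2) * Y < g Y by rewrite -ltr_pdivlMr.
have /andP[gY0 _] := gK Y (ltW Y0).
have iter n y : 0 <= y -> g (n%:R * y) <= n%:R * g y.
  move=> y0; elim: n => [|n IH].
    by rewrite !mul0r; have /andP[_] := gK 0 (lexx 0); rewrite mulr0.
  rewrite -natr1 !mulrDl !mul1r; apply: (le_trans (gsub _ _ _ y0)); first exact: mulr_ge0.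
  by rewrite lerD2r.
(* Rounding [Y] up to a multiple of [y] overshoots by at most [y]; this threshold makes |sup E| * y
   <= eta / 2 * Y, so the overshoot is absorbed. *)
pose q := eta * Y / (2 * (`|sup E| + 1)).
have q0 : 0 < q.
  by rewrite divr_gt0// ?mulr_gt0// ltr_wpDl.
exists q => // y /andP[y0 yq].
set n := (Num.truncn (Y / y)).+1.
have nY : Y < n%:R * y by rewrite -ltr_pdivrMr// truncnS_gt.
have nY' : n%:R * y <= Y + y.
  rewrite /n -natr1 mulrDl mul1r lerD2r -ler_pdivlMr// truncn_le.
  by rewrite divr_ge0// ltW.
have h1 : g Y <= n%:R * g y.
  by apply: (le_trans (gmono _ _ (ltW Y0) (ltW nY))); apply: iter; exact: ltW.
have /andP[gy0 _] := gK y (ltW y0).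
have h2 : g Y * y <= (Y + y) * g y.
  apply: (@le_trans _ _ (n%:R * g y * y)); first by rewrite ler_wpM2r// ltW.
  by rewrite mulrAC ler_wpM2r.
have h3 : (sup E - eta) * (Y + y) <= g Y.
  apply: (le_trans _ (ltW gY)).
  have : `|sup E| * y <= eta / 2 * Y.
    move: yq; rewrite ltr_pdivlMr; last by rewrite mulr_gt0// ltr_wpDl.
    by have := mulr_ge0 (normr_ge0 (sup E)) (ltW y0); lra.
  have : sup E * y <= `|sup E| * y by rewrite ler_wpM2r ?ler_norm// ltW.
  have : 0 <= eta * y by rewrite mulr_ge0// ltW.
  lra.
have Yy : 0 < Y + y by lra.
rewrite -(ler_pM2l Yy); apply: le_trans h2.
by rewrite mulrA [X in X * y <= _]mulrC ler_wpM2r// ltW.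
Qed.

(** * Levels and power curves crossed by a process with positive drift *)

Section bounded_variation_passage.
Context d (T : measurableType d) (R : realType) (P : probability T R).
Context (X : R -> {RV P >-> R}) (hX : is_Levy X).
Variables (dr b : R).
Hypothesis params : [/\ 0 < dr, 0 <= b & b < 1].

Local Notation law t := (distribution P (X t)).
Local Notation dev kap h := (forall t, 0 <= t ->
  \int[P]_w Num.min `|X t w - dr * t| h <= kap * t).
Local Notation mesh eps m := (eps / (2 ^ m)%N%:R).
Local Notation below y := (fun _ : nat => [set x : R | x <= y]).
Local Notation curve c dl :=
  (fun k : nat => [set x : R | x <= dr * c `^ (1 - b) * (k%:R * dl) `^ b]).

Hypothesis drift_dev : forall kap : R, 0 < kap -> exists2 h : R, 0 < h & dev kap h.

Lemma measurable_below y (k : nat) : measurable (below y k).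
Proof. by rewrite -[X in measurable X]set_itvNyc. Qed.

Lemma measurable_curve c dl k : measurable (curve c dl k).
Proof. by rewrite -[X in measurable X]set_itvNyc. Qed.

Lemma law_dev kap h dl : 0 < h -> dev kap h -> 0 <= dl ->
  \int[law dl]_y Num.min `|y - dr * dl| h <= kap * dl.
Proof.
move=> h0 hdev dl0.
rewrite (law_Rintegral (X dl) (f := fun y => Num.min `|y - dr * dl| h)); last exact: bm_dev.
exact: hdev.
Qed.

(** [est_drift] in units of time: one step lasts [mesh eps m], which turns [A] into A / dl, and the
    horizon of 2^m steps turns the large-deviation charge into eps * kap / h. *)
Lemma est_grid_le kap h s eps A m (hs : nat -> R) n x :
  0 <= kap -> 0 < h -> dev kap h -> 0 <= s -> 0 < eps ->
  1 + eps * kap / h <= A * (dr - s - kap) -> 0 <= A ->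
  (forall k, hs k.+1 <= hs k + s * mesh eps m) -> (n <= 2 ^ m)%N ->
  mesh eps m * est (law (mesh eps m)) (fun k => [set z | z <= hs k]) n x <=
  A * Num.max 0 (hs 0%N - x + dr * mesh eps m).
Proof.
have [dr0 b0 b1] := params.
move=> kap0 h0 hdev s0 eps0 hA A0 hss nm; set dl := mesh eps m.
have p2 : (0 : R) < (2 ^ m)%N%:R by rewrite ltr0n expn_gt0.
have dl0 : 0 < dl by rewrite divr_gt0.
have epsE : (2 ^ m)%N%:R * dl = eps by rewrite mulrC divfK// gt_eqF.
have d0 := ltW dl0.
have dd0 : 0 <= dr * dl by rewrite mulr_ge0// ltW.
have kd0 : 0 <= kap * dl by rewrite mulr_ge0.
have sd0 : 0 <= s * dl by rewrite mulr_ge0.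
have Ad0 : 0 <= A / dl by rewrite divr_ge0.
have hh : 1 + (2 ^ m)%N%:R * (kap * dl) / h <= A / dl * (dr * dl - s * dl - kap * dl).
  have -> : (2 ^ m)%N%:R * (kap * dl) / h = eps * kap / h by rewrite -epsE; ring.
  apply: (le_trans hA); have -> : A / dl * (dr * dl - s * dl - kap * dl) = A * (dr - s - kap).
    by field; rewrite gt_eqF.
  by [].
rewrite mulrC -ler_pdivlMr//.
apply: (le_trans (est_drift _ dd0 h0 kd0 (law_dev h0 hdev d0) Ad0 sd0 hss hh nm)).
by rewrite mulrAC.
Qed.

Definition level_time eps y := \int[P]_w capped_time (crosses X (fun=> y)) eps w.
(** Parametrised by c = C(r) rather than by r = dr * c^(1 - b); the curve then meets the drift line
    dr * t at t = c. *)
Definition curve_time eps c :=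
  \int[P]_w capped_time (crosses X (fun t => dr * c `^ (1 - b) * t `^ b)) eps w.

Lemma level_time_cvg eps y : 0 < eps ->
  mesh eps m * est (law (mesh eps m)) (below y) (2 ^ m) 0 @[m --> \oo] --> level_time eps y.
Proof. move=> eps0; apply: (passage_est hX (c := fun=> y) _ eps0) => t _; exact: cvg_cst. Qed.

Lemma curve_time_cvg eps c : 0 < eps ->
  mesh eps m * est (law (mesh eps m)) (curve c (mesh eps m)) (2 ^ m) 0
  @[m --> \oo] --> curve_time eps c.
Proof.
have [_ b0 _] := params; move=> eps0.
apply: (passage_est hX (c := fun t => dr * c `^ (1 - b) * t `^ b) _ eps0) => t t0.
by apply: cvgMr; exact: powR_right_cvg.
Qed.

Lemma level_time_le kap h eps A y : 0 <= kap -> 0 < h -> dev kap h -> 0 < eps ->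
  1 + eps * kap / h <= A * (dr - kap) -> 0 <= A -> 0 <= y ->
  0 <= level_time eps y <= A * y.
Proof.
have [dr0 b0 b1] := params.
move=> kap0 h0 hdev eps0 hA A0 y0; apply/andP; split.
  have cv0 : (0 : R) @[_ --> \oo] --> (0 : R) by exact: cvg_cst.
  apply: (le_of_cvg cv0 (level_time_cvg (y := y) eps0)); exists 0%N => m _.
  by apply: mulr_ge0; [rewrite divr_ge0// ltW|apply: est_ge0; exact: measurable_below].
have cv : A * (y + dr * mesh eps m) @[m --> \oo] --> A * (y + dr * 0).
  by apply: cvgMr; apply: cvgD; [exact: cvg_cst|apply: cvgMr; exact: cvg_mesh].
rewrite -[y in leRHS]addr0 -[X in _ + X](mulr0 dr).
apply: (le_of_cvg (level_time_cvg (y := y) eps0) cv); exists 0%N => m _.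
have dl0 : 0 <= mesh eps m by rewrite divr_ge0// ltW.
have := @est_grid_le kap h 0 eps A m (fun=> y) (2 ^ m) 0 kap0 h0 hdev (lexx 0) eps0.
rewrite subr0 => /(_ hA A0 _ (leqnn _))/le_trans; apply.
  by move=> k; rewrite mul0r addr0.
by rewrite subr0 max_r// addr_ge0// mulr_ge0// ltW.
Qed.

Lemma level_time_mono eps y z : 0 < eps -> y <= z -> level_time eps y <= level_time eps z.
Proof.
move=> eps0 yz; apply: (le_of_cvg (level_time_cvg (y := y) eps0) (level_time_cvg (y := z) eps0)).
exists 0%N => m _; rewrite ler_wpM2l ?divr_ge0 ?(ltW eps0)//.
apply: est_mono; [exact: measurable_below|exact: measurable_below|].
by move=> k x /= xy; exact: le_trans yz.
Qed.

Lemma level_timeD eps y z : 0 < eps -> 0 <= y -> 0 <= z ->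
  level_time eps (y + z) <= level_time eps y + level_time eps z.
Proof.
move=> eps0 y0 z0.
have cv : mesh eps m * est (law (mesh eps m)) (below y) (2 ^ m) 0 +
    mesh eps m * est (law (mesh eps m)) (below z) (2 ^ m) 0 @[m --> \oo] -->
    level_time eps y + level_time eps z.
  by apply: cvgD; exact: level_time_cvg.
apply: (le_of_cvg (level_time_cvg (y := y + z) eps0) cv); exists 0%N => m _.
by rewrite -mulrDr ler_wpM2l ?divr_ge0 ?(ltW eps0)//; exact: est_subadditive.
Qed.

(** At times t <= lam * c the curve exceeds dr * t by at least q c^(1 - b) t^b. Weighting deviations
    by t^(-b) makes this margin constant, and [surv_deviation] applies: the weights sum to order
    c^(1 - b) because t^(-b) is integrable at 0. *)
Lemma early_crossing lam eta : 0 < lam -> lam < 1 -> 0 < eta ->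
  exists2 c0 : R, 0 < c0 & forall c dl M, 0 < c -> c < c0 -> 0 < dl -> dl <= c ->
    M%:R * dl <= lam * c -> 1 - surv (law dl) (curve c dl) M.+1 0 <= eta.
Proof.
have [dr0 b0 b1] := params.
move=> lam0 lam1 eta0.
have b1' : 0 < 1 - b by lra.
have ll1 : lam `^ (1 - b) < 1.
  have := @gt0_ltr_powR R (1 - b) b1' lam 1; rewrite !nnegrE => /(_ (ltW lam0) ler01 lam1).
  by rewrite powR1.
pose q := (1 - lam `^ (1 - b)) * dr.
have q0 : 0 < q by rewrite mulr_gt0// subr_gt0.
(* The 1 is for the step at time 0, the other term comes from [sum_powRN]. *)
pose K1 := 1 + (1 - b)^-1.
have K10 : 0 < K1 by rewrite addr_gt0// invr_gt0.
pose kap := eta * q / (2 * K1).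
have kap0 : 0 < kap by rewrite divr_gt0// mulr_gt0.
have [h h0 hdev] := drift_dev kap0.
exists (eta * h / (4 * kap)); first by rewrite divr_gt0// mulr_gt0.
move=> c dl M c0 cc0 dl0 dlc Mc.
have d0 := ltW dl0.
have pc : 0 < c `^ (1 - b) by rewrite powR_gt0.
pose H' k := if (0 < k)%N && (k < M.+1)%N then curve c dl k else setT.
rewrite (@surv_ext0 _ _ (curve c dl) H'); last first.
- by move=> k k0 kM; rewrite /H' k0 kM.
- by [].
- by rewrite /= !mulr_ge0 ?powR_ge0// ltW.
(* The maximum with 1 is needed at k = 0: a negative power of 0 evaluates to 0, which would break
   the monotonicity of the weights. *)
pose w k := ((maxn k 1)%:R * dl) `^ (- b).
have mx k : (0 : R) < (maxn k 1)%:R by rewrite ltr0n leq_max orbT.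
have wpos k : 0 < w k by rewrite powR_gt0// mulr_gt0.
have pw (x : R) : 0 < x -> x `^ (- b) * x `^ b = 1.
  by move=> x0; rewrite powRN mulVf// gt_eqF// powR_gt0.
have sd : q * c `^ (1 - b) * (1 - surv (law dl) H' M.+1 0) <= w 0%N * Num.max 0 (0 - 0) +
    \sum_(j < M.+1) w j * (kap * dl) + q * c `^ (1 - b) * M.+1%:R * (kap * dl) / h.
  apply: (surv_deviation (a := dr * dl)) => //.
  - by rewrite mulr_ge0// ltW.
  - by rewrite mulr_ge0// ltW.
  - exact: law_dev.
  - by move=> k; rewrite /H'; case: ifP => _ //; exact: measurable_curve.
  - by rewrite mulr_ge0// ltW.
  - move=> k x; rewrite /H'; case: ifP => [/andP[k0 kM]|_]; last by move=> /(_ I).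
    move=> /= /negP; rewrite -ltNge => xk; rewrite add0r.
    set t := k%:R * dl in xk.
    have t0 : 0 < t by rewrite mulr_gt0// ltr0n.
    have wk : w k = t `^ (- b) by rewrite /w (maxn_idPl k0).
    have tc : t <= lam * c by apply: le_trans Mc; rewrite ler_wpM2r// ler_nat.
    have pt : 0 < t `^ b by rewrite powR_gt0.
    have -> : k%:R * (dr * dl) = dr * t by rewrite /t; ring.
    have tp : t `^ (1 - b) <= lam `^ (1 - b) * c `^ (1 - b).
      rewrite -powRM ?(ltW lam0) ?(ltW c0)//.
      by rewrite ge0_ler_powR ?nnegrE ?(ltW t0) ?mulr_ge0 ?(ltW lam0) ?(ltW c0)// ltW.
    have xt : q * c `^ (1 - b) * t `^ b <= x - dr * t.
      rewrite -{2}(powR_split b t0).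
      have : dr * (t `^ b * t `^ (1 - b)) <= dr * (t `^ b * (lam `^ (1 - b) * c `^ (1 - b))).
        by rewrite ler_wpM2l ?(ltW dr0)// ler_wpM2l// ltW.
      by rewrite /q; lra.
    rewrite wk; apply: (@le_trans _ _ (t `^ (- b) * (q * c `^ (1 - b) * t `^ b))).
      by rewrite mulrCA (pw t t0) mulr1.
    by rewrite ler_wpM2l ?powR_ge0.
  - by move=> k; rewrite ltW.
  - move=> k; rewrite /w !powRN lef_pV2 ?posrE ?powR_gt0 ?mulr_gt0//.
    rewrite ge0_ler_powR ?nnegrE ?mulr_ge0 ?(ltW (mx _))//.
    by rewrite ler_wpM2r// ler_nat geq_max !leq_max leqnSn !leqnn !orbT.
have sumw : \sum_(j < M.+1) w j * (kap * dl) <= kap * (K1 * c `^ (1 - b)).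
  have wE k : w k * dl = (maxn k 1)%:R `^ (- b) * dl `^ (1 - b).
    rewrite /w powRM ?(ltW (mx k))// -mulrA; congr (_ * _).
    rewrite -{2}(powR_split b dl0) mulrA pw// mul1r//.
  have -> : \sum_(j < M.+1) w j * (kap * dl) =
      kap * (dl `^ (1 - b) * (1 + \sum_(1 <= j < M.+1) (j%:R : R) `^ (- b))).
    rewrite big_ord_recl (_ : w ord0 * _ = kap * (dl `^ (1 - b) * 1)); last first.
      by rewrite mulrCA wE /= powR1 mul1r mulr1.
    rewrite big_add1 /= big_mkord !mulrDr; congr (_ + _).
    rewrite !mulr_sumr; apply: eq_bigr => j _.
    by rewrite mulrCA wE /bump /= add1n (maxn_idPl _)// (mulrC (_ `^ (- b))).
  rewrite ler_wpM2l ?(ltW kap0)//.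
  apply: (@le_trans _ _ (dl `^ (1 - b) * (1 + M%:R `^ (1 - b) / (1 - b)))).
    by rewrite ler_wpM2l ?powR_ge0// lerD2l; exact: sum_powRN.
  have -> : dl `^ (1 - b) * (1 + M%:R `^ (1 - b) / (1 - b)) =
      dl `^ (1 - b) + (M%:R * dl) `^ (1 - b) / (1 - b) by rewrite powRM//; ring.
  rewrite /K1 mulrDl mul1r; apply: lerD.
    by rewrite ge0_ler_powR ?nnegrE ?(ltW c0)// ltW.
  rewrite mulrC ler_wpM2l ?invr_ge0 ?(ltW b1')//.
  rewrite ge0_ler_powR ?nnegrE ?mulr_ge0 ?(ltW c0) ?(ltW b1')//.
  by apply: (le_trans Mc); rewrite ler_piMl ?(ltW c0)// ltW.
move: sd; rewrite subr0 max_l// mulr0 add0r => sd.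
have qc : 0 < q * c `^ (1 - b) by rewrite mulr_gt0.
rewrite -(ler_pM2l qc); apply: (le_trans sd).
have e1 : kap * (K1 * c `^ (1 - b)) = q * c `^ (1 - b) * (eta / 2).
  by rewrite /kap; field; rewrite gt_eqF.
have e2 : M.+1%:R * (kap * dl) / h <= eta / 2.
  rewrite ler_pdivrMr//; move: cc0; rewrite ltr_pdivlMr; last by rewrite mulr_gt0.
  have : M.+1%:R * dl <= 2 * c.
    have : lam * c <= 1 * c by rewrite ler_wpM2r// ltW.
    by rewrite -natr1 mulrDl mul1r; lra.
  move=> /(ler_wpM2l (ltW kap0)); lra.
have : q * c `^ (1 - b) * M.+1%:R * (kap * dl) / h = q * c `^ (1 - b) * (M.+1%:R * (kap * dl) / h) by ring.
move=> ->; have := ler_wpM2l (ltW qc) e2; lra.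
Qed.

(** A single time decides: at the last grid point t <= (1 + u) * c the line dr * t is above the
    level by dr (1 - b) u c, up to a mesh error of at most half of that, and Markov's inequality
    applies. By Bernoulli's inequality the level dominates the curve up to time (1 + u) * c. *)
Lemma late_survival u eta : 0 < u -> 0 < eta ->
  exists2 c0 : R, 0 < c0 & forall c dl M, 0 < c -> c < c0 -> 0 < dl ->
    dl <= (1 - b) * u * c / 2 -> M%:R * dl <= (1 + u) * c -> (1 + u) * c < M.+1%:R * dl ->
    surv (law dl) (below (dr * c * (1 + b * u))) M.+1 0 <= eta.
Proof.
have [dr0 b0 b1] := params; move=> u0 eta0; have b1' : 0 < 1 - b by lra.
pose v0 := dr * (1 - b) * u / 2.
have v00 : 0 < v0 by rewrite /v0 divr_gt0// !mulr_gt0.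
pose kap := eta * v0 / (1 + u).
have kap0 : 0 < kap by rewrite divr_gt0 ?mulr_gt0//; lra.
have [h h0 hdev] := drift_dev kap0.
exists (h / v0); first by rewrite divr_gt0.
move=> c dl M c0 ch dl0 dlc Mc cM; set rho := dr * c * _.
have d0 := ltW dl0; pose t := M%:R * dl.
have t0 : 0 <= t by rewrite mulr_ge0.
have mA : measurable [set w | X t w <= rho] by exact: (measurable_sublevel (f := X t)).
have sP : surv (law dl) (below rho) M.+1 0 <= fine (P [set w | X t w <= rho]).
  have mI : measurable ([set x : R | x <= rho]) by rewrite -[X in measurable X]set_itvNyc.
  rewrite -lee_fin -(levy_surv hX M.+1 0 d0 (lexx 0)); last by move=> k; exact: mI.
  rewrite fineK ?fin_num_measure//.
  have -> : P [set w | X t w <= rho] = P [set w | [set x | x <= rho] (X (0 + t) w - X 0 w)].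
    by rewrite (incr_law hX (lexx 0) _ mI) ?addr_ge0// add0r subr0.
  apply: le_measure; rewrite ?inE.
  - apply: bigcap_measurableType => j _.
    rewrite (_ : [set w | _] = [set w | [set x | x <= rho] (X (0 + j%:R * dl) w - X 0 w)]).
      exact: measurable_incr_set.
    by apply/seteqP; split => w /=; rewrite (add0r (X _ w - X 0 w)).
  - exact: measurable_incr_set.
  - by move=> w /(_ M (ltnSn _)) /=; rewrite (add0r (X _ w - X 0 w)).
apply: (le_trans sP).
have vh : v0 * c < h by rewrite mulrC -ltr_pdivlMr.
have mk : v0 * c * fine (P [set w | X t w <= rho]) <= kap * t.
  apply: le_trans (hdev t t0); apply: bm_markov => //.
  - exact: bm_min_dev (ltW h0).
  - by move=> w; rewrite le_min normr_ge0 ltW.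
  - move=> w /= Xr; rewrite le_min (ltW vh) andbT.
    have := ler_norm (- (X t w - dr * t)); rewrite normrN.
    have : dr * ((1 + u) * c - (1 - b) * u * c / 2) <= dr * t.
      rewrite ler_wpM2l ?(ltW dr0)//.
      have Mt : M.+1%:R * dl = t + dl by rewrite -natr1 mulrDl mul1r.
      by move: cM; rewrite Mt; lra.
    rewrite /v0 /rho in Xr *; lra.
have vc : 0 < v0 * c by rewrite mulr_gt0.
rewrite -(ler_pM2l vc); apply: (le_trans mk).
have u1 : 0 < 1 + u by lra.
have -> : v0 * c * eta = kap * ((1 + u) * c) by rewrite /kap; field; rewrite gt_eqF.
by rewrite ler_wpM2l// ltW.
Qed.

Lemma mesh_small (eps e : R) : 0 < eps -> 0 < e ->
  exists m0, forall m, (m0 <= m)%N -> 0 < mesh eps m <= e.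
Proof.
move=> eps0 e0; have [m0 m0P] := dyadic_small eps0 e0; exists m0 => m /m0P/ltW ->.
by rewrite divr_gt0// ltr0n expn_gt0.
Qed.

Lemma grid_index (t dl : R) : 0 <= t -> 0 < dl ->
  exists M, M%:R * dl <= t < M.+1%:R * dl.
Proof.
move=> t0 dl0; exists (Num.truncn (t / dl)).
have /andP[k1 k2] := truncn_itv (divr_ge0 t0 (ltW dl0)).
by rewrite -ler_pdivlMr// k1 -ltr_pdivrMr.
Qed.

(** The requirement c < eps keeps the cap out of the way up to time lam * c. This yields the lower
    bound 1 in [curve_time_limit]. *)
Lemma curve_time_ge_linear eps lam eta : 0 < eps -> 0 < lam -> lam < 1 -> 0 < eta ->
  exists2 c0 : R, 0 < c0 & forall c, 0 < c -> c < c0 ->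
    lam * c * (1 - eta) <= curve_time eps c.
Proof.
have [dr0 b0 b1] := params; move=> eps0 lam0 lam1 eta0.
have [c0 c00 c0P] := early_crossing lam0 lam1 eta0.
exists (Num.min c0 eps); first by rewrite lt_min c00.
move=> c cpos; rewrite lt_min => /andP[cc0 ceps].
have cv : lam * c * (1 - eta) @[_ --> \oo] --> lam * c * (1 - eta) by exact: cvg_cst.
have cv2 := curve_time_cvg (c := c) eps0.
apply: (le_of_cvg cv cv2).
have [m0 m0P] := mesh_small eps0 cpos; exists m0 => m /m0P/andP[dl0 dlc].
have lc0 : 0 <= lam * c by rewrite mulr_ge0 ?ltW.
have [M /andP[M1 M2]] := grid_index lc0 dl0.
have := c0P c _ M cpos cc0 dl0 dlc M1; set sv := surv _ _ _ _ => svP.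
have p2 : (0 : R) < (2 ^ m)%N%:R by rewrite ltr0n expn_gt0.
have Mm : (M < 2 ^ m)%N.
  rewrite -(ltr_nat R) -(ltr_pM2r dl0); apply: (le_lt_trans M1).
  rewrite [ltRHS]mulrC divfK ?gt_eqF//; apply: lt_trans ceps.
  by rewrite gtr_pMl.
have := surv_le_est (law (mesh eps m)) 0 (measurable_curve c (mesh eps m)) Mm; rewrite -/sv => h.
have sv0 : 0 <= sv by have /andP[] := surv01 (law (mesh eps m)) M.+1 0 (measurable_curve c (mesh eps m)).
apply: (@le_trans _ _ (mesh eps m * (M.+1%:R * sv))); last by rewrite ler_wpM2l// ltW.
rewrite mulrA (mulrC (mesh eps m)).
apply: (@le_trans _ _ (lam * c * sv)); first by rewrite ler_wpM2l//; lra.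
by rewrite ler_wpM2r// ltW.
Qed.

(** After time lam * c the curve lies above the level dr * c * lam^b, so crossing it late implies
    having crossed the level. An early crossing has probability at most [eta]; the process is then
    nonnegative and reaches the level within a mean time A times its height. *)
Lemma curve_time_ge_level kap h eps A lam eta :
  0 <= kap -> 0 < h -> dev kap h -> 0 < eps ->
  1 + eps * kap / h <= A * (dr - kap) -> 0 <= A ->
  0 < lam -> lam < 1 -> 0 < eta ->
  exists2 c0 : R, 0 < c0 & forall c, 0 < c -> c < c0 ->
    level_time eps (dr * c * lam `^ b) - A * (dr * c * lam `^ b) * eta <= curve_time eps c.
Proof.
have [dr0 b0 b1] := params; move=> kap0 h0 hdev eps0 hA A0 lam0 lam1 eta0.
have [c0 c00 c0P] := early_crossing lam0 lam1 eta0.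
exists c0 => // c cpos cc0; set rho := dr * c * _.
have rho0 : 0 <= rho by rewrite !mulr_ge0 ?powR_ge0 ?ltW.
have rhoE : rho = dr * c `^ (1 - b) * (lam * c) `^ b.
  by rewrite /rho powRM ?ltW// -{1}(powR_split b cpos); ring.
rewrite lerBlDr.
have cv1 := level_time_cvg (y := rho) eps0.
have cv2 : mesh eps m * est (law (mesh eps m)) (curve c (mesh eps m)) (2 ^ m) 0 +
    A * (rho + dr * mesh eps m) * eta @[m --> \oo] -->
    curve_time eps c + A * (rho + dr * 0) * eta.
  apply: cvgD; first exact: curve_time_cvg.
  apply: cvgMl; apply: cvgMr; apply: cvgD; first exact: cvg_cst.
  by apply: cvgMr; exact: cvg_mesh.
rewrite mulr0 addr0 in cv2.
apply: (le_of_cvg cv1 cv2).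
have [m0 m0P] := mesh_small eps0 cpos; exists m0 => m /m0P/andP[dl0 dlc].
set dl := mesh eps m in dl0 dlc *.
have lc0 : 0 <= lam * c by rewrite mulr_ge0 ?ltW.
have [M /andP[M1 M2]] := grid_index lc0 dl0.
have svP := c0P c _ M cpos cc0 dl0 dlc M1.
have rdl0 : 0 <= rho + dr * dl by rewrite addr_ge0// mulr_ge0 ?ltW.
have B0 : 0 <= A * (rho + dr * dl) / dl by rewrite divr_ge0 ?mulr_ge0// ltW.
have main := @est_le_est_surv _ (law dl) (curve c dl) (below rho) M.+1 (2 ^ m) 0
  (A * (rho + dr * dl) / dl) (measurable_curve c dl) (measurable_below rho) B0.
have pr : 0 <= dr * c `^ (1 - b) by rewrite mulr_ge0 ?powR_ge0// ltW.
have {}main := main _ _.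
apply: (@le_trans _ _ (dl * (est (law dl) (curve c dl) (2 ^ m) 0 +
  A * (rho + dr * dl) / dl * (1 - surv (law dl) (curve c dl) M.+1 0)))).
  rewrite ler_wpM2l ?(ltW dl0)//; apply: main.
  - move=> k Mk x /= xr; apply: (le_trans xr); rewrite rhoE ler_wpM2l//.
    have kM : lam * c <= k%:R * dl.
      by apply: (le_trans (ltW M2)); rewrite ler_wpM2r ?(ltW dl0)// ler_nat.
    by rewrite ge0_ler_powR ?nnegrE// (le_trans lc0).
  - move=> k n x _ nm /= /negP; rewrite -ltNge => xk.
    have x0 : 0 <= x by rewrite ltW// (le_lt_trans _ xk)// mulr_ge0 ?powR_ge0.
    rewrite ler_pdivlMr// mulrC.
    have := @est_grid_le kap h 0 eps A m (fun=> rho) n x kap0 h0 hdev (lexx 0) eps0.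
    rewrite subr0 => /(_ hA A0 _ nm)/le_trans; apply.
      by move=> j; rewrite mul0r addr0.
    rewrite ler_wpM2l// ge_max rdl0/= -/dl; lra.
rewrite mulrDr lerD2l mulrA (mulrC dl) divfK ?gt_eqF//.
by rewrite ler_wpM2l// mulr_ge0.
Qed.

(* The curve lies below a line of slope s, hence is left in a time linear in its
   height; this bound is used only after time (1 + u) c, rarely reached. *)
Lemma curve_time_le_level kap h eps A s u eta :
  0 <= kap -> 0 < h -> dev kap h -> 0 < eps ->
  1 + eps * kap / h <= A * (dr - s - kap) -> 0 <= A -> 0 < s -> 0 < u -> 0 < eta ->
  exists2 c0 : R, 0 < c0 & forall c, 0 < c -> c < c0 ->
    curve_time eps c <= (1 + A * s) * level_time eps (dr * c * (1 + b * u)) +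
      A * (dr * (s / dr) `^ (- (b / (1 - b))) * c) * eta.
Proof.
have [dr0 b0 b1] := params; move=> kap0 h0 hdev eps0 hA A0 s0 u0 eta0.
have b1' : 0 < 1 - b by lra.
have [c0 c00 c0P] := late_survival u0 eta0.
exists c0 => // c cpos cc0; set rho := dr * c * (1 + _).
set Cs := dr * _ * c.
have bu0 : 0 <= b * u by rewrite mulr_ge0// ltW.
have rho0 : 0 <= rho by rewrite !mulr_ge0 ?ltW//; lra.
have sd : 0 < s / dr by rewrite divr_gt0.
have Cs0 : 0 <= Cs by rewrite !mulr_ge0 ?powR_ge0 ?ltW.
(* Weighted AM-GM for (s / dr) * t and y * c, where [y] is fixed by (s / dr)^b y^(1 - b) = 1. *)
have line t : 0 <= t -> dr * c `^ (1 - b) * t `^ b <= s * t + Cs.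
  move=> t0; set y := (s / dr) `^ (- (b / (1 - b))).
  have y0 : 0 < y by rewrite powR_gt0.
  have xy : (s / dr) `^ b * y `^ (1 - b) = 1.
    rewrite /y -powRrM mulNr divfK ?gt_eqF// -powRD ?addrN ?powRr0//.
    by rewrite (gt_eqF sd) implybT.
  have st0 : 0 <= s / dr * t by rewrite mulr_ge0// ltW.
  have yc0 : 0 <= y * c by rewrite mulr_ge0// ltW.
  have := powR_amgm b0 b1 st0 yc0.
  rewrite (@powRM _ _ _ b (ltW sd) t0) (@powRM _ _ _ (1 - b) (ltW y0) (ltW cpos)).
  have -> : (s / dr) `^ b * t `^ b * (y `^ (1 - b) * c `^ (1 - b)) =
    ((s / dr) `^ b * y `^ (1 - b)) * (t `^ b * c `^ (1 - b)) by ring.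
  rewrite xy mul1r => am.
  have am2 : t `^ b * c `^ (1 - b) <= s / dr * t + y * c.
    apply: (le_trans am).
    have : b * (s / dr * t) <= 1 * (s / dr * t) by rewrite ler_wpM2r// ltW.
    have : (1 - b) * (y * c) <= 1 * (y * c) by rewrite ler_wpM2r//; lra.
    lra.
  have -> : s * t + Cs = dr * (s / dr * t + y * c).
    by rewrite /Cs -/y; field; rewrite gt_eqF.
  by rewrite -mulrA ler_wpM2l ?(ltW dr0)// mulrC.
have cv1 := curve_time_cvg (c := c) eps0.
have cv2 : (1 + A * s) * (mesh eps m * est (law (mesh eps m)) (below rho) (2 ^ m) 0) +
    A * (Cs + dr * mesh eps m) * eta @[m --> \oo] -->
    (1 + A * s) * level_time eps rho + A * (Cs + dr * 0) * eta.
  apply: cvgD; first by apply: cvgMr; exact: level_time_cvg.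
  apply: cvgMl; apply: cvgMr; apply: cvgD; first exact: cvg_cst.
  by apply: cvgMr; exact: cvg_mesh.
rewrite mulr0 addr0 in cv2.
apply: (le_of_cvg cv1 cv2).
have ec : 0 < (1 - b) * u * c / 2 by rewrite divr_gt0// !mulr_gt0.
have [m0 m0P] := mesh_small eps0 ec; exists m0 => m /m0P/andP[dl0 dlc].
set dl := mesh eps m in dl0 dlc *.
have uc0 : 0 <= (1 + u) * c by rewrite mulr_ge0 ?ltW//; lra.
have [M /andP[M1 M2]] := grid_index uc0 dl0.
have svP := c0P c _ M cpos cc0 dl0 dlc M1 M2.
have cd0 : 0 <= A * (Cs + dr * dl) by rewrite mulr_ge0// addr_ge0// mulr_ge0 ?ltW.
have C0 : 0 <= A * (Cs + dr * dl) / dl by rewrite divr_ge0// ltW.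
have As0 : 0 <= A * s by rewrite mulr_ge0// ltW.
have pr : 0 <= dr * c `^ (1 - b) by rewrite mulr_ge0 ?powR_ge0// ltW.
(* The curve plays [G] and the level [H]. The slope [s] makes the residual time grow by A * s per
   elapsed step, hence the factor 1 + A * s, which is close to 1 for small [s]. *)
have main := @est_le_residual _ (law dl) (below rho) (curve c dl) M.+1 (2 ^ m) 0
  (A * s) (A * (Cs + dr * dl) / dl) 0%N (measurable_below rho) (measurable_curve c dl) As0 C0.
apply: (@le_trans _ _ (dl * ((1 + A * s) * est (law dl) (below rho) (2 ^ m) 0 +
  A * (Cs + dr * dl) / dl * surv (law dl) (below rho) M.+1 0))).
  rewrite ler_wpM2l ?(ltW dl0)// -[X in _ <= X]add0r addrA.
  rewrite -[X in X + _ + _](mulr0 (A * s)); apply: main.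
  - move=> k kM x /= xk; apply: (le_trans xk).
    have kc : k%:R * dl <= (1 + u) * c.
      by apply: le_trans M1; rewrite ler_wpM2r ?(ltW dl0)// ler_nat.
    apply: (@le_trans _ _ (dr * c `^ (1 - b) * ((1 + u) * c) `^ b)).
      rewrite ler_wpM2l// ge0_ler_powR ?nnegrE//.
      by rewrite mulr_ge0// ltW.
    rewrite powRM ?(ltW cpos)//; last lra.
    have -> : dr * c `^ (1 - b) * ((1 + u) `^ b * c `^ b) =
      dr * (c `^ b * c `^ (1 - b)) * (1 + u) `^ b by ring.
    rewrite powR_split// /rho ler_wpM2l ?mulr_ge0 ?(ltW dr0) ?(ltW cpos)//.
    by apply: powRM_bernoulli => //; exact: ltW.
  - move=> j n x Mj nm /= /negP; rewrite -ltNge => xr; rewrite add0n.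
    have x0 : 0 <= x by rewrite (le_trans rho0)// ltW.
    pose hs i := s * ((j + i)%N%:R * dl) + Cs.
    have jd i : 0 <= (j + i)%N%:R * dl by rewrite mulr_ge0// ltW.
    apply: (@le_trans _ _ (est (law dl) (fun i => [set z | z <= hs i]) n x)).
      apply: est_mono => [k|k|k y /= /le_trans]; [exact: measurable_curve|exact: (measurable_below _ 0%N)|].
      by apply; exact: line.
    have hss k : hs k.+1 <= hs k + s * mesh eps m.
      by rewrite /hs addnS -natr1 -/dl; lra.
    have hg := @est_grid_le kap h s eps A m hs n x kap0 h0 hdev
      (ltW s0) eps0 hA A0 hss nm.
    have le2 : A * Num.max 0 (hs 0%N - x + dr * dl) <= A * (s * (j%:R * dl) + Cs + dr * dl).
      have drdl : 0 <= dr * dl by rewrite mulr_ge0 ?ltW.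
      have sj : 0 <= s * (j%:R * dl) by rewrite mulr_ge0 ?(ltW s0)// mulr_ge0 ?(ltW dl0).
      rewrite ler_wpM2l// ge_max; apply/andP; split; first by lra.
      by rewrite /hs addn0; lra.
    rewrite -(ler_pM2l dl0); apply: (le_trans hg); apply: (le_trans le2).
    have -> : dl * (A * (Cs + dr * dl) / dl + A * s * j%:R) =
        A * (s * (j%:R * dl) + Cs + dr * dl) by field; rewrite gt_eqF.
    by [].
rewrite mulrDr mulrCA lerD2l mulrA (mulrC dl) divfK ?gt_eqF//.
by rewrite ler_wpM2l.
Qed.

Lemma curve_time_limit eps : 0 < eps -> exists L : R,
  [/\ forall zeta, 0 < zeta -> exists2 c1 : R, 0 < c1 & forall c, 0 < c -> c < c1 ->
        `|L - curve_time eps c / c| <= zeta,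
      1 <= L &
      forall kap h A, 0 <= kap -> 0 < h -> dev kap h ->
        1 + eps * kap / h <= A * (dr - kap) -> 0 <= A -> L <= dr * A].
Proof.
have [dr0 b0 b1] := params; move=> eps0.
(* A quarter of the drift for the deviations and at most a quarter for the slope leave dr / 2, so
   one [A] serves all slopes up to dr / 4. *)
have kap0 : 0 < dr / 4 by lra.
have [h h0 hdev] := drift_dev kap0; set kap := dr / 4 in kap0 hdev.
pose A := (1 + eps * kap / h) / (dr / 2).
have ekh : 0 < eps * kap / h by rewrite divr_gt0// mulr_gt0.
have A0 : 0 < A by rewrite divr_gt0//; lra.
have hA e : e <= dr / 4 -> 1 + eps * kap / h <= A * (dr - e - kap).
  move=> es; rewrite -ler_pdivrMl//; apply: (@le_trans _ _ (dr / 2)).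
    have -> : A^-1 * (1 + eps * kap / h) = dr / 2.
      by rewrite /A invf_div divfK// gt_eqF//; lra.
    by [].
  by rewrite /kap; lra.
have hA0 : 1 + eps * kap / h <= A * (dr - kap).
  by have := hA 0; rewrite subr0; apply; lra.
have gK y : 0 <= y -> 0 <= level_time eps y <= A * y.
  by move=> y0; apply: (level_time_le (ltW kap0) h0 hdev) => //; exact: ltW.
have [S [S0 gS Sg]] := subadditive_slope gK
  (fun y z _ => @level_time_mono eps y z eps0)
  (fun y z => @level_timeD eps y z eps0).
have lower zeta : 0 < zeta -> exists2 c1 : R, 0 < c1 & forall c, 0 < c -> c < c1 ->
    dr * S - zeta <= curve_time eps c / c.
  move=> z0; pose eta := Num.min (2^-1) (zeta / (dr * (S + 1 + A))).
  have den : 0 < dr * (S + 1 + A) by rewrite mulr_gt0//; lra.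
  have eta0 : 0 < eta by rewrite lt_min invr_gt0 ltr0n/= divr_gt0.
  have eta1 : eta <= 2^-1 by rewrite ge_min lexx.
  have etaz : eta * (dr * (S + 1 + A)) <= zeta.
    by rewrite -ler_pdivlMr// ge_min lexx orbT.
  have l0 : 0 < 1 - eta by lra. have l1 : 1 - eta < 1 by lra.
  have [c0 c00 c0P] := curve_time_ge_level (ltW kap0) h0 hdev eps0
    hA0 (ltW A0) l0 l1 eta0.
  have [y0 y00 y0P] := Sg _ eta0.
  exists (Num.min c0 (y0 / dr)); first by rewrite lt_min c00 divr_gt0.
  move=> c cpos; rewrite lt_min => /andP[cc0 cy].
  have := c0P c cpos cc0; set rho := dr * c * _ => h1.
  have one e : (1 : R) `^ e = 1 by rewrite powR1.
  have pb1 : (1 - eta) `^ b <= 1.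
    rewrite -[leRHS](one b); apply: ge0_ler_powR; rewrite ?nnegrE//; lra.
  have pb2 : 1 - eta <= (1 - eta) `^ b.
    have p1 : (1 - eta) `^ (1 - b) <= 1.
      rewrite -[leRHS](one (1 - b)); apply: ge0_ler_powR; rewrite ?nnegrE//; lra.
    by rewrite -{1}(powR_split b l0) ler_piMr// powR_ge0.
  have dc0 : 0 < dr * c by rewrite mulr_gt0.
  have rho0 : 0 < rho by rewrite mulr_gt0// powR_gt0.
  have rho1 : rho <= dr * c by rewrite ler_piMr// ltW.
  have rho2 : dr * c * (1 - eta) <= rho by rewrite ler_wpM2l// ltW.
  have rhoy : rho < y0 by apply: (le_lt_trans rho1); rewrite mulrC -ltr_pdivlMr.
  have := y0P rho; rewrite rho0 rhoy => /(_ isT) h2.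
  move: (level_time eps rho) (curve_time eps c) h1 h2 => u v h1 h2.
  clearbody rho; rewrite (ler_pdivlMr _ _ cpos).
  have h3 : S * (dr * c * (1 - eta)) <= S * rho by rewrite ler_wpM2l.
  have h4 : eta * (1 + A) * rho <= eta * (1 + A) * (dr * c).
    by rewrite ler_wpM2l// mulr_ge0 ?(ltW eta0)//; lra.
  have h5 : eta * (dr * (S + 1 + A)) * c <= zeta * c by rewrite ler_wpM2r// ltW.
  clearbody eta A; clear - h1 h2 h3 h4 h5; lra.
have upper zeta : 0 < zeta -> exists2 c1 : R, 0 < c1 & forall c, 0 < c -> c < c1 ->
    curve_time eps c / c <= dr * S + zeta.
  move=> z0; pose sg := Num.min (dr / 4) (Num.min 1 (zeta / (2 * (dr * S * (2 * A + 1) + 1)))).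
  have dSA : 0 <= dr * S * (2 * A + 1).
    by rewrite mulr_ge0 ?mulr_ge0 ?(ltW dr0)//; lra.
  have den : 0 < 2 * (dr * S * (2 * A + 1) + 1) by lra.
  have sg0 : 0 < sg by rewrite !lt_min ltr01 kap0 divr_gt0.
  have sg1 : sg <= dr / 4 by rewrite ge_min lexx.
  have sg2 : sg <= 1 by rewrite !ge_min lexx !orbT.
  have sg3 : sg * (2 * (dr * S * (2 * A + 1) + 1)) <= zeta.
    by rewrite -ler_pdivlMr// !ge_min lexx !orbT.
  pose Cs := dr * (sg / dr) `^ (- (b / (1 - b))).
  have Cs0 : 0 <= Cs by rewrite mulr_ge0 ?powR_ge0// ltW.
  pose eta := zeta / (2 * (A * Cs + 1)).
  have ACs : 0 <= A * Cs by rewrite mulr_ge0// ltW.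
  have den2 : 0 < 2 * (A * Cs + 1) by lra.
  have eta0 : 0 < eta by rewrite divr_gt0.
  have etaz : eta * (2 * (A * Cs + 1)) = zeta by rewrite /eta divfK// gt_eqF.
  have [c0 c00 c0P] := curve_time_le_level (ltW kap0) h0 hdev eps0
    (hA sg sg1) (ltW A0) sg0 sg0 eta0.
  exists c0 => // c cpos cc0; rewrite ler_pdivrMr//.
  apply: (le_trans (c0P c cpos cc0)); rewrite -/Cs.
  have bs0 : 0 <= b * sg by rewrite mulr_ge0// ltW.
  have bs1 : b * sg <= sg by rewrite ler_piMl ?(ltW sg0)// ltW.
  have y0 : 0 <= dr * c * (1 + b * sg).
    by rewrite mulr_ge0 ?mulr_ge0 ?ltW//; lra.
  have As0 : 0 <= A * sg by rewrite mulr_ge0// ltW.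
  have AS1 : 0 <= 1 + A * sg by lra.
  have dSc : 0 <= dr * S * c by rewrite !mulr_ge0// ltW.
  have h1 := ler_wpM2l AS1 (gS _ y0).
  have h2 : (1 + A * sg) * (1 + b * sg) <= 1 + sg * (2 * A + 1).
    have : A * sg * (b * sg) <= A * sg * 1 by rewrite ler_wpM2l//; lra.
    lra.
  have h3 := ler_wpM2l dSc h2.
  have h4 := ler_wpM2r (ltW cpos) sg3.
  have h5 : A * (Cs * c) * eta <= zeta * c / 2.
    have -> : zeta * c / 2 = A * (Cs * c) * eta + c * eta by rewrite -etaz; field.
    by rewrite lerDl mulr_ge0// ltW.
  have h6 : 0 <= sg * c by rewrite mulr_ge0 ?ltW.
  move: (level_time eps _) h1 => u h1.
  clearbody Cs eta sg A; clear - h1 h2 h3 h4 h5 h6; lra.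
exists (dr * S); split.
- move=> zeta z0; have [c1 c10 c1P] := lower _ z0; have [c2 c20 c2P] := upper _ z0.
  exists (Num.min c1 c2); first by rewrite lt_min c10.
  move=> c cpos; rewrite lt_min => /andP[cc1 cc2].
  rewrite ler_norml; have := c1P c cpos cc1; have := c2P c cpos cc2; move: (curve_time eps c / c) => u g1 g2; lra.
- rewrite leNgt; apply/negP => L1.
  (* With dr * S = 1 - 4 eta the two bounds on [curve_time] would give (1 - eta)^2 <= 1 - 3 eta. *)
  pose eta := (1 - dr * S) / 4.
  have L0 : 0 <= dr * S by rewrite mulr_ge0// ltW.
  have eta0 : 0 < eta by rewrite /eta; lra.
  have eta1 : eta < 1 by rewrite /eta; lra.
  have [c1 c10 c1P] := upper _ eta0.
  have l0 : 0 < 1 - eta by lra. have l1 : 1 - eta < 1 by lra.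
  have [c2 c20 c2P] := curve_time_ge_linear eps0 l0 l1 eta0.
  pose c := Num.min c1 c2 / 2.
  have m0 : 0 < Num.min c1 c2 by rewrite lt_min c10.
  have cpos : 0 < c by rewrite divr_gt0.
  have cm : c < Num.min c1 c2 by rewrite /c; lra.
  move: cm; rewrite lt_min => /andP[cc1 cc2].
  have := c1P c cpos cc1; have := c2P c cpos cc2.
  rewrite ler_pdivrMr// => g1 g2.
  have : ((1 - eta) * (1 - eta)) * c <= (dr * S + eta) * c by lra.
  rewrite ler_pM2r// => g3.
  have : eta = (1 - dr * S) / 4 by [].
  have := mulr_ge0 (ltW eta0) (ltW eta0); lra.
- move=> kap' h' A' kap0' h0' hdev' hA' A0'.
  rewrite ler_wpM2l ?(ltW dr0)// leNgt; apply/negP => AS.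
  have eta0 : 0 < (S - A') / 2 by lra.
  have [y0 y00 y0P] := Sg _ eta0.
  have y2 : 0 < y0 / 2 < y0 by apply/andP; split; lra.
  have := y0P _ y2.
  have /andP[_ g1] := level_time_le kap0' h0' hdev' eps0 hA' A0' (ltW (andP y2).1).
  move=> /le_trans/(_ g1); rewrite ler_pM2r; lra.
Qed.

End bounded_variation_passage.

Lemma BV_passage_asymptotics (R : realType) (d : measure_display) (T : measurableType d)
    (P : probability T R) (X : R -> {RV P >-> R})
    (gamma sigma : R) (Pi : {measure set R -> \bar R}) (b : R) :
  is_Levy X -> has_Levy_triplet X gamma sigma Pi -> 0 <= b -> b < 1 ->
  bounded_variation_process X -> 0 < Levy_drift gamma Pi ->
    let C (r : R) := (r / Levy_drift gamma Pi) `^ (1 / (1 - b)) in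
    exists2 L : R -> \bar R,
      forall eps : R, 0 < eps ->
        ((\int[P]_w mine (passage_time X b r w) eps%:E) / (C r)%:E)%E
          @[r --> 0^'+] --> L eps
      & L eps @[eps --> 0^'+] --> 1%E.
Proof.
move=> hX hXt b0 b1 bvX; set dr := Levy_drift gamma Pi => dr0 C.
have params : [/\ 0 < dr, 0 <= b & b < 1] by [].
have b1' : 0 < 1 - b by lra.
have ddev := drift_moment hX hXt bvX.
have := curve_time_limit hX params ddev => lim.
(* The inner limit exists for each eps separately; choice makes it a function of eps, with an
   arbitrary value for eps <= 0. *)
have /choice[Lf LfP] : forall eps : R, exists L : R, 0 < eps ->
  [/\ forall zeta, 0 < zeta -> exists2 c1 : R, 0 < c1 & forall c, 0 < c -> c < c1 ->
        `|L - curve_time X dr b eps c / c| <= zeta,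
      1 <= L &
      forall kap h A, 0 <= kap -> 0 < h -> (forall t, 0 <= t ->
        \int[P]_w Num.min `|X t w - dr * t| h <= kap * t) ->
        1 + eps * kap / h <= A * (dr - kap) -> 0 <= A -> L <= dr * A].
  move=> eps; have [e0|e0] := ltP 0 eps; last by exists 0.
  by have [L HL] := lim eps e0; exists L.
exists (fun eps => (Lf eps)%:E) => [eps eps0|].
- have [L1 _ _] := LfP eps eps0.
  have Cpos r : 0 < r -> 0 < C r by move=> r0; rewrite powR_gt0// divr_gt0.
  have CE r : 0 < r -> dr * C r `^ (1 - b) = r.
    move=> r0; rewrite /C -powRrM div1r mulVf ?gt_eqF// powRr1 ?divr_ge0 ?ltW//.
    by rewrite mulrC divfK// gt_eqF.
  have cvgR : curve_time X dr b eps (C r) / C r @[r --> 0^'+] --> Lf eps.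
    apply/cvgrPdist_le => zeta z0; have [c1 c10 c1P] := L1 _ z0.
    near=> r; apply: c1P; first by apply: Cpos.
    have rc : r < dr * c1 `^ (1 - b).
      by near: r; apply: nbhs_right_lt; rewrite mulr_gt0// powR_gt0.
    have r0 : 0 < r by [].
    rewrite /C div1r -[c1](powRr1 (ltW c10)) -[X in c1 `^ X](mulfV (lt0r_neq0 b1')) powRrM.
    apply: gt0_ltr_powR; rewrite ?nnegrE ?invr_gt0 ?powR_ge0 ?divr_ge0 ?(ltW r0) ?(ltW dr0)//.
    by rewrite ltr_pdivrMr// mulrC.
  have cvgE : (curve_time X dr b eps (C r) / C r)%:E @[r --> 0^'+] --> (Lf eps)%:E.
    by apply: cvg_EFin; [near=> r|].
  apply: cvg_trans cvgE; apply: near_eq_cvg; near=> r.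
  have r0 : 0 < r by [].
  have -> : (\int[P]_w mine (passage_time X b r w) eps%:E =
      (curve_time X dr b eps (C r))%:E)%E.
    rewrite /curve_time CE// -bm_integral.
      apply: eq_integral => w _; rewrite capped_timeE//.
    apply: bm_capped_time => //.
    - by move=> t t0; exact: measurable_crosses.
    - move=> w; apply: (right_open_crosses hX) => t t0.
      by apply: cvgMr; exact: powR_right_cvg.
  by rewrite inver gt_eqF ?Cpos.
- apply: cvg_EFin; first by near=> eps.
  apply/cvgrPdist_le => zeta z0.
  (* With kappa = dr * q the bound is L <= (1 + E) / (1 - q) where E = eps * dr * q / h. Since [h]
     depends on [q], [q] comes first and eps is then taken small compared with [h]. *)
  pose q := Num.min (2^-1) (zeta / 4); have q0 : 0 < q by rewrite lt_min invr_gt0 ltr0n divr_gt0.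
  have q1 : q <= 2^-1 by rewrite ge_min lexx.
  have q2 : q <= zeta / 4 by rewrite ge_min lexx orbT.
  have kap0 : 0 < dr * q by rewrite mulr_gt0.
  have [h h0 hdev] := ddev _ kap0.
  have w0 : 0 < 1 + zeta / 2 by rewrite addr_gt0// divr_gt0.
  have zz : 0 < 2 * (1 + zeta / 2) by rewrite mulr_gt0.
  near=> eps.
  have eps0 : 0 < eps by [].
  have [_ g1 g2] := LfP eps eps0.
  have epsk : eps * (dr * q) / h <= zeta / (2 * (1 + zeta / 2)).
    rewrite ler_pdivrMr// -ler_pdivlMr//; near: eps; apply: nbhs_right_le.
    by rewrite divr_gt0// mulr_gt0// divr_gt0// zz.
  have dq : 0 < dr - dr * q.
    have : dr * q <= dr * 2^-1 by rewrite ler_wpM2l// ltW.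
    by move=> dq2; move: dr0; lra.
  pose E := eps * (dr * q) / h.
  have E0 : 0 <= E by rewrite !mulr_ge0 ?invr_ge0 ?ltW.
  have g4 : Lf eps <= dr * ((1 + E) / (dr - dr * q)).
    apply: (g2 (dr * q) h _ (ltW kap0) h0 hdev); first by rewrite divfK// gt_eqF.
    by rewrite divr_ge0 ?(ltW dq)//; lra.
  have q3 : dr * ((1 + E) / (dr - dr * q)) = (1 + E) / (1 - q).
    by field; rewrite !gt_eqF//; lra.
  have g5 : (1 + E) / (1 - q) <= (1 + E) * (1 + zeta / 2).
    rewrite ler_wpM2l//; first lra.
    rewrite -div1r ler_pdivrMr; last lra.
    have : q * q <= 2^-1 * q by rewrite ler_wpM2r// ltW.
    nra.
  have g6 : E * (1 + zeta / 2) <= zeta / 2.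
    have e2 : zeta / (2 * (1 + zeta / 2)) * (1 + zeta / 2) = zeta / 2.
      by rewrite invfM mulrA divfK// gt_eqF.
    rewrite -[leRHS]e2; apply: ler_wpM2r; [exact: ltW|exact: epsk].
  move: g4; rewrite q3 => /le_trans/(_ g5); rewrite mulrDl mul1r => g4.
  by rewrite /= ler_norml; apply/andP; split; lra.
Unshelve. all: by end_near. Qed.

(** * Two-sided passage times *)

Section absolute_passage.
Context d (T : measurableType d) (R : realType) (P : probability T R).
Context (X : R -> {RV P >-> R}) (hX : is_Levy X).
Variable b : R.
Hypothesis b01 : 0 <= b < 1.

Local Notation tau r := (passage_time_abs X b r).
Definition abs_crosses r t w := r * t `^ b < `|X t w|.

Lemma measurable_abs_crosses r t : measurable [set w | abs_crosses r t w].
Proof.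
apply: (measurable_superlevel (f := fun w => `|X t w|)).
exact: (measurableT_comp (@normr_measurable R setT)).
Qed.

Lemma right_open_norm_crosses (c : R -> R) w :
  (forall t, 0 <= t -> c s @[s --> t^'+] --> c t) ->
  right_open (fun t => c t < `|X t w|).
Proof.
move=> cc; apply: (right_open_lt (g := fun t => `|X t w|)) => // t t0.
by apply: cvg_norm; exact: (Levy_cadlag_right hX).
Qed.

Lemma right_open_abs_crosses r w : right_open ((abs_crosses r) ^~ w).
Proof.
have /andP[b0 _] := b01; apply: right_open_norm_crosses => t t0.
by apply: cvgMr; exact: powR_right_cvg.
Qed.

Lemma measurable_tau r : measurable_fun setT (tau r).
Proof.
apply: (@measurable_first_time _ _ _ (abs_crosses r)).
- by move=> t _; exact: measurable_abs_crosses.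
- exact: right_open_abs_crosses.
Qed.

Lemma tau_ge0 r w : (0 <= tau r w)%E.
Proof. exact: first_time_ge0. Qed.

Lemma tau_mono r r' w : r <= r' -> (tau r w <= tau r' w)%E.
Proof.
move=> rr; apply: ereal_inf_le_tmp => _ [t [t0 ct] <-]; exists t => //; split => //.
by apply: le_lt_trans ct; rewrite ler_wpM2r ?powR_ge0.
Qed.

Lemma tau_ltP r (t : \bar R) w : (tau r w < t)%E <->
  exists s, [/\ 0 <= s, r * s `^ b < `|X s w| & (s%:E < t)%E].
Proof. exact: first_time_ltP. Qed.

Definition cap_time r eps w := capped_time (abs_crosses r) eps w.

Lemma cap_timeE r eps w : 0 < eps -> (cap_time r eps w)%:E = mine (tau r w) eps%:E.
Proof. by move=> e0; rewrite capped_timeE. Qed.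

Lemma bm_cap_time r eps : 0 < eps -> bm (cap_time r eps).
Proof.
move=> e0; apply: bm_capped_time => //.
- by move=> t _; exact: measurable_abs_crosses.
- exact: right_open_abs_crosses.
Qed.

End absolute_passage.

Lemma cvg0_EFinP (R : realType) (F : R -> \bar R) (f : R -> R) (l : R) :
  (forall r, 0 < r -> F r = (f r)%:E) ->
  (F r @[r --> 0^'+] --> l%:E) <->
  (forall eta : R, 0 < eta -> exists2 r0 : R, 0 < r0 & forall r : R, 0 < r -> r < r0 ->
     `|f r - l| <= eta).
Proof.
move=> FE; split.
  move=> /fine_cvgP[_ /cvgrPdist_le h] eta eta0.
  have [e /= e0 He] := h _ eta0; exists e => // r r0 re.
  have := He r; rewrite /= sub0r normrN ger0_norm ?(ltW r0)// => /(_ re r0).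
  by rewrite FE// distrC.
move=> h; apply/fine_cvgP; split; first by near=> r; rewrite FE.
apply/cvgrPdist_le => eta eta0; have [e e0 He] := h _ eta0.
near=> r; rewrite /= FE// distrC; exact: He.
Unshelve. all: by end_near. Qed.

(** * Ratios near one in probability *)

Section near_one.
Context d (T : measurableType d) (R : realType) (P : probability T R).
Variable C : R -> R.
Hypothesis C_gt0 : forall r : R, 0 < r -> 0 < C r.

(** Cross-multiplied, so that an infinite passage time simply falls outside. *)
Definition ratio_in (U : R -> T -> \bar R) (r dl : R) :=
  [set w | (((1 - dl) * C r)%:E <= U r w <= ((1 + dl) * C r)%:E)%E].

Definition near_one (U : R -> T -> \bar R) := forall dl eta : R, 0 < dl -> 0 < eta ->
  exists2 r0 : R, 0 < r0 & forall r : R, 0 < r -> r < r0 ->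
  fine (P (~` ratio_in U r dl)) <= eta.

Lemma measurable_ratio_in U (r dl : R) : measurable_fun setT (U r) -> measurable (ratio_in U r dl).
Proof.
move=> mU; rewrite (_ : ratio_in U r dl =
  (setT `&` [set w | (((1 - dl) * C r)%:E <= U r w)%E]) `&`
  (setT `&` [set w | (U r w <= ((1 + dl) * C r)%:E)%E])).
  by apply: measurableI; [exact: emeasurable_fun_c_infty|exact: emeasurable_fun_infty_c].
by rewrite !setTI; apply/seteqP; split => w /=; rewrite /ratio_in/=; [move/andP|move=> ?; exact/andP].
Qed.

Lemma ratio_inE U (r dl : R) : 0 < r -> (forall w, 0 <= U r w)%E ->
  [set w | (dl%:E < `|U r w / (C r)%:E - 1|)%E] = ~` ratio_in U r dl.
Proof.
move=> r0 U0; have c0 := C_gt0 r0.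
apply/seteqP; split => w; rewrite /ratio_in /=; have := U0 w;
  case: (U r w) => [u| |] //=; rewrite inver gt_eqF//=.
- rewrite !lee_fin lte_fin => u0 h; apply/negP; move: h; apply: contraTN => /andP[h1 h2].
  rewrite -leNgt ler_norml lerBrDr lerBlDr ler_pdivlMr// ler_pdivrMr//; lra.
- by move=> _ _; rewrite leye_eq/= andbF.
- rewrite !lee_fin lte_fin => u0 /negP; apply: contraNT; rewrite -leNgt.
  by rewrite ler_norml lerBrDr lerBlDr ler_pdivlMr// ler_pdivrMr//; lra.
- by move=> _ _; rewrite gt0_mulye ?lte_fin ?invr_gt0//= ltry.
Qed.

Lemma cvg0_probP (Q : R -> set T) : (forall r, measurable (Q r)) ->
  (P (Q r) @[r --> 0^'+] --> 0%E) <->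
  (forall eta : R, 0 < eta -> exists2 r0 : R, 0 < r0 & forall r : R, 0 < r -> r < r0 ->
     fine (P (Q r)) <= eta).
Proof.
move=> mQ; rewrite (cvg0_EFinP (f := fun r => fine (P (Q r))) 0); last first.
  by move=> r _; rewrite fineK// fin_num_measure.
by split=> h eta /h[r1 r10 r1P]; exists r1 => // r r0 /(r1P r r0);
  rewrite subr0 ger0_norm// fineP_ge0.
Qed.

Lemma near_oneP U : (forall r, measurable_fun setT (U r)) -> (forall r w, 0 <= U r w)%E ->
  cvg0_in_probability P (fun r w => U r w / (C r)%:E)%E 1%E <-> near_one U.
Proof.
move=> mU U0.
have E dl : (P [set w | (dl%:E < `|U r w / (C r)%:E - 1|)%E] @[r --> 0^'+] --> 0%E) <->
    (P (~` ratio_in U r dl) @[r --> 0^'+] --> 0%E).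
  by split; apply: cvg_trans; apply: near_eq_cvg; near=> r; rewrite ratio_inE.
have mR dl r : measurable (~` ratio_in U r dl) by apply/measurableC/measurable_ratio_in.
split=> [h dl eta dl0 eta0|h dl dl0].
  have [+ _] := cvg0_probP (fun r => mR dl r); apply => //.
  by apply/E; exact: h.
by apply/E; have [_] := cvg0_probP (fun r => mR dl r); apply => eta; exact: h.
Unshelve. all: by end_near. Qed.

End near_one.

(** * Paths that vanish on an initial interval *)

Section frozen.
Context d (T : measurableType d) (R : realType) (P : probability T R).
Context (X : R -> {RV P >-> R}) (hX : is_Levy X).

Local Notation law t := (distribution P (X t)).
Local Notation dl t m := (t / (2 ^ m)%N%:R : R).

Definition frozen (t : R) := [set w | forall u, 0 <= u <= t -> X u w = 0].

Definition flat (t : R) m := \bigcap_(i < (2 ^ m)%N) [set w |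
  [set 0] (X (0 + i.+1%:R * dl t m) w - X (0 + i%:R * dl t m) w)].

Lemma measurable_flat t m : measurable (flat t m).
Proof. by apply: bigcap_measurableType => i _; exact: measurable_incr_set. Qed.

Lemma meshS (t : R) m : dl t m = 2 * dl t m.+1.
Proof.
have p : (2 ^ m)%N%:R != 0 :> R by rewrite pnatr_eq0 expn_eq0.
by rewrite expnS natrM; field.
Qed.

Lemma flatS t m : flat t m.+1 `<=` flat t m.
Proof.
move=> w h i /= im.
have i2 : ((i * 2).+1 < 2 ^ m.+1)%N by rewrite expnS; lia.
have h1 := h (i * 2)%N (ltnW i2); have h2 := h (i * 2).+1 i2.
have e1 : i%:R * 2 = (i * 2)%N%:R :> R by rewrite natrM.
have e2 : i.+1%:R * 2 = (i * 2).+2%:R :> R by rewrite -natrM mulSn addnC addn2.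
move: h1 h2; rewrite /= (meshS t m) !mulrA e1 e2 => h1 h2.
by rewrite (subr0_eq h2) (subr0_eq h1) subrr.
Qed.

Lemma start_null : exists N, [/\ measurable N, P N = 0%E & forall w, ~ N w -> X 0 w = 0].
Proof.
have [N [mN PN NX]] := Levy_start hX; exists N; split=> // w Nw.
by apply: contrapT => X0; apply: Nw; exact: NX.
Qed.

Lemma flat_grid t m w i : flat t m w -> X 0 w = 0 -> (i <= 2 ^ m)%N ->
  X (i%:R * dl t m) w = 0.
Proof.
move=> h X0; elim: i => [|i IH] im; first by rewrite mul0r.
by have /eqP := h i im; rewrite subr_eq0 !add0r IH ?(ltnW im)// => /eqP.
Qed.

Lemma flat_frozen t w : 0 < t -> (forall m, flat t m w) -> X 0 w = 0 -> frozen t w.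
Proof.
move=> t0 h X0 u /andP[u0]; rewrite le_eqVlt => /predU1P[->|ut].
  by have := flat_grid (h 0%N) X0 (i := 1%N); rewrite mul1r divr1; apply.
apply/eqP; rewrite -normr_le0 leNgt; apply/negP => Xu.
have rD : right_open (fun s => 0 < `|X s w|).
  apply: (right_open_norm_crosses hX (c := fun=> 0)) => s s0; exact: cvg_cst.
have [m0 /(_ m0 (leqnn _))[k [km _]]] := grid_crossing rD u0 Xu ut ut.
by rewrite (flat_grid (h m0) X0 (ltnW km)) normr0 ltxx.
Qed.

Lemma frozen_flat t m w : 0 < t -> frozen t w -> flat t m w.
Proof.
move=> t0 h i im /=; rewrite !add0r !h ?subrr//.
  rewrite mulr_ge0 ?divr_ge0 ?(ltW t0)//= mulrCA ger_pMr//.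
  by rewrite ler_pdivrMr ?ltr0n ?expn_gt0// mul1r ler_nat ltnW.
rewrite mulr_ge0 ?divr_ge0 ?(ltW t0)//= mulrCA ger_pMr//.
by rewrite ler_pdivrMr ?ltr0n ?expn_gt0// mul1r ler_nat.
Qed.

Lemma measurable_flats t : measurable (\bigcap_m flat t m).
Proof. by apply: bigcapT_measurable => m; exact: measurable_flat. Qed.

Lemma measurable_frozen t : 0 < t -> measurable (frozen t).
Proof.
move=> t0; rewrite (_ : frozen t = \bigcap_m flat t m `&` [set w | X 0 w = 0]).
  apply: measurableI; first exact: measurable_flats.
  rewrite -[X in measurable X]setTI; exact: (measurable_funP (X 0)) (measurable_set1 0).
apply/seteqP; split => w.
  move=> h; split=> [m _|]; first exact: frozen_flat.
  by apply: h; rewrite lexx ltW.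
by move=> [h X0]; apply: flat_frozen => // m; exact: h.
Qed.

Lemma frozen_prob t : 0 < t -> P (frozen t) = P (\bigcap_m flat t m).
Proof.
move=> t0; have [N [mN PN NX]] := start_null.
apply: (fineP_ae (measurable_frozen t0) (measurable_flats t) mN PN) => w /NX X0.
split=> [h m _|h]; first exact: frozen_flat.
by apply: flat_frozen => // m; exact: h.
Qed.

Lemma increments_prob (s : R) n (A : set R) : 0 <= s -> measurable A ->
  fine (P (\bigcap_(i < n) [set w | A (X (0 + i.+1%:R * s) w - X (0 + i%:R * s) w)])) =
  fine (law s A) ^+ n.
Proof.
move=> s0 mA; rewrite (xi_rectangle hX (lexx 0) s0 n (A := fun=> A))//=.
by rewrite prodr_const card_ord.
Qed.

Lemma flat_prob t m : 0 < t ->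
  fine (P (flat t m)) = fine (law (dl t m) [set 0]) ^+ (2 ^ m).
Proof. by move=> t0; apply: increments_prob => //; rewrite divr_ge0// ltW. Qed.

Lemma flat_cvg t : 0 < t -> fine (P (flat t m)) @[m --> \oo] --> fine (P (frozen t)).
Proof.
move=> t0; rewrite frozen_prob//; apply: fine_cvg.
rewrite fineK ?fin_num_measure//; last exact: measurable_flats.
apply: nonincreasing_cvg_mu.
- by rewrite (le_lt_trans (probability_le1 _ _)) ?ltry//; exact: measurable_flat.
- by move=> m; exact: measurable_flat.
- exact: measurable_flats.
- by apply/nonincreasing_seqP => m; apply/subsetPset; exact: flatS.
Qed.

(** Doubling t and refining once keeps the mesh and doubles the number of i.i.d. increments, which
    squares the probability at each grid level; the identity survives in the limit. *)
Lemma frozen_double t : 0 < t -> fine (P (frozen (2 * t))) = fine (P (frozen t)) ^+ 2.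
Proof.
move=> t0; have t20 : 0 < 2 * t by rewrite mulr_gt0.
have h2 := flat_cvg t20; rewrite -(cvg_shiftS (fun m => fine (P (flat (2 * t) m)))) in h2.
have E : (fun m => fine (P (flat (2 * t) m.+1))) =
    (fun m => fine (P (flat t m)) * fine (P (flat t m))).
  apply/funext => m; rewrite !flat_prob// -expr2 -exprM mulnC -expnS.
  by have -> : dl (2 * t) m.+1 = dl t m by rewrite (meshS t m) -mulrA.
have cv : fine (P (flat (2 * t) m.+1)) @[m --> \oo] -->
    fine (P (frozen t)) * fine (P (frozen t)).
  by rewrite E; apply: cvgM; exact: flat_cvg.
by rewrite expr2; exact: (cvg_unique _ h2 cv).
Qed.

Lemma frozen_anti s t : 0 < s -> s <= t -> fine (P (frozen t)) <= fine (P (frozen s)).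
Proof.
move=> s0 st; have t0 := lt_le_trans s0 st.
apply: fineP_le; [exact: measurable_frozen..|move=> w h u /andP[u0 us]].
by apply: h; rewrite u0 (le_trans us).
Qed.

Lemma null_frozen : (forall t, 0 < t -> fine (P (frozen t)) = 1) -> null_process X.
Proof.
move=> h; have : {ae P, forall w, forall n : nat, frozen n.+1%:R w}.
  apply: ae_foralln => n; exists (~` frozen n.+1%:R); split => //.
    by apply: measurableC; exact: measurable_frozen.
  have mF : measurable (frozen n.+1%:R) by exact: measurable_frozen.
  transitivity (1 - P (frozen n.+1%:R))%E; first exact: probability_setC.
  by rewrite -[P _]fineK ?fin_num_measure// h// subee.
apply: filterS => w hw t t0; apply: (hw (Num.truncn t)).
by rewrite t0 ltW//; have /andP[] := truncn_itv t0.
Qed.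

End frozen.

(** * Removing the cap *)

Section sandwiched.
Context d (T : measurableType d) (R : realType) (P : probability T R).
Context (X : R -> {RV P >-> R}) (hX : is_Levy X).
Variables (b : R) (C : R -> R).
Hypothesis b01 : 0 <= b < 1.
Hypothesis nonnull : ~ null_process X.

Local Notation tau r := (passage_time_abs X b r).
Local Notation near_one := (near_one P C).
Local Notation prob_frozen t := (fine (P (frozen X t))).

Lemma measurable_late r t : measurable [set w | (t%:E < tau r w)%E].
Proof.
rewrite -[X in measurable X]setTI; apply: emeasurable_fun_o_infty => //.
exact: measurable_tau.
Qed.

Lemma frozen_tau r t w : 0 < r -> frozen X t w -> (t%:E <= tau r w)%E.
Proof.
move=> r0 h; rewrite leNgt; apply/negP => /tau_ltP[s [s0 cs st]].
move: cs; rewrite h ?s0 ?normr0 ?ltNge ?mulr_ge0 ?powR_ge0 ?(ltW r0)//.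
by rewrite lte_fin in st; exact: ltW.
Qed.

(** If the passage is later than t for every level r > 0, the path vanishes on [0, t]; the rest is
    continuity of [P] along decreasing events. *)
Lemma late_le_frozen t eta : 0 < t -> 0 < eta -> exists2 r0 : R, 0 < r0 &
  forall r, 0 < r -> r < r0 -> fine (P [set w | (t%:E < tau r w)%E]) <= prob_frozen t + eta.
Proof.
move=> t0 eta0; pose A n := [set w | (t%:E < tau (n.+1%:R^-1) w)%E].
have mA n : measurable (A n) by exact: measurable_late.
have mIA : measurable (\bigcap_n A n) by exact: bigcapT_measurable.
have Asub : \bigcap_n A n `<=` frozen X t.
  move=> w h u /andP[u0 ut]; apply/eqP; rewrite -normr_le0 leNgt; apply/negP => Xu.
  have pb := powR_ge0 u b.
  have den : 0 < `|X u w| / (u `^ b + 1) by rewrite divr_gt0//; lra.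
  have [n] := ltr_add_invr den; rewrite add0r => hn.
  have := h n I; rewrite /A/= ltNge => /negP; apply.
  apply: (@le_trans _ _ u%:E); last by rewrite lee_fin.
  apply: ereal_inf_lbound; exists u => //; split => //.
  rewrite ltr_pdivlMr in hn; last by lra.
  by apply: le_lt_trans hn; rewrite ler_wpM2l ?invr_ge0 ?ler0n//; lra.
have cA : fine (P (A n)) @[n --> \oo] --> fine (P (\bigcap_n A n)).
  apply: fine_cvg; rewrite fineK ?fin_num_measure//.
  apply: nonincreasing_cvg_mu => //.
    by rewrite (le_lt_trans (probability_le1 _ _)) ?ltry.
  apply/nonincreasing_seqP => n; apply/subsetPset => w; rewrite /A/= => /lt_le_trans; apply.
  by apply: tau_mono; rewrite lef_pV2 ?posrE ?ltr0n// ler_nat.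
have [N _ NP] := (cvgrPdist_le _ _).1 cA _ eta0.
exists (N.+1%:R^-1) => [|r r0 rN]; first by rewrite invr_gt0 ltr0n.
apply: (@le_trans _ _ (fine (P (A N)))).
  apply: fineP_le => //; first exact: measurable_late.
  by move=> w /lt_le_trans; apply; apply: tau_mono; exact: ltW.
have := NP N (leqnn _); rewrite ler_distl => /andP[h _].
rewrite lerBlDr in h; apply: (le_trans h); rewrite lerD2r.
by apply: fineP_le => //; exact: measurable_frozen.
Qed.

(** Covers the passage time and all its capped versions at once, so that one lemma transfers the
    convergence in every direction. *)
Definition sandwiched (U : R -> T -> \bar R) := (forall r, measurable_fun setT (U r)) /\
  exists2 e : R, 0 < e & forall r w, (mine (tau r w) e%:E <= U r w <= tau r w)%E.

Lemma fineP_inhabited (A : set T) : 0 < fine (P A) -> exists w, A w.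
Proof.
by move=> h; apply/set0P/negP => /eqP A0; move: h; rewrite A0 measure0 ltxx.
Qed.

(** [C r] is deterministic: a single path with [U] close to it and passage before t bounds it. *)
Lemma ratio_early U t eta dl : sandwiched U -> near_one U -> 0 < dl ->
  0 < t -> 0 < eta -> prob_frozen t + eta < 1 ->
  exists2 r0 : R, 0 < r0 & forall r, 0 < r -> r < r0 -> (1 - dl) * C r <= t.
Proof.
move=> [mU [e e0 eU]] nU dl0 t0 eta0 ft.
have eta20 : 0 < eta / 2 by rewrite divr_gt0.
have [r1 r10 r1P] := late_le_frozen t0 eta20; have [r2 r20 r2P] := nU _ _ dl0 eta20.
exists (Num.min r1 r2); first by rewrite lt_min r10.
move=> r r0; rewrite lt_min => /andP[rr1 rr2].
have h1 := r1P r r0 rr1; have h2 := r2P r r0 rr2.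
have mL := measurable_late r t; have mR := measurable_ratio_in C dl (mU r).
have mR' := measurableC mR.
pose W := ~` (~` ratio_in C U r dl `|` [set w | (t%:E < tau r w)%E]).
have mW : measurable W by apply: measurableC; exact: measurableU.
have [w] : exists w, W w.
  apply: fineP_inhabited; rewrite fineP_setC; last exact: measurableU.
  by have := fineP_setU P mR' mL; lra.
rewrite /W setCU setCK => -[/andP[w1 _] /= /negP]; rewrite -leNgt => w2.
have /andP[_ w3] := eU r w.
by have := le_trans w1 (le_trans w3 w2); rewrite lee_fin.
Qed.

(** Otherwise, by [frozen_double], there are arbitrarily small s at which being frozen on [0, s] has
    probability below 1, while being frozen on [0, 4 s] has positive probability. For small r the
    first fact gives (2/3) C r <= s through [ratio_early]; a path of the second kind gives 4 s <=
    (4/3) C r, that is at most 2 s. *)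
Lemma frozen_zero U t : sandwiched U -> near_one U -> 0 < t -> prob_frozen t = 0.
Proof.
move=> sU nU t0; apply/eqP; rewrite eq_le fineP_ge0 andbT leNgt; apply/negP => ft.
have [t2 t20 ft2] : exists2 t2, 0 < t2 & prob_frozen t2 < 1.
  apply: contrapT => h; apply: nonnull; apply: (null_frozen hX) => s s0.
  apply/eqP; rewrite eq_le fineP_le1/= ?leNgt; last exact: measurable_frozen.
  by apply/negP => fs; apply: h; exists s.
have ft2n n : prob_frozen (t2 / 2 ^+ n) < 1.
  elim: n => [|n IH]; first by rewrite divr1.
  have p2 : 0 < t2 / 2 ^+ n.+1 by rewrite divr_gt0// exprn_gt0.
  move: IH; have -> : t2 / 2 ^+ n = 2 * (t2 / 2 ^+ n.+1).
    by rewrite exprS; field; rewrite expf_neq0.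
  by rewrite frozen_double// expr_lt1// fineP_ge0.
have [mU [e e0 eU]] := sU.
have m0 : 0 < Num.min t e / 5 by rewrite divr_gt0// lt_min t0.
have [n0 /(_ n0 (leqnn _))] := dyadic_small t20 m0.
rewrite natrX; set s := t2 / _ => sm.
have s0 : 0 < s by rewrite divr_gt0// exprn_gt0.
have [s4t s4e] : 4 * s < t /\ 4 * s < e.
  have : Num.min t e <= t by rewrite ge_min lexx.
  have : Num.min t e <= e by rewrite ge_min lexx orbT.
  by split; lra.
have f4 : 0 < prob_frozen (4 * s).
  by apply: (lt_le_trans ft); apply: (frozen_anti hX); lra.
have fs := ft2n n0; rewrite -/s in fs.
have d3 : (0 : R) < 3^-1 by rewrite invr_gt0.
have eta0 : 0 < (1 - prob_frozen s) / 2 by lra.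
have lt1 : prob_frozen s + (1 - prob_frozen s) / 2 < 1 by lra.
have [r1 r10 r1P] := ratio_early sU nU d3 s0 eta0 lt1.
have eta20 : 0 < prob_frozen (4 * s) / 2 by lra.
have [r2 r20 r2P] := nU _ _ d3 eta20.
pose r := Num.min r1 r2 / 2.
have rm : 0 < Num.min r1 r2 by rewrite lt_min r10.
have r0 : 0 < r by rewrite divr_gt0.
have : r < Num.min r1 r2 by rewrite /r; lra.
rewrite lt_min => /andP[rr1 rr2].
have h1 := r1P r r0 rr1; have h2 := r2P r r0 rr2.
have s40 : 0 < 4 * s by rewrite mulr_gt0.
have mF := measurable_frozen hX s40; have mR := measurable_ratio_in C 3^-1 (mU r).
have mR' := measurableC mR.
have [w [wF wR]] : exists w, frozen X (4 * s) w /\ ratio_in C U r 3^-1 w.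
  apply: contrapT => h; suff : prob_frozen (4 * s) <= prob_frozen (4 * s) / 2 by lra.
  apply: (le_trans _ h2); apply: fineP_le => // w wF wR; apply: h; by exists w.
have := frozen_tau r0 wF => w1; have /andP[w2 _] := eU r w; have /andP[_ w3] := wR.
have : ((4 * s)%:E <= ((1 + 3^-1) * C r)%:E)%E.
  apply: le_trans w3; apply: le_trans w2; rewrite le_min w1 lee_fin; exact: ltW.
by rewrite lee_fin; lra.
Qed.

Lemma tau_vanish U t eta : sandwiched U -> near_one U -> 0 < t -> 0 < eta ->
  exists2 r0 : R, 0 < r0 &
  forall r, 0 < r -> r < r0 -> fine (P [set w | (t%:E < tau r w)%E]) <= eta.
Proof.
move=> sU nU t0 eta0; have := late_le_frozen t0 eta0.
by rewrite (frozen_zero sU nU t0) add0r.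
Qed.

(** Both variables equal the passage time as long as it is below both caps, which by [tau_vanish]
    happens with probability close to 1. *)
Lemma near_one_transfer U V : sandwiched U -> sandwiched V -> near_one U -> near_one V.
Proof.
move=> sU sV nU dl eta dl0 eta0; have [mU [e e0 eU]] := sU; have [mV [e' e'0 eV]] := sV.
have eta20 : 0 < eta / 2 by rewrite divr_gt0.
have m0 : 0 < Num.min e e' by rewrite lt_min e0.
have [r1 r10 r1P] := tau_vanish sU nU m0 eta20; have [r2 r20 r2P] := nU _ _ dl0 eta20.
exists (Num.min r1 r2); first by rewrite lt_min r10.
move=> r r0; rewrite lt_min => /andP[rr1 rr2].
have h1 := r1P r r0 rr1; have h2 := r2P r r0 rr2.
have mL := measurable_late r (Num.min e e').
have mRU := measurableC (measurable_ratio_in C dl (mU r)).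
have mRV := measurableC (measurable_ratio_in C dl (mV r)).
have E w e1 (Z : R -> T -> \bar R) : (forall r w, (mine (tau r w) e1%:E <= Z r w <= tau r w)%E) ->
    (tau r w <= e1%:E)%E -> Z r w = tau r w.
  by move=> /(_ r w)/andP[z1 z2] z3; apply/eqP; rewrite eq_le z2/=; move: z1; rewrite min_l.
apply: (@le_trans _ _ (fine (P (~` ratio_in C U r dl `|` [set w | ((Num.min e e')%:E < tau r w)%E])))).
  apply: fineP_le => //; first exact: measurableU.
  move=> w wV; have [w1|w1] := leP (tau r w) (Num.min e e')%:E; last by right.
  left; move: wV; rewrite /ratio_in /=.
  rewrite (E w e' V eV) ?(E w e U eU)//; apply: (le_trans w1);
    by rewrite lee_fin ge_min lexx ?orbT.
by apply: (le_trans (fineP_setU P mRU mL)); lra.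
Qed.

End sandwiched.

Lemma expr_small (R : realType) (q e : R) : 0 <= q -> q < 1 -> 0 < e ->
  exists n0, forall n, (n0 <= n)%N -> q ^+ n <= e.
Proof.
move=> q0 q1 e0.
have h : q ^+ n @[n --> \oo] --> (0 : R) by apply: cvg_expr; rewrite ger0_norm.
have [n0 _ H] := (cvgr0Pnorm_le _).1 h _ e0.
by exists n0 => n /H /=; rewrite ger0_norm ?exprn_ge0.
Qed.

Lemma sum_half_le (R : realType) M N :
  \sum_(M <= m < N) (2^-1 : R) ^+ m <= 2 * 2^-1 ^+ M.
Proof.
have p n : 0 <= (2^-1 : R) ^+ n by rewrite exprn_ge0// invr_ge0.
have [MN|NM] := leqP M N; last by rewrite big_geq ?mulr_ge0 1?ltnW.
suff : \sum_(M <= m < N) (2^-1 : R) ^+ m + 2 * 2^-1 ^+ N = 2 * 2^-1 ^+ M.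
  by have := p N; lra.
elim: N MN => [|N IH]; first by rewrite leqn0 => /eqP ->; rewrite big_geq// add0r.
rewrite leq_eqVlt => /predU1P[->|]; first by rewrite big_geq// add0r.
rewrite ltnS => MN; rewrite big_nat_recr//= exprS mulrA mulfV// mul1r -IH//.
by lra.
Qed.

(** * Growth of C and geometric tails of the passage time *)

Section tails.
Context d (T : measurableType d) (R : realType) (P : probability T R).
Context (X : R -> {RV P >-> R}) (hX : is_Levy X).
Variables (b : R) (C : R -> R).
Hypothesis b01 : 0 <= b < 1.
Hypothesis C_gt0 : forall r : R, 0 < r -> 0 < C r.

Local Notation law t := (distribution P (X t)).
Local Notation tau r := (passage_time_abs X b r).
Hypothesis near : near_one P C (fun r => tau r).

Lemma measurable_norm_le (a : R) : measurable ([set z | `|z| <= a] : set R).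
Proof.
apply: (measurable_sublevel (f := fun z : R => `|z|)).
exact: (@normr_measurable R setT).
Qed.

Lemma endp_law (dl : R) (A : set R) j : 0 <= dl -> measurable A ->
  endp (law dl) A j 0 = fine (law (j%:R * dl) A).
Proof.
move=> dl0 mA; rewrite -endp_surv//; set H := fun k : nat => if k == j then A else setT.
have mH k : measurable (H k) by rewrite /H; case: ifP.
have := levy_surv hX j.+1 0 dl0 (lexx 0) mH => /(congr1 fine) /= <-; congr fine.
have := incr_law hX (lexx 0) (mulr_ge0 (ler0n _ j) dl0) mA; rewrite subr0 => <-.
congr (P _); apply/seteqP; split => [w /(_ j (leqnn _))|w h k kj] /=.
  by rewrite /H eqxx !add0r.
by rewrite /H; case: eqP => [->|//]; rewrite !add0r.
Qed.

(** If all X_s with s <= 2 c were within [a] with probability at least 2/3, Ottaviani's inequality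
    would keep |X| below 2 a = r (c / 2)^b on [0, 2 c) with probability at least 1/2. But with
    probability at least 3/4 the passage falls between c / 2 and 3 c / 2, where the curve is already
    above 2 a. *)
Lemma half_scale : exists2 r0 : R, 0 < r0 & forall r, 0 < r -> r < r0 ->
  exists s, [/\ 0 <= s, s <= 2 * C r &
    fine (law s [set z | `|z| <= r * (C r / 2) `^ b / 2]) < 2 / 3].
Proof.
have /andP[b0 b1] := b01.
have h2 : (0 : R) < 2^-1 by rewrite invr_gt0.
have h4 : (0 : R) < 4^-1 by rewrite invr_gt0.
have [r0 r00 r0P] := near h2 h4; exists r0 => // r rp rr.
have c0 := C_gt0 rp; set c := C r in c0 *; have hR := r0P r rp rr.
set a := r * _ / 2; apply: contrapT => hs.
have a0 : 0 < a by rewrite !(mulr_gt0, powR_gt0, divr_gt0).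
have c20 : 0 < 2 * c by rewrite mulr_gt0.
have {}hs s : 0 <= s -> s <= 2 * c -> 2 / 3 <= fine (law s [set z | `|z| <= a]).
  by move=> s0 s1; rewrite leNgt; apply/negP => s2; apply: hs; exists s.
pose dl m := 2 * c / (2 ^ m)%N%:R.
have dl0 m : 0 <= dl m by rewrite divr_ge0// ltW.
pose H := fun _ : nat => [set z : R | `|z| <= 2 * a].
pose A m := \bigcap_(k < (2 ^ m)%N) [set w | H k (0 + (X (0 + k%:R * dl m) w - X 0 w))].
have mH k : measurable (H k) by exact: measurable_norm_le.
have mA m : measurable (A m).
  apply: bigcap_measurableType => k _.
  rewrite (_ : [set w | _] = [set w | H k (X (0 + k%:R * dl m) w - X 0 w)]).
    exact: measurable_incr_set.
  by apply/seteqP; split => w /=; rewrite (add0r (X _ w - X 0 w)).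
have mIA : measurable (\bigcap_m A m) by exact: bigcapT_measurable.
have A2 m : 2^-1 <= fine (P (A m)).
  rewrite /A (levy_surv hX (2 ^ m) 0 (dl0 m) (lexx 0) mH) /=.
  have q01 : (0 : R) <= (2 / 3 : R) <= (1 : R) by lra.
  have hj j : (j <= (2 ^ m).-1)%N -> 2 / 3 <= endp (law (dl m)) [set z | `|z| <= a] j 0.
    move=> jm; rewrite endp_law//; last exact: measurable_norm_le.
    apply: hs; first by rewrite mulr_ge0.
    rewrite /dl mulrCA ger_pMr// ler_pdivrMr ?ltr0n ?expn_gt0// mul1r ler_nat.
    by rewrite (leq_trans jm)// leq_pred.
  have := ottaviani 0 q01 hj; rewrite prednK ?expn_gt0// => h.
  by have := hj _ (leqnn _); rewrite /H; lra.
have dS m : dl m = 2 * dl m.+1 by exact: meshS.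
have AS m : A m.+1 `<=` A m.
  move=> w h k /= km; have /= := h (k * 2)%N.
  by rewrite (dS m) mulrA -natrM; apply; rewrite expnS mulnC ltn_pmul2l.
have cA : fine (P (A m)) @[m --> \oo] --> fine (P (\bigcap_m A m)).
  apply: fine_cvg; rewrite fineK ?fin_num_measure//.
  apply: nonincreasing_cvg_mu => //.
    by rewrite (le_lt_trans (probability_le1 _ _)) ?ltry.
  by apply/nonincreasing_seqP => m; apply/subsetPset; exact: AS.
have : 2^-1 <= fine (P (\bigcap_m A m)).
  by apply: (le_of_cvg (cvg_cst _) cA); exists 0%N => m _; exact: A2.
have [N [mN PN NX]] := start_null hX.
have mR := measurableC (measurable_ratio_in C 2^-1 (measurable_tau hX b01 r)).
have : fine (P (\bigcap_m A m)) <= fine (P ((~` ratio_in C (fun r => tau r) r 2^-1) `|` N)).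
  apply: fineP_le => //; first exact: measurableU.
  move=> w wA; have [wN|/NX X0] := pselect (N w); [by right|left => /andP[w1 w2]].
  have : (tau r w < (2 * c)%:E)%E.
    by apply: (le_lt_trans w2); rewrite lte_fin -/c; lra.
  move=> /tau_ltP[t [t0 ct]]; rewrite lte_fin => t2.
  have tc : c / 2 <= t.
    have : (((1 - 2^-1) * c)%:E <= t%:E)%E.
      by apply: (le_trans w1); apply: ereal_inf_lbound; exists t.
    by rewrite lee_fin; lra.
  have Xt : 2 * a < `|X t w|.
    apply: le_lt_trans ct; rewrite /a [leLHS]mulrC divfK// ler_wpM2l ?(ltW rp)//.
    by apply: ge0_ler_powR; rewrite ?nnegrE//; lra.
  have rD : right_open (fun s => 2 * a < `|X s w|).
    by apply: (right_open_norm_crosses hX (c := fun=> 2 * a)) => s s0; exact: cvg_cst.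
  have [m0 /(_ m0 (leqnn _))[k [km _ Xk]]] := grid_crossing rD t0 Xt t2 t2.
  have := wA m0 I k km; rewrite /H /= X0 subr0 !add0r => Xk'.
  by move: Xk; rewrite ltNge Xk'.
by have := fineP_setU P mR mN; rewrite PN /=; lra.
Qed.

Lemma powR_double (c n : R) : 0 < c -> 0 <= n ->
  (2 * n * c) `^ b = (4 * n) `^ b * (c / 2) `^ b.
Proof.
move=> c0 n0; rewrite -powRM ?mulr_ge0 ?(ltW c0)//.
by congr (_ `^ _); field.
Qed.

Lemma measurable_gt_sign (a sg : R) : measurable ([set z | a < sg * z] : set R).
Proof.
by apply: (measurable_superlevel (f := fun z : R => sg * z)); exact: measurable_funM.
Qed.

(* k steps of the same sign, each larger than a, cross the curve of level 2 r as
   soon as k ^ (1 - b) > 16. *)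
Lemma doubling : exists2 K : R, 1 <= K & exists2 r0 : R, 0 < r0 &
  forall r, 0 < r -> r < r0 -> C (2 * r) <= K * C r.
Proof.
have /andP[b0 b1] := b01; have b1' : 0 < 1 - b by lra.
pose k := (Num.truncn (17 `^ (1 / (1 - b)) : R)).+1.
have k17 : 16 * k%:R `^ b < k%:R :> R.
  have h : 17 `^ (1 / (1 - b)) < k%:R :> R by rewrite truncnS_gt.
  have k0 : 0 < k%:R :> R by rewrite ltr0n.
  have : 17 < k%:R `^ (1 - b) :> R.
    rewrite -[ltLHS](powRr1 (ler0n _ 17)) -[X in 17 `^ X < _](divfK (lt0r_neq0 b1') 1) powRrM.
    by apply: gt0_ltr_powR; rewrite ?nnegrE ?powR_ge0 ?ler0n.
  move=> h17; rewrite -[ltRHS](powR_split b k0) mulrC.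
  by rewrite ltr_pM2l ?powR_gt0//; lra.
have k1 : 1 <= k%:R :> R by rewrite ler1n.
clearbody k.
have p6 : 0 < 6^-1 ^+ k :> R by rewrite exprn_gt0// invr_gt0.
(* Half the lower bound for a favourable run, so that some favourable path also has its ratio near
   one. *)
have eta0 : 0 < 6^-1 ^+ k / 2 :> R by rewrite divr_gt0.
have h2 : (0 : R) < 2^-1 by rewrite invr_gt0.
have [r1 r10 r1P] := half_scale.
have [r2 r20 r2P] := near h2 eta0.
(* The run crosses by time k * s <= 2 k C r, and the passage time over the curve of level 2 r is at
   least C (2 r) / 2. *)
exists (4 * k%:R); first by lra.
exists (Num.min r1 (r2 / 2)); first by rewrite lt_min r10 divr_gt0.
move=> r rp; rewrite lt_min => /andP[rr1 rr2].
have r2p : 0 < 2 * r by rewrite mulr_gt0.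
have hR := r2P (2 * r) r2p ltac:(lra).
have [s [s0 s2 sP]] := r1P r rp rr1.
have c0 := C_gt0 rp; move: s2 sP; set c := C r in c0 *; set D := (c / 2) `^ b => s2.
have D0 : 0 < D by rewrite powR_gt0// divr_gt0.
set a := r * D / 2 => sP.
have a0 : 0 < a by rewrite !(mulr_gt0, divr_gt0).
(* |X_s| exceeds [a] with probability above 1/3, so one of the two signs has at least 1/6. *)
have [sg [sg1 sgP]] : exists sg : R, `|sg| = 1 /\
    6^-1 <= fine (law s [set z | a < sg * z]).
  apply: contrapT => h.
  have h1 : fine (law s [set z | a < 1 * z]) < 6^-1.
    by rewrite ltNge; apply/negP => h1; apply: h; exists 1; rewrite normr1.
  have h1' : fine (law s [set z | a < (-1) * z]) < 6^-1.
    by rewrite ltNge; apply/negP => h3; apply: h; exists (-1); rewrite normrN1.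
  have mU := fineP_setU (law s) (measurable_gt_sign a 1) (measurable_gt_sign a (-1)).
  have mC := fineP_setC (law s) (measurable_norm_le a).
  have : fine (law s (~` [set z | `|z| <= a])) <=
      fine (law s ([set z | a < 1 * z] `|` [set z | a < (-1) * z])).
    apply: fineP_le.
    - by apply: measurableC; exact: measurable_norm_le.
    - by apply: measurableU; exact: measurable_gt_sign.
    move=> z /= /negP; rewrite -ltNge mul1r mulN1r.
    by case: (ger0P z) => _; [left|right].
  lra.
pose G := \bigcap_(i < k) [set w | [set z | a < sg * z]
  (X (0 + i.+1%:R * s) w - X (0 + i%:R * s) w)].
have mG : measurable G.
  by apply: bigcap_measurableType => i _; apply: measurable_incr_set; exact: measurable_gt_sign.
have PG : 6^-1 ^+ k <= fine (P G).
  rewrite (increments_prob hX k s0 (measurable_gt_sign a sg)).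
  by apply: lerXn2r; rewrite ?nnegrE ?fineP_ge0// invr_ge0.
have [N [mN PN NX]] := start_null hX.
have mR := measurableC (measurable_ratio_in C 2^-1 (measurable_tau hX b01 (2 * r))).
have [w [wG wN /andP[wR _]]] : exists w,
    [/\ G w, ~ N w & ratio_in C (fun r => tau r) (2 * r) 2^-1 w].
  apply: contrapT => h.
  have : fine (P G) <= fine (P ((~` ratio_in C (fun r => tau r) (2 * r) 2^-1) `|` N)).
    apply: fineP_le => //; first exact: measurableU.
    move=> w wG; have [wN|wN] := pselect (N w); [by right|left => wR].
    by apply: h; exists w.
  by have := fineP_setU P mR mN; rewrite PN /=; lra.
have X0 := NX w wN.
have Xj j : (j <= k)%N -> j%:R * a <= sg * X (j%:R * s) w.
  elim: j => [|j IH] jk; first by rewrite !mul0r X0 mulr0.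
  have := wG j jk; have := IH (ltnW jk); rewrite /= !add0r mulrBr -natr1 mulrDl mul1r.
  by lra.
have kX : k%:R * a <= `|X (k%:R * s) w|.
  by apply: (le_trans (Xj k (leqnn _))); rewrite -[leRHS]mul1r -sg1 -normrM ler_norm.
have ks0 : 0 <= k%:R * s by rewrite mulr_ge0.
have ks2 : k%:R * s <= 2 * k%:R * c.
  by rewrite [2 * _]mulrC -mulrA ler_wpM2l ?ler0n.
have pk : (k%:R * s) `^ b <= 4 * k%:R `^ b * D.
  apply: (@le_trans _ _ ((2 * k%:R * c) `^ b)).
    by apply: ge0_ler_powR; rewrite ?nnegrE// ?mulr_ge0 ?ler0n ?ltW.
  rewrite powR_double// powRM// ler_wpM2r ?(ltW D0)// ler_wpM2r ?powR_ge0//.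
  by rewrite -[leRHS](powRr1 (ler0n _ 4)); apply: ler_powR; lra.
have cross : (2 * r) * (k%:R * s) `^ b < k%:R * a.
  apply: (@le_lt_trans _ _ (2 * r * (4 * k%:R `^ b * D))).
    by rewrite ler_wpM2l// ltW.
  have -> : 2 * r * (4 * k%:R `^ b * D) = (r * D / 2) * (16 * k%:R `^ b) by field.
  by rewrite -/a [ltRHS]mulrC ltr_pM2l.
have : (((1 - 2^-1) * C (2 * r))%:E <= (k%:R * s)%:E)%E.
  apply: (le_trans wR); apply: ereal_inf_lbound; exists (k%:R * s) => //; split => //.
  exact: lt_le_trans kX.
by rewrite lee_fin; lra.
Qed.

(** Before its passage the process is bounded by the curve: at the times j * s, j <= n, it is at
    most 4 n r D, so each increment is at most 8 n r D <= r' D / 2 = a. Each of these n independent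
    events has probability below 2/3. *)
Lemma survival_tail : exists2 r0 : R, 0 < r0 & forall r r' n, 0 < r -> r' < r0 ->
  (0 < n)%N -> 16 * n%:R * r <= r' ->
  fine (P [set w | ((2 * n%:R * C r')%:E < tau r w)%E]) <= (2 / 3) ^+ n.
Proof.
have /andP[b0 b1] := b01.
have [r0 r00 r0P] := half_scale.
exists r0 => // r r' n rp rr n0 nr.
have n1 : 1 <= n%:R :> R by rewrite ler1n.
have r'0 : 0 < r' by apply: lt_le_trans nr; rewrite !mulr_gt0// ltr0n.
have [s [s0 s2 sP]] := r0P r' r'0 rr.
have c0 := C_gt0 r'0; move: s2 sP; set c := C r' in c0 *; set D := (c / 2) `^ b => s2.
have D0 : 0 < D by rewrite powR_gt0// divr_gt0.
set a := r' * D / 2 => sP.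
apply: (@le_trans _ _ (fine (law s [set z | `|z| <= a]) ^+ n)); last first.
  by apply: lerXn2r; rewrite ?nnegrE ?fineP_ge0// ?divr_ge0// ltW.
rewrite -(increments_prob hX n s0 (measurable_norm_le a)).
apply: fineP_le; first exact: measurable_late.
  by apply: bigcap_measurableType => i _; apply: measurable_incr_set; exact: measurable_norm_le.
move=> w /= late i /= ni.
have bd j : (j <= n)%N -> `|X (0 + j%:R * s) w| <= r * (4 * n%:R * D).
  move=> jn; rewrite add0r.
  have js : j%:R * s <= 2 * n%:R * c.
    apply: (@le_trans _ _ (n%:R * (2 * c))); last by rewrite mulrCA mulrA.
    by rewrite ler_pM// ler_nat.
  apply: (@le_trans _ _ (r * (j%:R * s) `^ b)).
    rewrite leNgt; apply/negP => cs.
    suff : (tau r w < tau r w)%E by rewrite ltxx.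
    apply/tau_ltP; exists (j%:R * s); split => //; first by rewrite mulr_ge0.
    by apply: le_lt_trans late; rewrite lee_fin.
  rewrite ler_wpM2l ?(ltW rp)//; apply: (@le_trans _ _ ((2 * n%:R * c) `^ b)).
    by apply: ge0_ler_powR; rewrite ?nnegrE// ?mulr_ge0 ?ler0n ?(ltW c0).
  rewrite powR_double// ler_wpM2r ?(ltW D0)// -[leRHS]powRr1; last by lra.
  by apply: ler_powR; lra.
apply: (le_trans (ler_normB _ _)); apply: (le_trans (lerD (bd _ ni) (bd _ (ltnW ni)))).
have := ler_wpM2r (ltW D0) nr; rewrite /a.
have -> : r * (4 * n%:R * D) = 4 * n%:R * r * D by ring.
have -> : 16 * n%:R * r * D = 4 * (4 * n%:R * r * D) by ring.
by lra.
Qed.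

(** Passage times increase with r on every path; the factor 3 is (3/2) / (1/2), from a path with
    both ratios within 1/2 of one. *)
Lemma C_almost_mono : exists2 r0 : R, 0 < r0 &
  forall r r', 0 < r -> r <= r' -> r' < r0 -> C r <= 3 * C r'.
Proof.
have h2 : (0 : R) < 2^-1 by rewrite invr_gt0.
have h4 : (0 : R) < 4^-1 by rewrite invr_gt0.
have [r0 r00 r0P] := near h2 h4; exists r0 => // r r' rp rr' r'0.
have mR r := measurable_ratio_in C 2^-1 (measurable_tau hX b01 r).
have [w] : exists w, (ratio_in C (fun r => tau r) r 2^-1 `&`
    ratio_in C (fun r => tau r) r' 2^-1) w.
  apply: (@fineP_inhabited _ _ _ P); rewrite -[X in P X]setCK setCI.
  rewrite fineP_setC; last by apply: measurableU; exact: measurableC.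
  have := fineP_setU P (measurableC (mR r)) (measurableC (mR r')).
  by have := r0P r rp (le_lt_trans rr' r'0);
    have := r0P r' (lt_le_trans rp rr') r'0; lra.
move=> [/andP[w1 _] /andP[_ w2]].
by have := le_trans w1 (le_trans (tau_mono X b w rr') w2); rewrite lee_fin; lra.
Qed.

(* B does not depend on Q, so that B ^ p * (2 / 3) ^ Q can be made small. *)
Lemma geometric_tail : exists2 B : R, 1 < B & forall (Q : nat) (eps : R), (0 < Q)%N ->
  0 < eps -> exists2 A : R, 1 <= A & exists2 r0 : R, 0 < r0 &
  forall r m, 0 < r -> r < r0 -> (0 < m)%N ->
  fine (P [set w | A * B ^+ m * C r < cap_time X b r eps w]) <= (2 / 3) ^+ (Q * m).
Proof.
have [K K1 [r1 r10 r1P]] := doubling; have [r2 r20 r2P] := survival_tail.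
have [r3 r30 r3P] := C_almost_mono.
exists (2 * K) => [|Q eps Q0 eps0]; first by lra.
pose r0 := Num.min r1 (Num.min r2 r3).
have r00 : 0 < r0 by rewrite !lt_min r10 r20.
have rle : [/\ r0 <= r1, r0 <= r2 & r0 <= r3].
  by split; rewrite !ge_min lexx ?orbT.
have [rr1 rr2 rr3] := rle.
have K0 : 0 < K by lra.
(* Since 16 Q <= 2^j0 and m <= 2^m, the level 2^(m + j0) r satisfies the hypothesis of
   [survival_tail] for n = Q * m. [c0] is a lower bound for C on [r0 / 2, r0), by
   [C_almost_mono]. *)
pose j0 := (16 * Q)%N; pose c0 := C (r0 / 2) / 3.
have r020 : 0 < r0 / 2 by rewrite divr_gt0.
have c00 : 0 < c0 by rewrite divr_gt0// C_gt0.
have Kj n : 0 < K ^+ n by rewrite exprn_gt0.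
have Kj0 := Kj j0.
pose A := 1 + (2 * Q%:R * K ^+ j0 + eps * K ^+ j0 / c0).
have A1 : 0 <= 2 * Q%:R * K ^+ j0 by rewrite !mulr_ge0// ltW.
have A2 : 0 <= eps * K ^+ j0 / c0 by apply: divr_ge0; [apply: mulr_ge0|]; exact: ltW.
have Ap : 1 <= A by rewrite /A; lra.
exists A => //; exists r0 => // r m rp rr m0.
have Cr := C_gt0 rp.
have iter i : 2 ^+ i * r < r0 -> C (2 ^+ i * r) <= K ^+ i * C r.
  elim: i => [|i IH] ir; first by rewrite !mul1r.
  have ip : 0 < 2 ^+ i * r by rewrite mulr_gt0// exprn_gt0.
  have ir' : 2 ^+ i * r < r0 by rewrite exprS -mulrA in ir; lra.
  rewrite !exprS -!mulrA; apply: (le_trans (r1P _ ip (lt_le_trans ir' rr1))).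
  by rewrite ler_wpM2l ?(ltW K0)// IH.
have tm2 : (m <= 2 ^ m)%N by rewrite ltnW// ltn_expl.
have Bm : (2 * K) ^+ m = 2 ^+ m * K ^+ m by rewrite exprMn.
have m2R : m%:R <= 2 ^+ m :> R by rewrite -natrX ler_nat.
have mC : measurable [set w | A * (2 * K) ^+ m * C r < cap_time X b r eps w].
  by apply: measurable_superlevel; have [] := bm_cap_time hX b01 r eps0.
(* If the level 2^(m + j0) r leaves the range of validity, [C r] is so large that the threshold
   exceeds the cap and the event is empty; otherwise [survival_tail] applies, with C (2^(m + j0) r)
   <= K^(m + j0) C r. *)
have [big|small] := leP r0 (2 ^+ (m + j0) * r).
  have [i [ij i1 i2]] : exists i, [/\ (i <= m + j0)%N, r0 / 2 <= 2 ^+ i * r & 2 ^+ i * r < r0].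
    elim: (m + j0)%N big => [|j IH] big; first by rewrite mul1r leNgt rr in big.
    have [/IH[i [ij i1 i2]]|i2] := leP r0 (2 ^+ j * r); first by exists i; rewrite leqW.
    by exists j; split => //; rewrite exprS -mulrA in big; lra.
  have c0C : c0 <= K ^+ (m + j0) * C r.
    have h1 := r3P _ _ r020 i1 (lt_le_trans i2 rr3); have h2 := iter i i2.
    have h3 : K ^+ i * C r <= K ^+ (m + j0) * C r.
      by rewrite ler_wpM2r ?(ltW Cr)// ler_weXn2l.
    by rewrite /c0; lra.
  have epsA : eps <= A * (2 * K) ^+ m * C r.
    rewrite -(ler_pM2r (Kj j0)).
    have h1 : eps * K ^+ j0 <= A * c0.
      by rewrite -ler_pdivrMr// /A; lra.
    apply: (le_trans h1); apply: (@le_trans _ _ (A * (K ^+ (m + j0) * C r))).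
      by rewrite ler_wpM2l//; lra.
    have -> : A * (2 * K) ^+ m * C r * K ^+ j0 = 2 ^+ m * (A * (K ^+ (m + j0) * C r)).
      by rewrite Bm exprD; ring.
    rewrite ler_peMl// ?exprn_ege1 ?ler1n// !mulr_ge0 ?ltW//; lra.
  rewrite (_ : [set w | _] = set0) ?measure0 ?exprn_ge0//.
  apply/seteqP; split => w //=; apply/negP; rewrite -leNgt.
  apply: le_trans epsA; have /andP[_] := capped_time_bounds (abs_crosses X b r) eps0 w.
  exact.
have n0 : (0 < Q * m)%N by rewrite muln_gt0 Q0.
have jr : 16 * (Q * m)%N%:R * r <= 2 ^+ (m + j0) * r.
  rewrite ler_wpM2r ?(ltW rp)// exprD -!natrX -!natrM ler_nat.
  have : (16 * Q <= 2 ^ j0)%N by rewrite ltnW// ltn_expl.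
  by move: tm2 => h1 h2; rewrite mulnA mulnC leq_mul.
apply: le_trans (r2P r _ (Q * m)%N rp (lt_le_trans small rr2) n0 jr).
apply: fineP_le => //; first exact: measurable_late.
move=> w /= h; apply: (@lt_le_trans _ _ (cap_time X b r eps w)%:E).
  rewrite lte_fin; apply: le_lt_trans h.
  apply: (@le_trans _ _ (2 * (Q * m)%N%:R * (K ^+ (m + j0) * C r))).
    by rewrite ler_wpM2l ?mulr_ge0// iter.
  rewrite natrM Bm exprD.
  have -> : 2 * (Q%:R * m%:R) * (K ^+ m * K ^+ j0 * C r) =
    2 * Q%:R * K ^+ j0 * (m%:R * (K ^+ m * C r)) by ring.
  have -> : A * (2 ^+ m * K ^+ m) * C r = A * (2 ^+ m * (K ^+ m * C r)) by ring.
  apply: ler_pM => //.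
  - by rewrite !mulr_ge0// ltW.
  - by rewrite /A; lra.
  - by rewrite ler_wpM2r// mulr_ge0 ?ltW.
by rewrite cap_timeE// ge_min lexx.
Qed.

(** Uniform integrability at work: [phi] is small where the ratio is near one, bounded on the
    unlikely rest up to [W M], and summed over geometric layers beyond. It serves both |z - 1|^p,
    for convergence in L^p, and |z^p - 1|, for the moments. *)
Lemma phi_integral_small (p eps : R) (phi : R -> R) : 0 < p -> 0 < eps ->
  near_one P C (fun r w => mine (tau r w) eps%:E) ->
  measurable_fun setT phi -> (forall z, 0 <= z -> 0 <= phi z <= z `^ p + 1) ->
  (forall eta, 0 < eta -> exists2 dl : R, 0 < dl & forall z, `|z - 1| <= dl -> phi z <= eta) ->
  forall eta, 0 < eta -> exists2 r0 : R, 0 < r0 & forall r, 0 < r -> r < r0 ->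
    \int[P]_w phi (cap_time X b r eps w / C r) <= eta.
Proof.
move=> p0 eps0 nearU mphi phib phi1 eta eta0.
have [B B1 tailB] := geometric_tail.
have B0 : 0 < B by lra.
pose be := B `^ p; have be0 : 0 < be by rewrite powR_gt0.
(* [Q] is chosen so that (2/3)^Q beats the growth B^p of the p-th power from one layer to the next,
   leaving a ratio of at most 1/2. *)
have [Q0 /(_ Q0.+1 (leqnSn _)) hQ] : exists n0, forall n, (n0 <= n)%N ->
    (2 / 3 : R) ^+ n <= (2 * be)^-1.
  by apply: expr_small; [lra|lra|rewrite invr_gt0 mulr_gt0].
set Q := Q0.+1 in hQ; pose rho := (2 / 3 : R) ^+ Q.
have rho0 : 0 <= rho by rewrite exprn_ge0//; lra.
have berho : be * rho <= 2^-1.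
  have := ler_wpM2l (ltW be0) hQ; rewrite -/rho invfM mulrCA mulfV ?mulr1//.
  by rewrite gt_eqF.
have [A A1 [r1 r10 tailA]] := tailB Q eps isT eps0.
have A0 : 0 < A by lra.
pose W m := A * B ^+ m.
have W1 m : 1 <= W m.
  by rewrite -[1]mulr1; apply: ler_pM => //; rewrite exprn_ege1// ltW.
have WM m n : (m <= n)%N -> W m <= W n.
  by move=> mn; rewrite ler_wpM2l ?(ltW A0)// ler_weXn2l// ltW.
pose G := 2 * A `^ p * be; have G0 : 0 < G by rewrite !mulr_gt0// powR_gt0.
pose c m := 2 * W m.+1 `^ p.
have c0 m : 0 <= c m by rewrite mulr_ge0// powR_ge0.
have crho m : c m * rho ^+ m <= G * 2^-1 ^+ m.
  have -> : c m = G * be ^+ m.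
    have BE n : (B ^+ n) `^ p = be ^+ n.
      by rewrite -powR_mulrn ?(ltW B0)// -powRrM mulrC powRrM powR_mulrn ?(ltW be0).
    by rewrite /c /W powRM ?exprn_ge0 ?(ltW A0) ?(ltW B0)// BE exprS /G; ring.
  rewrite -mulrA ler_wpM2l ?(ltW G0)// -exprMn.
  by apply: lerXn2r; rewrite ?nnegrE ?mulr_ge0 ?(ltW be0).
have eta30 : 0 < eta / 3 by lra.
have [M M0 hM] : exists2 M, (0 < M)%N & G * (2 * 2^-1 ^+ M) <= eta / 3.
  have G2 : 0 < 2 * G by lra.
  have e0 : 0 < eta / 3 / (2 * G) by rewrite divr_gt0.
  have h2 : (0 : R) <= 2^-1 by lra. have h21 : (2^-1 : R) < 1 by lra.
  have [M /(_ M.+1 (leqnSn _))] := expr_small h2 h21 e0.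
  rewrite ler_pdivlMr// => h; exists M.+1 => //; apply: le_trans h.
  by rewrite le_eqVlt; apply/orP; left; apply/eqP; ring.
have [dl dl0 hdl] := phi1 _ eta30.
pose D := W M `^ p + 1; have D0 : 0 < D by rewrite ltr_wpDl ?powR_ge0.
have etaD : 0 < eta / 3 / D by rewrite divr_gt0.
have [r2 r20 hr2] := nearU _ _ dl0 etaD.
exists (Num.min r1 r2); first by rewrite lt_min r10.
move=> r rp; rewrite lt_min => /andP[rr1 rr2].
have cr := C_gt0 rp; have Prat := hr2 r rp rr2.
have bcap := bm_cap_time hX b01 r eps0; have [mcap _] := bcap.
have capb w : 0 <= cap_time X b r eps w <= eps.
  exact: (capped_time_bounds (abs_crosses X b r) eps0 w).
pose V w := cap_time X b r eps w / C r.
have V0 w : 0 <= V w by have /andP[h _] := capb w; rewrite divr_ge0// ltW.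
(* For fixed r the cap bounds the ratio by eps / C r, so finitely many layers suffice; [N] depends
   on r, but the bound on the sum does not. *)
have [N MN hN] : exists2 N, (M <= N)%N & forall w, V w <= W N.
  have Bi0 : 0 <= B^-1 by rewrite invr_ge0 ltW.
  have Bi1 : B^-1 < 1 by rewrite invf_lt1.
  have e0 : 0 < C r / eps by rewrite divr_gt0.
  have [n0 hn] := expr_small Bi0 Bi1 e0; exists (maxn M n0); first exact: leq_maxl.
  move=> w; apply: (@le_trans _ _ (eps / C r)).
    by rewrite ler_pM2r ?invr_gt0//; have /andP[_] := capb w.
  have := hn (maxn M n0) (leq_maxr _ _); set n := maxn _ _.
  rewrite exprVn -[C r / eps]invf_div lef_pV2 ?posrE ?divr_gt0 ?exprn_gt0// => h.
  by apply: (le_trans h); rewrite ler_peMl// exprn_ge0// ltW.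
pose E m := [set w | A * B ^+ m * C r < cap_time X b r eps w].
have mE m : measurable (E m) by exact: measurable_superlevel.
pose Z := ~` ratio_in C (fun r w => mine (tau r w) eps%:E) r dl.
have mU : measurable_fun setT (fun w => mine (tau r w) eps%:E).
  by apply: measurable_mine => //; exact: measurable_tau.
have mZ : measurable Z.
  apply: measurableC.
  exact: (@measurable_ratio_in _ _ _ C (fun r w => mine (tau r w) eps%:E) r dl mU).
have EV m w : W m < V w -> E m w.
  by rewrite /V ltr_pdivlMr.
have phiV w : 0 <= phi (V w) <= V w `^ p + 1 by exact: phib.
have VpM w x : V w <= x -> V w `^ p <= x `^ p.
  move=> Vx; apply: ge0_ler_powR; rewrite ?nnegrE// ?(ltW p0)//.
  exact: le_trans (V0 w) Vx.
pose S w := \sum_(M <= m < N) c m * \1_(E m) w : R.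
have S0 w : 0 <= S w by apply: sumr_ge0 => m _; rewrite mulr_ge0// indicE.
have ind0 (F : set T) w : 0 <= \1_F w :> R by rewrite indicE.
have pw w : phi (V w) <= (eta / 3 + D * \1_Z w) + S w.
  have [VM|VM] := leP (V w) (W M); last first.
    have [m [Mm mN Wm VWm]] : exists m, [/\ (M <= m)%N, (m < N)%N, W m < V w & V w <= W m.+1].
      have := hN w; elim: N MN {hN S S0} => [|N IH].
        by rewrite leqn0 => /eqP Mz; rewrite Mz in VM; rewrite leNgt VM.
      rewrite leq_eqVlt => /predU1P[<-|]; first by rewrite leNgt VM.
      rewrite ltnS => MN VN; have [/(IH MN)[m [m1 m2 m3 m4]]|VN'] := leP (V w) (W N).
        by exists m; split => //; rewrite ltnW.
      by exists N.
    apply: (@le_trans _ _ (c m)).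
      have /andP[_ h1] := phiV w; apply: (le_trans h1); have := VpM w _ VWm.
      have : 1 <= W m.+1 `^ p.
        have one : (1 : R) `^ p = 1 by rewrite powR1.
        by rewrite -[leLHS]one; apply: ge0_ler_powR; rewrite ?nnegrE ?(ltW p0)// (le_trans ler01).
      by rewrite /c; lra.
    apply: (@le_trans _ _ (S w)).
      rewrite /S (bigD1_seq m) ?iota_uniq ?mem_index_iota ?Mm//=.
      rewrite indicE mem_set ?mulr1; last exact: EV.
      by rewrite lerDl; apply: sumr_ge0 => i _; rewrite mulr_ge0.
    by rewrite lerDr addr_ge0 ?(ltW eta30)// mulr_ge0// ltW.
  have [Zw|Zw] := pselect (Z w).
    rewrite indicE mem_set// mulr1.
    have /andP[_ h1] := phiV w; have := VpM w _ VM; have := S0 w; rewrite /D; lra.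
  have : `|V w - 1| <= dl.
    have Rw : ratio_in C (fun r w => mine (tau r w) eps%:E) r dl w by exact: contrapT.
    have /andP[] := Rw; rewrite -cap_timeE// !lee_fin => h1 h2.
    by rewrite ler_norml lerBrDr lerBlDr /V ler_pdivlMr// ler_pdivrMr//; lra.
  move=> /hdl h; rewrite -addrA; apply: (le_trans h); rewrite lerDl addr_ge0//.
  by rewrite mulr_ge0// ltW.
have bV : bm V by apply: bmM => //; exact: bm_cst.
have bphi : bm (fun w => phi (V w)).
  have [mV _] := bV; split; first exact: measurableT_comp.
  exists (W N `^ p + 1) => w; have /andP[h1 h2] := phiV w.
  by rewrite ger0_norm//; have := VpM w _ (hN w); lra.
have bZ : bm (fun w => eta / 3 + D * \1_Z w).
  by apply: bmD; [exact: bm_cst|apply: bmZ; exact: bm_indic].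
have bcE m : bm (fun w => c m * \1_(E m) w) by apply: bmZ; exact: bm_indic.
have bS : bm S by exact: bm_sum.
apply: (@le_trans _ _ (\int[P]_w ((eta / 3 + D * \1_Z w) + S w))).
  by apply: bm_le_Rintegral => //; exact: bmD.
rewrite bm_RintegralD// bm_Rintegral_affine; last exact: bm_indic.
rewrite bm_Rintegral_indic// bm_Rintegral_sum//.
have hZ : D * fine (P Z) <= eta / 3.
  by rewrite mulrC -ler_pdivlMr.
have hS : \sum_(M <= m < N) \int[P]_w (c m * \1_(E m) w) <= eta / 3.
  apply: le_trans hM; apply: le_trans (ler_wpM2l (ltW G0) (sum_half_le _ M N)).
  rewrite mulr_sumr; apply: ler_sum_nat => m /andP[Mm _].
  rewrite bm_RintegralZ; last exact: bm_indic.
  rewrite bm_Rintegral_indic//; apply: le_trans (crho m).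
  rewrite ler_wpM2l// /rho -exprM; apply: tailA => //; exact: leq_trans M0 Mm.
by have := hZ; have := hS; lra.
Qed.

End tails.

Section powR_near_one.
Context (R : realType).

Lemma powR_abs_sub1_le (p z : R) : 0 < p -> 0 <= z -> `|z - 1| `^ p <= z `^ p + 1.
Proof.
move=> p0 z0; have one : (1 : R) `^ p = 1 by rewrite powR1.
have mono x y : 0 <= x -> x <= y -> x `^ p <= y `^ p.
  move=> x0 xy; apply: ge0_ler_powR; rewrite ?nnegrE ?(ltW p0)//.
  exact: le_trans x0 xy.
have [z1|z1] := leP 1 z.
  apply: (@le_trans _ _ (z `^ p)); last by rewrite lerDl.
  by apply: mono => //; rewrite ger0_norm; lra.
apply: (@le_trans _ _ (1 `^ p)); last by rewrite one lerDr powR_ge0.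
by apply: mono => //; rewrite ltr0_norm; lra.
Qed.

Lemma powR_small (p eta : R) : 0 < p -> 0 < eta ->
  exists2 dl : R, 0 < dl & forall x, 0 <= x -> x <= dl -> x `^ p <= eta.
Proof.
move=> p0 eta0; exists (eta `^ p^-1) => [|x x0 xe]; first by rewrite powR_gt0.
rewrite -[leRHS](powRr1 (ltW eta0)) -(mulVf (lt0r_neq0 p0)) powRrM.
by apply: ge0_ler_powR; rewrite ?nnegrE ?powR_ge0 ?(ltW p0).
Qed.

Lemma powR_near1 (p eta : R) : 0 < p -> 0 < eta ->
  exists2 dl : R, 0 < dl & forall z, `|z - 1| <= dl -> `|z `^ p - 1| <= eta.
Proof.
move=> p0 eta0; have one : (1 : R) `^ p = 1 by rewrite powR1.
have c1 : {for 1, continuous (fun z : R => z `^ p)}.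
  apply/differentiable_continuous/derivable1_diffP/derivable_powR.
  by rewrite in_itv/= ltr01.
have : \forall z \near (1 : R), `|1 `^ p - z `^ p| <= eta.
  by move/cvgrPdist_le : c1; exact.
move=> /nbhs_ballP[e /= e0 He].
have e20 : 0 < e / 2 by rewrite divr_gt0.
exists (e / 2) => // z ze; have := He z; rewrite /= one distrC; apply.
by rewrite /ball/= distrC; lra.
Qed.

End powR_near_one.

(** * Equivalence of the modes of convergence *)

Section Lp_limits.
Context d (T : measurableType d) (R : realType) (P : probability T R).
Context (X : R -> {RV P >-> R}) (hX : is_Levy X).
Variables (b : R) (C : R -> R).
Hypothesis b01 : 0 <= b < 1.
Hypothesis C_gt0 : forall r : R, 0 < r -> 0 < C r.

Local Notation tau r := (passage_time_abs X b r).
Local Notation capped eps := (fun r w => mine (tau r w) eps%:E).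
Local Notation V eps r := (fun w => cap_time X b r eps w / C r).

Lemma bm_powR (f : T -> R) p : bm f -> (forall w, 0 <= f w) -> 0 < p ->
  bm (fun w => f w `^ p).
Proof.
move=> [mf [M fM]] f0 p0; split.
  by apply: (measurableT_comp (measurable_powR p)).
exists (M `^ p) => w; rewrite ger0_norm ?powR_ge0//.
have := fM w; rewrite ger0_norm// => fwM.
by apply: ge0_ler_powR; rewrite ?nnegrE ?(ltW p0)// (le_trans (f0 w)).
Qed.

Lemma bm_ratio r eps : 0 < eps -> bm (V eps r).
Proof. by move=> e0; apply: bmM; [exact: bm_cap_time|exact: bm_cst]. Qed.

Lemma ratio_ge0 r eps w : 0 < r -> 0 < eps -> 0 <= V eps r w.
Proof.
move=> r0 e0; have /andP[h _] := capped_time_bounds (abs_crosses X b r) e0 w.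
by rewrite divr_ge0// ltW// C_gt0.
Qed.

Lemma bm_Lp r eps p : 0 < eps -> 0 < p -> bm (fun w => `|V eps r w - 1| `^ p).
Proof.
move=> e0 p0; apply: bm_powR => //.
have [mf [M fM]] := bmB (bm_ratio r e0) (bm_cst T (1 : R)); split.
  exact: (measurableT_comp (@normr_measurable R setT)).
by exists M => w; rewrite normr_id.
Qed.

Lemma in_LpP p eps : 0 < p -> 0 < eps ->
  cvg0_in_Lp P p (fun r w => mine (tau r w) eps%:E / (C r)%:E)%E 1%E <->
  (forall eta : R, 0 < eta -> exists2 r0 : R, 0 < r0 & forall r : R, 0 < r -> r < r0 ->
     \int[P]_w `|V eps r w - 1| `^ p <= eta).
Proof.
move=> p0 e0; rewrite /cvg0_in_Lp.
rewrite (@cvg0_EFinP _ _ (fun r => \int[P]_w `|V eps r w - 1| `^ p) 0); last first.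
  move=> r r0; rewrite -bm_integral; last exact: bm_Lp.
  by apply: eq_integral => w _; rewrite -cap_timeE// inver gt_eqF ?C_gt0.
have I0 r : 0 <= \int[P]_w `|V eps r w - 1| `^ p.
  rewrite -[leLHS](bm_Rintegral_cst P); apply: bm_le_Rintegral.
  - exact: bm_cst.
  - exact: bm_Lp.
  - by move=> w; exact: powR_ge0.
by split=> h eta /h[r1 r10 r1P]; exists r1 => // r r0 /(r1P r r0); rewrite subr0 ger0_norm.
Qed.

Lemma measurable_capped eps r : measurable_fun setT (capped eps r).
Proof. by apply: measurable_mine => //; exact: measurable_tau. Qed.

Lemma tau_sandwiched : sandwiched X b (fun r => tau r).
Proof.
split; first by move=> r; exact: measurable_tau.
by exists 1 => // r w; rewrite lexx andbT ge_min lexx.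
Qed.

Lemma capped_sandwiched eps : 0 < eps -> sandwiched X b (capped eps).
Proof.
move=> e0; split; first exact: measurable_capped.
by exists eps => // r w; rewrite lexx /= ge_min lexx.
Qed.

Lemma in_probP :
  cvg0_in_probability P (fun r w => tau r w / (C r)%:E)%E 1%E <->
  near_one P C (fun r => tau r).
Proof.
apply: (@near_oneP _ _ _ P C C_gt0 (fun r => tau r)).
  by move=> r; exact: measurable_tau.
by move=> r w; exact: tau_ge0.
Qed.

Lemma in_Lp_near_one p eps : 0 < p -> 0 < eps ->
  cvg0_in_Lp P p (fun r w => mine (tau r w) eps%:E / (C r)%:E)%E 1%E ->
  near_one P C (capped eps).
Proof.
move=> p0 e0 /(in_LpP p0 e0) h dl eta dl0 eta0.
have dlp : 0 < dl `^ p by rewrite powR_gt0.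
have [r0 r00 r0P] := h _ (mulr_gt0 dlp eta0); exists r0 => // r rp rr.
rewrite -(ler_pM2l dlp); apply: le_trans (r0P r rp rr).
apply: bm_markov; first exact: bm_Lp.
- by apply: measurableC; apply: measurable_ratio_in; exact: measurable_capped.
- by move=> w; exact: powR_ge0.
move=> w Zw; apply: ge0_ler_powR; rewrite ?nnegrE ?(ltW p0) ?(ltW dl0)//.
rewrite leNgt; apply/negP => /ltW; rewrite ler_norml lerBrDr lerBlDr.
rewrite ler_pdivlMr ?C_gt0// ler_pdivrMr ?C_gt0// => /andP[h1 h2].
by apply: Zw; rewrite /ratio_in /= -cap_timeE// !lee_fin; apply/andP; split; lra.
Qed.

Lemma near_one_pick U dl N : (forall r, measurable_fun setT (U r)) -> near_one P C U ->
  0 < dl -> measurable N -> P N = 0%E -> exists2 r0 : R, 0 < r0 &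
  forall r, 0 < r -> r < r0 -> exists w, ~ N w /\ ratio_in C U r dl w.
Proof.
move=> mU nU dl0 mN PN; have h2 : (0 : R) < 2^-1 by rewrite invr_gt0.
have [r0 r00 r0P] := nU _ _ dl0 h2; exists r0 => // r rp rr.
have mR := measurableC (measurable_ratio_in C dl (mU r)).
have [w] : exists w, (~` (~` ratio_in C U r dl `|` N)) w.
  apply: (@fineP_inhabited _ _ _ P); rewrite fineP_setC; last exact: measurableU.
  by have := fineP_setU P mR mN; have := r0P r rp rr; rewrite PN /=; lra.
by rewrite setCU setCK => -[wR wN]; exists w.
Qed.

Lemma null_tau : null_process X -> exists N, [/\ measurable N, P N = 0%E &
  forall w, ~ N w -> forall r, 0 < r -> tau r w = +oo%E].
Proof.
move=> [N [mN PN NX]]; exists N; split=> // w Nw r r0.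
have X0 t : 0 <= t -> X t w = 0.
  by move: t; apply: contrapT => h; apply: Nw; apply: NX.
apply/eqP; rewrite -leye_eq leNgt; apply/negP => /tau_ltP[s [s0 cs _]].
by move: cs; rewrite X0// normr0 ltNge mulr_ge0 ?powR_ge0 ?ltW.
Qed.

Lemma near_one_nonnull : near_one P C (fun r => tau r) -> ~ null_process X.
Proof.
move=> nT /null_tau[N [mN PN NX]].
have mT r : measurable_fun setT (tau r) by exact: measurable_tau.
have [r0 r00 r0P] := near_one_pick mT nT ltr01 mN PN.
have r20 : 0 < r0 / 2 by rewrite divr_gt0.
have [|w [wN /andP[_]]] := r0P _ r20; first by lra.
by rewrite NX ?divr_gt0// leye_eq.
Qed.

(* For the null process the capped passage time is the cap itself, and C cannot
   be asymptotic to two different constants. *)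
Lemma capped_near_one_nonnull : near_one P C (capped 1) -> near_one P C (capped 3) ->
  ~ null_process X.
Proof.
move=> n1 n3 /null_tau[N [mN PN NX]].
have h3 : (0 : R) < 3^-1 by rewrite invr_gt0.
have [r1 r10 r1P] := near_one_pick (measurable_capped 1) n1 h3 mN PN.
have [r3 r30 r3P] := near_one_pick (measurable_capped 3) n3 h3 mN PN.
have m0 : 0 < Num.min r1 r3 by rewrite lt_min r10.
pose r := Num.min r1 r3 / 2; have r0 : 0 < r by rewrite divr_gt0.
have : r < Num.min r1 r3 by rewrite /r; lra.
rewrite lt_min => /andP[rr1 rr3].
have [w1 [w1N /andP[+ _]]] := r1P r r0 rr1; have [w3 [w3N /andP[_]]] := r3P r r0 rr3.
rewrite !NX// !min_r ?leey// !lee_fin; have := C_gt0 r0; lra.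
Qed.

Section converse.
Hypothesis nonnull : ~ null_process X.
Hypothesis near : near_one P C (fun r => tau r).

Lemma near_one_Lp p eps : 0 < p -> 0 < eps ->
  cvg0_in_Lp P p (fun r w => mine (tau r w) eps%:E / (C r)%:E)%E 1%E.
Proof.
move=> p0 e0; apply/(in_LpP p0 e0).
have nearU := near_one_transfer hX b01 nonnull tau_sandwiched
  (capped_sandwiched e0) near.
apply: (phi_integral_small hX b01 C_gt0 near p0 e0 nearU
  (phi := fun z => `|z - 1| `^ p)).
- apply: (measurableT_comp (measurable_powR p)).
  apply: (measurableT_comp (@normr_measurable R setT)).
  by apply: measurable_funB.
- by move=> z z0; rewrite powR_ge0 powR_abs_sub1_le.
- move=> eta eta0; have [dl dl0 dlP] := powR_small p0 eta0.
  by exists dl => // z; exact: dlP.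
Qed.

(** Applies [phi_integral_small] to |z^p - 1| directly, which handles p < 1 and p >= 1 alike. *)
Lemma near_one_moment p eps : 0 < p -> 0 < eps ->
  ((\int[P]_w ((mine (tau r w) eps%:E) `^ p)) / (C r `^ p)%:E)%E @[r --> 0^'+] --> 1%E.
Proof.
move=> p0 e0.
have nearU := near_one_transfer hX b01 nonnull tau_sandwiched
  (capped_sandwiched e0) near.
have bcp r : bm (fun w => cap_time X b r eps w `^ p).
  apply: bm_powR => //; first exact: bm_cap_time.
  by move=> w; have /andP[] := capped_time_bounds (abs_crosses X b r) e0 w.
have bVp r : 0 < r -> bm (fun w => V eps r w `^ p).
  by move=> r0; apply: bm_powR => //; [exact: bm_ratio|move=> w; exact: ratio_ge0].
apply/(cvg0_EFinP (f := fun r => \int[P]_w (V eps r w `^ p))).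
  move=> r r0; have Cr := C_gt0 r0; have Cp : 0 < C r `^ p by rewrite powR_gt0.
  transitivity ((\int[P]_w (cap_time X b r eps w `^ p))%:E / (C r `^ p)%:E)%E.
    congr (_ / _)%E; rewrite -bm_integral//.
    by apply: eq_integral => w _; rewrite -cap_timeE.
  rewrite inver gt_eqF//= -EFinM mulrC -bm_RintegralZ//; congr (_%:E).
  apply: eq_Rintegral => w _.
  have /andP[c0 _] := capped_time_bounds (abs_crosses X b r) e0 w.
  by rewrite powRM ?invr_ge0 ?(ltW Cr)// mulrC -powR_inv1 ?(ltW Cr)// powRAC powR_inv1 ?ltW.
move=> eta eta0.
have [r0 r00 r0P] : exists2 r0 : R, 0 < r0 & forall r, 0 < r -> r < r0 ->
    \int[P]_w `|V eps r w `^ p - 1| <= eta.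
  apply: (phi_integral_small hX b01 C_gt0 near p0 e0 nearU
    (phi := fun z => `|z `^ p - 1|)) => //.
  - apply: (measurableT_comp (@normr_measurable R setT)).
    by apply: measurable_funB => //; exact: measurable_powR.
  - move=> z z0; rewrite normr_ge0/= (le_trans (ler_normB _ _))// normr1.
    by rewrite ger0_norm ?powR_ge0.
  - by move=> eta' eta'0; exact: powR_near1.
exists r0 => // r rp rr; apply: le_trans (r0P r rp rr).
have b1 : bm (fun _ : T => (1 : R)) by exact: bm_cst.
have bV := bVp r rp.
rewrite -[X in _ - X](bm_Rintegral_cst P 1) -bm_RintegralB//.
by apply: le_normr_Rintegral => //; apply: bm_integrable; exact: bmB.
Qed.

End converse.

End Lp_limits.

(** The iterated limit is carried by a function [L], which also asserts that the inner limits exist.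
    In (b) the weakest condition, a single [p] and a single [eps], is stated for X not null: for the
    null process the capped time is [eps], so the constant function C = eps satisfies it although
    the passage time is infinite. *)
Theorem theorem3p4 (R : realType) (d : measure_display) (T : measurableType d)
    (P : probability T R) (X : R -> {RV P >-> R})
    (gamma sigma : R) (Pi : {measure set R -> \bar R}) (b : R)
    (hX : is_Levy X) (hXtriplet : has_Levy_triplet X gamma sigma Pi)
    (b_ge0 : 0 <= b) (b_lt1 : b < 1) :
  (bounded_variation_process X -> 0 < Levy_drift gamma Pi ->
    let C (r : R) := (r / Levy_drift gamma Pi) `^ (1 / (1 - b)) in
    exists2 L : R -> \bar R,
      forall eps : R, 0 < eps ->
        ((\int[P]_w mine (passage_time X b r w) eps%:E) / (C r)%:E)%E
          @[r --> 0^'+] --> L eps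
      & L eps @[eps --> 0^'+] --> 1%E)
  /\
  (forall C : R -> R, (forall r, 0 < r -> 0 < C r) ->
    let in_prob :=
      cvg0_in_probability P
        (fun r w => passage_time_abs X b r w / (C r)%:E)%E 1%E in
    let in_Lp (p eps : R) :=
      cvg0_in_Lp P p
        (fun r w => mine (passage_time_abs X b r w) eps%:E / (C r)%:E)%E 1%E in
    [/\ in_prob <-> (forall p eps, 0 < p -> 0 < eps -> in_Lp p eps),
        in_prob <-> (exists2 p, 0 < p & forall eps, 0 < eps -> in_Lp p eps),
        ~ null_process X ->
          (in_prob <-> (exists p eps, [/\ 0 < p, 0 < eps & in_Lp p eps]))
      & in_prob -> forall p eps, 0 < p -> 0 < eps ->
          ((\int[P]_w ((mine (passage_time_abs X b r w) eps%:E) `^ p))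
             / (C r `^ p)%:E)%E @[r --> 0^'+] --> 1%E]).
Proof.
split; first exact: (BV_passage_asymptotics hX hXtriplet b_ge0 b_lt1).
move=> C C_gt0 in_prob in_Lp.
have b01 : 0 <= b < 1 by rewrite b_ge0.
have probP : in_prob <-> near_one P C (fun r => passage_time_abs X b r).
  exact: in_probP.
have prob_nonnull : in_prob -> ~ null_process X.
  by move=> /probP; exact: (near_one_nonnull hX b01).
have prob_Lp p eps : in_prob -> 0 < p -> 0 < eps -> in_Lp p eps.
  move=> hp; apply: (near_one_Lp hX b01 C_gt0); first exact: prob_nonnull.
  exact/probP.
have Lp_prob p eps : ~ null_process X -> 0 < p -> 0 < eps -> in_Lp p eps -> in_prob.
  move=> nn p0 e0 h; apply/probP.
  apply: (near_one_transfer hX b01 nn (capped_sandwiched hX b01 e0)).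
    exact: tau_sandwiched.
  exact: (in_Lp_near_one hX b01 C_gt0 p0 e0).
(* Convergence at the two caps 1 and 3 rules out the null process, so that [Lp_prob] becomes
   available. *)
have Lp_nonnull p : 0 < p -> (forall eps, 0 < eps -> in_Lp p eps) -> ~ null_process X.
  move=> p0 h; apply: (capped_near_one_nonnull hX b01 C_gt0).
    by apply: (in_Lp_near_one hX b01 C_gt0 p0 ltr01); apply: h.
  by apply: (in_Lp_near_one hX b01 C_gt0 p0 (ltr0Sn R 2)); apply: h.
split.
- split=> [h p eps|h]; first exact: prob_Lp.
  apply: (Lp_prob 1 1) => //; last exact: h.
  by apply: (Lp_nonnull 1) => // eps; exact: h.
- split=> [h|[p p0 h]]; first by exists 1 => // eps; exact: prob_Lp.
  by apply: (Lp_prob p 1) => //; [exact: (Lp_nonnull p)|exact: h].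
- move=> nn; split=> [h|[p [eps [p0 e0 h]]]].
    by exists 1, 1; split => //; exact: prob_Lp.
  exact: (Lp_prob p eps).
- move=> h p eps p0 e0; apply: (near_one_moment hX b01 C_gt0) => //.
    exact: prob_nonnull.
  exact/probP.
Qed.
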